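(* Let $Z(X_\Gamma,u)=Z_{1,1}(X_\Gamma,u)Z_{1,2}(X_\Gamma,u)$, where for $i=1,2$, $Z_{1,i}(X_\Gamma,u)=\prod_{[C]}(1-u^{l_A([C])})^{-1}$ with $[C]$ running through the equivalence classes of tailless primitive closed geodesics in $X_\Gamma$ consisting of edges of type $i$. Then $$Z(X_\Gamma,u)=\frac{(1-u^3)^{\chi(X_\Gamma)}}{\det(I-A_1u+qA_2u^2-q^3u^3I)\,\det(I+L_Bu)},$$ where $\chi(X_\Gamma)$ is the Euler characteristic of $X_\Gamma$, $A_1,A_2$ are the type $1$ and type $2$ adjacency operators on vertices of $X_\Gamma$, and $L_B$ is the adjacency operator on pointed chambers of $X_\Gamma$.
   Context: $F$ is a nonarchimedean local field with ring of integers $\mathcal O_F$, uniformizer $\pi$, residue field of $q$ elements and valuation $\mathrm{ord}_\pi$. $G=\mathrm{GL}_3(F)$, $Z$ is its center, $K=\mathrm{GL}_3(\mathcal O_F)$. **Building.** $\mathcal B$ is the Bruhat-Tits building of $\mathrm{PGL}_3(F)$: its vertices are homothety classes $[L]$ of rank-3 $\mathcal O_F$-lattices in $F^3$, identified with $G/KZ$ via $gKZ\mapsto$ class of the lattice spanned by the columns of $g$. Distinct $[L],[L']$ are adjacent if representatives satisfy $\pi L\subset L'\subset L$; the directed edge $([L],[L'])$ has type $i\in\{1,2\}$ if $L'$ has index $q^i$ in $L$. A triple of distinct vertices $([L],[L'],[L''])$ with $\pi L\subset L''\subset L'\subset L$ is a pointed chamber; the unordered triple is a chamber (2-simplex). The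 out-neighbors of a pointed chamber $(v_1,v_2,v_3)$ are the pointed chambers $(v_2,v_3,v_4)$ with $v_4\neq v_1$. **$\Gamma$ and operators.** $\Gamma$ is a discrete torsion-free subgroup of $G$ with $\Gamma\backslash G/Z$ compact, meeting every conjugate of $KZ$ trivially, with $\mathrm{ord}_\pi\det\Gamma\subset3\mathbb Z$. $X_\Gamma=\Gamma\backslash\mathcal B$ is a finite 2-dimensional complex. $A_i$ ($i=1,2$) is the matrix indexed by vertices of $X_\Gamma$ whose $(v,v')$ entry is the number of type $i$ directed edges from $v$ to $v'$. $L_B$ is the matrix indexed by pointed chambers of $X_\Gamma$ (the $\Gamma$-orbits of pointed chambers of $\mathcal B$) whose $(c,c')$ entry is the number of times $c'$ is an out-neighbor of $c$, induced from $\mathcal B$. **Cycles.** A cycle in $X_\Gamma$ is an oriented closed path in the 1-skeleton with a starting vertex, possibly repeating vertices. A 1-geodesic in $\mathcal B$ is a shortest path in the 1-skeleton between its endpoints; it is a geodesic iff all its edges have the same type. A cycle in $X_\Gamma$ is 1-geodesic (resp. geodesic) if it lifts to such a path in $\mathcal B$. Two cycles are equivalent if one is obtained from the other by changing the starting vertex. A cycle is tailless if all equivalent cycles are 1-geodesic, and primitive if it is not a repetition (more than once) of a shorter cycle. A closed geodesic with $k$ edges, all of type $i$, has algebraic length $l_A=ik$; $l_A([C])$ is the algebraic length of any member of $[C]$. *)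

(* Defs.v *)
From HB Require Import structures.
From mathcomp Require Import all_boot all_order all_algebra finmap.
From mathcomp Require Import boolp classical_sets functions cardinality.
From mathcomp Require Import topology.

Set Implicit Arguments.
Unset Strict Implicit.
Unset Printing Implicit Defensive.

Import Order.TTheory GRing.Theory Num.Theory.
Local Open Scope classical_set_scope.
Local Open Scope ring_scope.

Record fps (R : Type) := Fps { fps_coef :> nat -> R }.

Lemma fpsP (R : Type) (a b : fps R) : a =1 b -> a = b.
Proof. by case: a b => [a] [b] /= /funext ->. Qed.

HB.instance Definition _ (R : Type) := gen_eqMixin (fps R).
HB.instance Definition _ (R : Type) := gen_choiceMixin (fps R).

Section FpsRing.
Variable R : comNzRingType.
Implicit Types a b c : fps R.

Definition fps_zero : fps R := Fps (fun=> 0).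
Definition fps_opp a : fps R := Fps (fun n => - a n).
Definition fps_add a b : fps R := Fps (fun n => a n + b n).
Definition fps_one : fps R := Fps (fun n => (n == 0%N)%:R).
Definition fps_mul a b : fps R := Fps (fun n => \sum_(i < n.+1) a i * b (n - i)%N).

Let addA : associative fps_add.
Proof. by move=> a b c; apply: fpsP => n /=; rewrite addrA. Qed.
Let addC : commutative fps_add.
Proof. by move=> a b; apply: fpsP => n /=; rewrite addrC. Qed.
Let add0 : left_id fps_zero fps_add.
Proof. by move=> a; apply: fpsP => n /=; rewrite add0r. Qed.
Let addN : left_inverse fps_zero fps_opp fps_add.
Proof. by move=> a; apply: fpsP => n /=; rewrite addNr. Qed.

HB.instance Definition _ := GRing.isZmodule.Build (fps R) addA addC add0 addN.

Let trunc n a : {poly R} := \poly_(i < n.+1) a i.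

Let trunc_mul n m a b : (m <= n)%N -> fps_mul a b m = (trunc n a * trunc n b)`_m.
Proof.
move=> le_mn; rewrite coefM /=; apply: eq_bigr => i _.
by rewrite !coef_poly ltnS (leq_trans (leq_ord i) le_mn) ltnS
           (leq_trans (leq_subr _ _) le_mn).
Qed.

Let mulC : commutative fps_mul.
Proof. by move=> a b; apply: fpsP => n; rewrite !(trunc_mul _ _ (leqnn n)) mulrC. Qed.

Let mulA : associative fps_mul.
Proof.
have aux a b c n :
    fps_mul a (fps_mul b c) n = (trunc n a * (trunc n b * trunc n c))`_n.
  rewrite coefM; apply: eq_bigr => i _.
  by rewrite (@trunc_mul n) ?leq_subr// coef_poly ltn_ord.
move=> a b c; apply: fpsP => n.
by rewrite [in RHS]mulC !aux mulrCA [in RHS]mulrC -mulrA mulrCA mulrA.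
Qed.

Let mul1 : left_id fps_one fps_mul.
Proof.
move=> a; apply: fpsP => n /=.
by rewrite big_ord_recl /= mul1r subn0 big1 ?addr0// => i _; rewrite mul0r.
Qed.

Let mulDl : left_distributive fps_mul fps_add.
Proof.
move=> a b c; apply: fpsP => n /=.
by rewrite -big_split; apply: eq_bigr => i _; rewrite mulrDl.
Qed.

Let one_neq0 : fps_one != 0.
Proof.
by apply/eqP => /(congr1 (fun a : fps R => a 0%N)) /eqP; rewrite oner_eq0.
Qed.

HB.instance Definition _ :=
  GRing.Zmodule_isComNzRing.Build (fps R) mulA mulC mul1 mulDl one_neq0.

Definition fpsX : fps R := Fps (fun n => (n == 1%N)%:R).

(* Product of a family of series with constant coefficient 1: the n-th
   coefficient only depends on the factors not congruent to 1 modulo X^(n+1).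
   It is meaningful when there are finitely many of them for every n. *)
Definition fps_prod (I : choiceType) (A : set I) (f : I -> fps R) : fps R :=
  Fps (fun n =>
    (\prod_(i <- fset_set [set i | A i /\ exists2 k, (0 < k <= n)%N & f i k != 0])
       f i) n).

End FpsRing.

Section FpsUnit.
Variable R : comUnitRingType.
Implicit Types a b : fps R.

Fixpoint fps_inv_seq a n : seq R :=
  if n is m.+1 then
    let s := fps_inv_seq a m in
    rcons s (- (a 0%N)^-1 * \sum_(i < m.+1) a (m.+1 - i)%N * s`_i)
  else [:: (a 0%N)^-1].

Definition fps_unit : pred (fps R) := fun a => a 0%N \is a GRing.unit.
Definition fps_inv a : fps R :=
  if fps_unit a then Fps (fun n => (fps_inv_seq a n)`_n) else a.

Let size_inv_seq a n : size (fps_inv_seq a n) = n.+1.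
Proof. by elim: n => //= n IH; rewrite size_rcons IH. Qed.

Let nth_inv_seq a n i :
  (i <= n)%N -> (fps_inv_seq a n)`_i = (fps_inv_seq a i)`_i.
Proof.
elim: n => [|n IH]; first by rewrite leqn0 => /eqP->.
rewrite leq_eqVlt => /predU1P[->//|]; rewrite ltnS => le_in.
by rewrite /= nth_rcons size_inv_seq ltnS le_in IH.
Qed.

Let mulV : {in fps_unit, left_inverse 1 fps_inv *%R}.
Proof.
move=> a ua; rewrite /fps_inv [fps_unit a]ua; apply: fpsP => -[|n] /=.
  by rewrite big_ord1 mulVr.
rewrite big_ord_recr /= subnn nth_rcons size_inv_seq ltnn eqxx.
rewrite mulrAC mulNr mulVr// mulN1r; apply/eqP; rewrite subr_eq0; apply/eqP.
apply: eq_bigr => i _; rewrite mulrC; congr (_ * _).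
by rewrite [RHS]nth_inv_seq ?leq_ord.
Qed.

Let unitP a b : b * a = 1 -> fps_unit a.
Proof.
move=> /(congr1 (fun c : fps R => c 0%N)) /=; rewrite big_ord1 => ba1.
have {}ba1 : b 0%N * a 0%N = 1 := ba1.
by apply/unitrP; exists (b 0%N); rewrite [a _ * _]mulrC.
Qed.

Let inv_out : {in [predC fps_unit], fps_inv =1 id}.
Proof. by move=> a ua; rewrite /fps_inv ifN. Qed.

HB.instance Definition _ :=
  GRing.ComNzRing_hasMulInverse.Build (fps R) mulV unitP inv_out.

End FpsUnit.

(* The cardinal of a finite set; 0 for infinite sets. *)
Definition card (T : choiceType) (A : set T) : nat := #|` fset_set A |%fset.

(* A must be finite; the determinant does not depend on the enumeration. *)
Definition mx_on (S : pzRingType) (T : choiceType) (A : set T) (f : T -> T -> S) :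
    'M[S]_(size (fset_set A)) :=
  let x := tnth (in_tuple (fset_set A : seq T)) in \matrix_(i, j) f (x i) (x j).

(* For an additive subgroup B of A: B has index n in A. *)
Definition has_index (V : zmodType) (A B : set V) (n : nat) : Prop :=
  ([set [set x + y | y in B] | x in A] #= `I_n)%card.

Section Building.
Variables (F : fieldType) (ord : F -> int) (pi : F) (q : nat).

(* The value of ord at 0, morally +oo, is irrelevant. *)
Definition ord_ge (n : int) (x : F) : bool := (x == 0) || (n <= ord x).

Definition O_F : set F := [set x | ord_ge 0 x].

(* F is complete for the normalized discrete valuation ord, with uniformizer
   pi and residue field of q elements. *)
Record nonarch_local_field : Prop := NonarchLocalField {
  ordM : forall x y, x != 0 -> y != 0 -> ord (x * y) = ord x + ord y;
  ord_geD : forall n x y, ord_ge n x -> ord_ge n y -> ord_ge n (x + y);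
  uniformizer : pi != 0 /\ ord pi = 1;
  ord_complete : forall a : nat -> F,
    (forall n, exists N, forall i j,
       (N <= i)%N -> (N <= j)%N -> ord_ge n (a i - a j)) ->
    exists l, forall n, exists N, forall i, (N <= i)%N -> ord_ge n (a i - l);
  residue_card : has_index O_F [set pi * x | x in O_F] q }.

Definition GL3 : set 'M[F]_3 := [set g | g \in unitmx].

Definition GL3_O : set 'M[F]_3 :=
  [set g | [/\ GL3 g, forall i j, O_F (g i j) & forall i j, O_F (invmx g i j)]].

Definition conj_KZ (g : 'M[F]_3) : set 'M[F]_3 :=
  [set x | exists k c, [/\ GL3_O k, c != 0 & x = g *m (c *: k) *m invmx g]].

(* Subsets of GL_3(F) open in the topology induced by F^(3 x 3). *)
Definition GL3_open (U : set 'M[F]_3) : Prop :=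
  U `<=` GL3 /\ forall g, U g -> exists n, forall h, GL3 h ->
    (forall i j, ord_ge n (h i j - g i j)) -> U h.

Variable Gamma : set 'M[F]_3.

Record GL3_subgroup : Prop := GL3Subgroup {
  subgroup_GL3 : Gamma `<=` GL3;
  subgroup1 : Gamma 1%:M;
  subgroupM : forall g h, Gamma g -> Gamma h -> Gamma (g *m h);
  subgroupV : forall g, Gamma g -> Gamma (invmx g) }.

Definition discrete_subgroup : Prop :=
  forall g, Gamma g -> exists2 U, GL3_open U & Gamma `&` U = [set g].

Definition torsion_free : Prop :=
  forall g n, Gamma g -> (0 < n)%N -> g ^+ n = 1 -> g = 1.

Definition dcoset (g : 'M[F]_3) : set 'M[F]_3 :=
  [set x | exists h c, [/\ Gamma h, c != 0 & x = h *m g *m c%:M]].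

(* Gamma \ G / Z; ord occurs only so that the type carries the topology that
   it induces. *)
Definition dcoset_space : Type :=
  let _ := ord in {D : set 'M[F]_3 | D \in dcoset @` GL3}.

(* Quotient topology: D is open iff its preimage in G is. *)
Definition dcoset_open (D : set dcoset_space) : Prop :=
  GL3_open [set g | GL3 g /\ exists2 d, D d & val d = dcoset g].

Lemma dcoset_openT : dcoset_open setT.
Proof.
split=> [g []//|g [Gg _]]; exists 0 => h Gh _; split=> //.
have dh : dcoset h \in dcoset @` GL3 by rewrite inE; exists h.
by exists (exist _ (dcoset h) dh).
Qed.

Lemma dcoset_openI : setI_closed dcoset_open.
Proof.
move=> A B [_ oA] [_ oB]; split=> [g []//|g [Gg [d [Ad Bd] dg]]].
have [|m hm] := oA g; first by split=> //; exists d.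
have [|n hn] := oB g; first by split=> //; exists d.
exists (Num.max m n) => h Gh hgh.
have ge_le k l x : k <= l -> ord_ge l x -> ord_ge k x.
  by move=> kl /orP[/eqP->|lx]; rewrite /ord_ge ?eqxx// (le_trans kl) ?orbT.
have [|_ [a Aa ah]] := hm h Gh.
  by move=> i j; apply: ge_le (hgh i j); rewrite le_max lexx.
have [|_ [b Bb bh]] := hn h Gh.
  by move=> i j; apply: ge_le (hgh i j); rewrite le_max lexx orbT.
split=> //; exists a => //; split=> //.
by rewrite (_ : a = b)//; apply: val_inj; rewrite ah bh.
Qed.

Lemma dcoset_open_bigU (I : Type) (f : I -> set dcoset_space) :
  (forall i, dcoset_open (f i)) -> dcoset_open (\bigcup_i f i).
Proof.
move=> of_; split=> [g []//|g [Gg [d [i _ fid] dg]]].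
have [|n hn] := (of_ i).2 g; first by split=> //; exists d.
exists n => h Gh hgh; have [_ [a fa ah]] := hn h Gh hgh.
by split=> //; exists a => //; exists i.
Qed.

HB.instance Definition _ := Choice.on dcoset_space.
HB.instance Definition _ := isOpenTopological.Build dcoset_space
  dcoset_openT dcoset_openI dcoset_open_bigU.

(* The O_F-lattice spanned by the columns of g. *)
Definition lattice_of (g : 'M[F]_3) : set 'cV[F]_3 :=
  [set g *m x | x in [set x : 'cV[F]_3 | forall i, O_F (x i 0)]].

Definition scale_set (c : F) (L : set 'cV[F]_3) : set 'cV[F]_3 :=
  [set c *: x | x in L].

Definition homothety_class (L : set 'cV[F]_3) : set (set 'cV[F]_3) :=
  [set scale_set c L | c in [set c | c != 0]].

Local Notation vtx := (set (set 'cV[F]_3)).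

Definition vertex : set vtx := [set homothety_class (lattice_of g) | g in GL3].

Definition adjacent (v v' : vtx) : Prop :=
  [/\ vertex v, vertex v', v <> v' &
    exists L L', [/\ v L, v' L', scale_set pi L `<=` L' & L' `<=` L]].

Definition adjacent_type (i : nat) (v v' : vtx) : Prop :=
  [/\ vertex v, vertex v', v <> v' &
    exists L L', [/\ v L, v' L', scale_set pi L `<=` L', L' `<=` L &
      has_index L L' (q ^ i)]].

Definition directed_edge : set (vtx * vtx) := [set e | adjacent e.1 e.2].
Definition typed_edge (i : nat) : set (vtx * vtx) :=
  [set e | adjacent_type i e.1 e.2].

Definition pointed_chamber : set (vtx * vtx * vtx) :=
  [set c | [/\ vertex c.1.1, vertex c.1.2, vertex c.2,
    [/\ c.1.1 <> c.1.2, c.1.2 <> c.2 & c.1.1 <> c.2] &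
    exists L L' L'', [/\ c.1.1 L, c.1.2 L', c.2 L'' &
      [/\ scale_set pi L `<=` L'', L'' `<=` L' & L' `<=` L]]]].

Definition out_neighbor : set ((vtx * vtx * vtx) * (vtx * vtx * vtx)) :=
  [set a | [/\ pointed_chamber a.1, pointed_chamber a.2,
    a.2.1 = (a.1.1.2, a.1.2) & a.2.2 <> a.1.1.1]].

Definition edge : set (set vtx) := [set [set e.1; e.2] | e in directed_edge].
Definition chamber : set (set vtx) :=
  [set [set c.1.1; c.1.2; c.2] | c in pointed_chamber].

Definition act (g : 'M[F]_3) (v : vtx) : vtx :=
  [set [set g *m x | x in L] | L in v].
Definition act2 g (e : vtx * vtx) := (act g e.1, act g e.2).
Definition act3 g (c : vtx * vtx * vtx) := (act2 g c.1, act g c.2).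
Definition act33 g (a : (vtx * vtx * vtx) * (vtx * vtx * vtx)) :=
  (act3 g a.1, act3 g a.2).
Definition act_set g (s : set vtx) : set vtx := [set act g v | v in s].

Definition orbit (T : Type) (a : 'M[F]_3 -> T -> T) (x : T) : set T :=
  [set a g x | g in Gamma].
Definition orbits (T : Type) (a : 'M[F]_3 -> T -> T) (A : set T) : set (set T) :=
  [set orbit a x | x in A].

Definition Xvertex : set (set vtx) := orbits act vertex.
Definition Xedge : set (set (set vtx)) := orbits act_set edge.
Definition Xchamber : set (set (set vtx)) := orbits act_set chamber.
Definition Xdirected_edge : set (set (vtx * vtx)) := orbits act2 directed_edge.
Definition Xtyped_edge (i : nat) : set (set (vtx * vtx)) :=
  orbits act2 (typed_edge i).
Definition Xpointed_chamber : set (set (vtx * vtx * vtx)) :=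
  orbits act3 pointed_chamber.

Definition euler_char : int :=
  (card Xvertex)%:Z - (card Xedge)%:Z + (card Xchamber)%:Z.

(* Edges of the quotient are orbits of directed edges, so that parallel edges
   are counted; fst @` e and snd @` e are the orbits of the end points of e. *)
Definition A_mx (i : nat) :=
  mx_on Xvertex (fun v v' =>
    (card [set e | [/\ Xtyped_edge i e, fst @` e = v & snd @` e = v']])%:R
      : fps int).

Definition LB_mx :=
  mx_on Xpointed_chamber (fun c c' =>
    (card [set a | [/\ orbits act33 out_neighbor a, fst @` a = c &
      snd @` a = c']])%:R : fps int).

(* A cycle is the sequence of its directed edges; it starts at the origin of
   the first one. Recording edges rather than vertices matters because X_Gamma
   may have several edges between two vertices. *)
Local Notation xcycle := (seq (set (vtx * vtx))).

Definition is_cycle (C : xcycle) : Prop :=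
  [/\ C <> [::], forall e, e \in C -> Xdirected_edge e &
    cycle (fun e e' => `[< snd @` e = fst @` e' >]) C].

(* In the building, x :: p is the sequence of vertices of a path. *)
Definition is_path (x : vtx) (p : seq vtx) : Prop :=
  vertex x /\ path (fun v v' => `[< adjacent v v' >]) x p.

Definition one_geodesic (x : vtx) (p : seq vtx) : Prop :=
  is_path x p /\
  forall p', is_path x p' -> last x p' = last x p -> (size p <= size p')%N.

Definition geodesic (x : vtx) (p : seq vtx) : Prop :=
  one_geodesic x p /\ exists2 i, i \in [:: 1%N; 2%N] &
    path (fun v v' => `[< adjacent_type i v v' >]) x p.

Definition lifts_to (C : xcycle) (x : vtx) (p : seq vtx) : Prop :=
  pairmap (fun v v' => orbit act2 (v, v')) x p = C.

Definition one_geodesic_cycle (C : xcycle) : Prop :=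
  is_cycle C /\ exists x p, lifts_to C x p /\ one_geodesic x p.

Definition geodesic_cycle (C : xcycle) : Prop :=
  is_cycle C /\ exists x p, lifts_to C x p /\ geodesic x p.

Definition cycle_class (C : xcycle) : set xcycle :=
  [set C' | exists n, C' = rot n C].

Definition tailless (C : xcycle) : Prop :=
  forall C', cycle_class C C' -> one_geodesic_cycle C'.

Definition primitive (C : xcycle) : Prop :=
  ~ exists D n, [/\ is_cycle D, (1 < n)%N & C = flatten (nseq n D)].

Definition geodesic_classes (i : nat) : set (set xcycle) :=
  [set cycle_class C | C in [set C | [/\ geodesic_cycle C,
    forall e, e \in C -> Xtyped_edge i e, tailless C & primitive C]]].

(* All members of a class have the same number of edges. *)
Definition class_length (i : nat) (c : set xcycle) : nat :=
  (i * size (xget [::] c))%N.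

Definition zeta_type (i : nat) : fps int :=
  fps_prod (geodesic_classes i)
    (fun c => (1 - fpsX int ^+ class_length i c)^-1).

Definition zeta : fps int := zeta_type 1 * zeta_type 2.

End Building.

(* Main.v *)
From HB Require Import structures.
Require Import Defs.
From mathcomp Require Import all_boot all_order all_algebra finmap.
From mathcomp Require Import boolp classical_sets functions cardinality topology.
From mathcomp Require Import fingroup perm mxabelem path.
From mathcomp Require Import ring zify.

Set Implicit Arguments.
Unset Strict Implicit.
Unset Printing Implicit Defensive.

Import Order.TTheory GRing.Theory Num.Theory.
Local Open Scope classical_set_scope.
Local Open Scope ring_scope.

(** Write X for the quotient complex, V, E and B for the sets of its vertices, type 1 edges
    and pointed chambers, and u for the variable. The theorem combines an Euler product with
    an identity between determinants.

    Euler product. In the building, a path whose edges all have the same type is a geodesic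
    if and only if it is straight: no three consecutive vertices are pairwise adjacent
    ([straight_path_geodesic], [geodesic_is_straight]). In terms of lattices, a path of type 1
    is a descending chain with steps of index q. After n straight steps from L the chain
    reaches a lattice that does not contain pi^(n-1) L, and a path with fewer than n steps
    cannot end at its class. Being geodesic is thus a condition on consecutive edges, and the
    classes of tailless primitive closed geodesics of type i are the primitive cyclic words in
    the edges of type i for the relation T_i of straight continuation ([geodesic_classesE]).
    For any relation on a finite set, the product over these classes is 1 / det (1 - u^i T_i), because both sides have a logarithmic derivative
    that counts closed walks ([euler_product]). Reversal of edges turns T_2 into the transpose
    of T_1, so that Z = 1 / (det (1 - u L) det (1 - u^2 L^T)) with L the transpose of T_1.

    Determinants. Let s and e be the matrices of origins and ends (V by E), D0 and D1 those of
    the faces (v1, v2) and (v2, v3) of a pointed chamber (E by B), P the rotation of pointed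
    chambers, and M = D1 D0^T. Then L = s^T e - M, since a continuation that is not straight
    follows a chamber ([straight_mxE]), and the transpose of L_B is D0^T D1 - P ([LB_mxE]). The
    link of a vertex is the projective plane over the residue field, of order q; this yields
    D0 D0^T = q + 1, M M^T = q + s^T s and M^T M = q + e^T e ([face0_mx_tr], [face_mx_MMt],
    [face_mx_MtM]). With N = 1 + q u^3 + u M + u^2 M^T, the product (1 - u L) (1 - u^2 L^T)
    differs from N by a matrix that factors through the space spanned by the columns of s^T,
    e^T and M s^T, which N preserves. Sylvester's identity therefore compares their
    determinants on 3 |V| coordinates ([edge_det_identity]):
      (1 - u^3)^|V| det (1 - u L) det (1 - u^2 L^T)
        = det N det (1 - A_1 u + q A_2 u^2 - q^3 u^3).
    As P^3 = 1, the rotation can be eliminated from 1 + u L_B in the same way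
    ([chamber_det_identity]):
      (1 - u^3)^|E| det (1 + u L_B) = det (1 - u P) det N.
    Finally det (1 - u P) is 1 - u^3 to the number of chambers ([det_rot_mx]), because the
    rotation has no fixed points: the valuation of determinants modulo 3, which Gamma
    preserves, changes along the edges of type 1. Elimination of det N leaves the Euler
    characteristic as the exponent of 1 - u^3 ([complex_det_identity]).

    Gamma meets the stabilizers of vertices trivially, so that configurations in X lift
    uniquely from one of their vertices and can be counted in the building ([free_action]).
    That X is finite follows from compactness of Gamma \ G / Z, because the vertex defined by
    g depends on g in a locally constant way ([finite_Xvertex]). *)

(** * Determinant identities for a complex of triangles *)

Section Determinants.
Variable R : comUnitRingType.

(** Sylvester's identity: one block matrix has a factorization for each side. *)
Lemma det_1BmulmxC m n (A : 'M[R]_(m, n)) (B : 'M[R]_(n, m)) :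
  \det (1%:M - A *m B) = \det (1%:M - B *m A).
Proof.
have E1 : block_mx (1%:M - A *m B) A 0 1%:M *m block_mx 1%:M 0 B 1%:M =
    block_mx 1%:M A B 1%:M.
  by rewrite mulmx_block !mulmx1 !mul1mx !mulmx0 !add0r subrK.
have E2 : block_mx 1%:M 0 B 1%:M *m block_mx 1%:M A 0 (1%:M - B *m A) =
    block_mx 1%:M A B 1%:M.
  rewrite mulmx_block !mulmx1 !mul1mx !mulmx0 !mul0mx !addr0.
  by rewrite addrC subrK.
have := congr1 determinant (etrans E1 (esym E2)).
by rewrite !det_mulmx !det_ublock !det_lblock !det1 !mulr1 !mul1r.
Qed.

(** The relation N T = T Nh also gives N^-1 T = T Nh^-1, so factoring N and Nh out leaves
    1 - T X and 1 - X T with X = Nh^-1 S. A perturbation of N that factors through an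
    invariant subspace is thereby computed on that subspace. *)
Lemma det_perturb_intertwined m n (N : 'M[R]_n) (Nh : 'M[R]_m)
    (T : 'M[R]_(n, m)) (S : 'M[R]_(m, n)) :
  N \in unitmx -> Nh \in unitmx -> N *m T = T *m Nh ->
  \det (N - T *m S) * \det Nh = \det N * \det (Nh - S *m T).
Proof.
move=> uN uNh NT.
have TN : invmx N *m T = T *m invmx Nh.
  by rewrite -[LHS](mulmxK uNh) -[invmx N *m T *m _]mulmxA -NT mulKmx.
have -> : N - T *m S = N *m (1%:M - T *m (invmx Nh *m S)).
  by rewrite mulmxBr mulmx1 [T *m (_ *m S)]mulmxA -TN !mulmxA mulmxV // mul1mx.
have -> : Nh - S *m T = Nh *m (1%:M - (invmx Nh *m S) *m T).
  by rewrite mulmxBr mulmx1 !mulmxA mulmxV // mul1mx.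
by rewrite !det_mulmx det_1BmulmxC mulrAC mulrA.
Qed.

End Determinants.

(** Here s and e are the origin and end matrices of the type 1 edges of a complex and M
    relates consecutive edges of a chamber, so that the matrix [Lt] below, which
    continues an edge without following a chamber, is the operator whose cycles are the
    geodesics. The hypotheses on M express that links of vertices are projective planes
    of order q. *)
Section EdgeIdentity.
Variables (R : comUnitRingType) (nV nE : nat).
Variables (M : 'M[R]_nE) (s e : 'M[R]_(nV, nE)) (q u : R).
Let n : R := q ^+ 2 + q + 1.
Let A1 := e *m s^T.
Let A2 := s *m e^T.
Hypothesis MMt : M *m M^T = q%:M + s^T *m s.
Hypothesis MtM : M^T *m M = q%:M + e^T *m e.
Hypothesis Mi : M *m e^T = (q + 1) *: s^T.
Hypothesis Mto : M^T *m s^T = (q + 1) *: e^T.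
Hypothesis MoMti : M *m s^T = M^T *m e^T.
Hypothesis ss : s *m s^T = n%:M.
Hypothesis ee : e *m e^T = n%:M.

(** The columns of s^T and e^T do not span a space stable under M and M^T; together with
    those of p they do. *)
Let p := M *m s^T.

Let Mp : M *m p = s^T *m A2 + q *: e^T.
Proof. by rewrite /p MoMti mulmxA MMt mulmxDl mul_scalar_mx addrC mulmxA. Qed.

Let Mtp : M^T *m p = e^T *m A1 + q *: s^T.
Proof. by rewrite /p mulmxA MtM mulmxDl mul_scalar_mx addrC mulmxA. Qed.

Let sM : s *m M = (q + 1) *: e.
Proof. by apply: (can_inj trmxK); rewrite trmx_mul Mto linearZ. Qed.

Let eMt : e *m M^T = (q + 1) *: s.
Proof. by apply: (can_inj trmxK); rewrite trmx_mul trmxK Mi linearZ. Qed.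

Let sp : s *m p = (q + 1) *: A1.
Proof. by rewrite /p mulmxA sM scalemxAl. Qed.

Let ep : e *m p = (q + 1) *: A2.
Proof. by rewrite /p MoMti mulmxA eMt scalemxAl. Qed.

(** The matrix on edges to which [chamber_det_identity] reduces 1 + u L_B. *)
Definition chamber_mx : 'M[R]_nE :=
  (1 + q * u ^+ 3)%:M + u *: M + u ^+ 2 *: M^T.

Let N := chamber_mx.

Let Theta : 'M[R]_(nE, nV + (nV + nV)) := row_mx s^T (row_mx e^T p).

(** N on the span of the columns of [Theta], in this generating family. *)
Let Nh : 'M[R]_(nV + (nV + nV)) :=
  block_mx (1 + q * u ^+ 3)%:M
    (row_mx ((q + 1) * u)%:M (u *: A2 + (q * u ^+ 2)%:M))
    (col_mx ((q + 1) * u ^+ 2)%:M u%:M)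
    (block_mx (1 + q * u ^+ 3)%:M ((q * u)%:M + u ^+ 2 *: A1)
       (u ^+ 2)%:M (1 + q * u ^+ 3)%:M).

Let No : N *m s^T =
  (1 + q * u ^+ 3) *: s^T + ((q + 1) * u ^+ 2) *: e^T + u *: p.
Proof.
rewrite /N /chamber_mx !mulmxDl mul_scalar_mx -!scalemxAl Mto -/p scalerA.
by rewrite [u ^+ 2 * _]mulrC addrAC.
Qed.

Let Ni : N *m e^T =
  ((q + 1) * u) *: s^T + (1 + q * u ^+ 3) *: e^T + u ^+ 2 *: p.
Proof.
rewrite /N /chamber_mx !mulmxDl mul_scalar_mx -!scalemxAl Mi -MoMti -/p scalerA.
by rewrite [u * _]mulrC [X in X + _]addrC.
Qed.

Let Np : N *m p =
  s^T *m (u *: A2 + (q * u ^+ 2)%:M) + e^T *m ((q * u)%:M + u ^+ 2 *: A1)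
  + (1 + q * u ^+ 3) *: p.
Proof.
rewrite /N /chamber_mx !mulmxDl mul_scalar_mx -!scalemxAl Mp Mtp.
rewrite !mulmxDr !mul_mx_scalar !scalerDr !scalerA -!scalemxAr.
by apply/matrixP => i j; rewrite !mxE; ring.
Qed.

Let NTheta : N *m Theta = Theta *m Nh.
Proof.
rewrite /Theta /Nh !mul_mx_row mul_row_block mul_row_col mul_mx_row mul_row_block.
rewrite add_row_mx !mul_mx_scalar No Ni Np; congr (row_mx _ (row_mx _ _)).
- by rewrite addrA.
- by rewrite addrA.
- by rewrite addrA.
Qed.

(** The terms of the product in [PE] that pass through vertices, which are those missing
    from N, are up to sign [Theta *m S]. *)
Let S : 'M[R]_(nV + (nV + nV), nE) :=
  col_mx (u *: e - ((q ^+ 2 - q) * u ^+ 3) *: s) (col_mx (u ^+ 2 *: s) 0).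

Let Lt := s^T *m e - M.

Let LtT : Lt^T = e^T *m s - M^T.
Proof. by rewrite /Lt linearB /= trmx_mul trmxK. Qed.

Let PE : (1%:M - u *: Lt) *m (1%:M - u ^+ 2 *: Lt^T) = N - Theta *m S.
Proof.
rewrite /Theta /S !mul_row_col mulmx0 addr0 !mulmxBr -!scalemxAr.
rewrite mulmx1 mulmxBl mul1mx -!scalemxAl.
have -> : Lt *m Lt^T =
    (n - (q + 1) - (q + 1)) *: (s^T *m s) + (q%:M + s^T *m s).
  rewrite LtT /Lt mulmxBl !mulmxBr MMt.
  rewrite -!mulmxA [e *m (e^T *m s)]mulmxA ee mul_scalar_mx eMt.
  rewrite -!scalemxAr [M *m (e^T *m s)]mulmxA Mi -scalemxAl.
  by apply/matrixP => i j; rewrite !mxE; ring.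
rewrite LtT /Lt /N /chamber_mx /n.
move: (s^T *m e) (s^T *m s) (e^T *m s) => a b c.
by apply/matrixP => i j; rewrite !mxE; ring.
Qed.

(** The matrix Nh - S Theta splits into a factor for each type: Lo yields the vertex
    determinant at u, and Li the one at u^2 with the types exchanged, which also divides
    det Nh and cancels. *)
Let Lo : 'M[R]_(nV + (nV + nV)) :=
  block_mx (1%:M - u *: A1) (row_mx (- q ^+ 2 * u)%:M (- (q * u) *: A2))
    (col_mx 0 u%:M) (block_mx 1%:M (q * u)%:M 0 1%:M).

Let Li : 'M[R]_(nV + (nV + nV)) :=
  block_mx 1%:M (row_mx 0 (q * u ^+ 2)%:M)
    (col_mx (- q ^+ 2 * u ^+ 2)%:M 0)
    (block_mx (1%:M - u ^+ 2 *: A2) (- (q * u ^+ 2) *: A1) (u ^+ 2)%:M 1%:M).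

Let PhE : Nh - S *m Theta = Lo *m Li.
Proof.
rewrite /S /Theta mul_col_row [X in block_mx _ _ X _]mul_col_mx.
rewrite [X in block_mx _ X _ _]mul_mx_row mul_col_row !mul0mx.
rewrite opp_block_mx add_block_mx.
rewrite opp_col_mx opp_row_mx opp_block_mx add_col_mx add_row_mx add_block_mx.
rewrite /Lo /Li mulmx_block.
rewrite [X in _ = block_mx (X + _) _ _ _]mulmx1.
rewrite [X in _ = block_mx (_ + X) _ _ _]mul_row_col.
rewrite mul_row_block mul_mx_row add_row_mx.
rewrite mul_block_col mulmx1 mulmx_block add_col_mx mul_col_row add_block_mx.
rewrite !mulmxBl -!scalemxAl ss ee sp ep -/A1 -/A2.
rewrite ?(mulmxBr, mulmx0, mul0mx, mulmx1, mul1mx, mul_scalar_mx, mul_mx_scalar).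
by congr block_mx; [|congr row_mx|congr col_mx|congr block_mx];
  apply/matrixP => i j; rewrite /n !mxE; ring.
Qed.

Definition vertex_mx (v : R) (B1 B2 : 'M[R]_nV) : 'M[R]_nV :=
  1%:M - v *: B1 + (q * v ^+ 2) *: B2 - (q ^+ 3 * v ^+ 3)%:M.

Let det_Lo : \det Lo = \det (vertex_mx u A1 A2).
Proof.
pose X : 'M[R]_(nV + (nV + nV)) :=
  block_mx 1%:M 0 (col_mx (q * u ^+ 2)%:M (- u)%:M) 1%:M.
have dX : \det X = 1 by rewrite det_lblock !det1 mulr1.
rewrite -[LHS]mulr1 -dX -det_mulmx /Lo /X mulmx_block.
rewrite !mulmx0 !mulmx1 mul_row_col mul_block_col !add0r add_col_mx.
rewrite !mul1mx mul0mx !add0r -scalar_mxM mul_mx_scalar scalerA -scalar_mxM.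
have -> : (q * u ^+ 2)%:M + (q * u * - u)%:M = 0 :> 'M[R]_nV.
  by rewrite -raddfD /= -[RHS](raddf0 (@scalar_mx _ nV)); congr _%:M; ring.
have -> : u%:M + (- u)%:M = 0 :> 'M[R]_nV by rewrite -raddfD /= subrr raddf0.
rewrite col_mx0 !det_ublock !det1 !mulr1; congr (\det _).
by apply/matrixP => i j; rewrite !mxE; ring.
Qed.

Let det_Li : \det Li = \det (vertex_mx (u ^+ 2) A2 A1).
Proof.
pose X : 'M[R]_(nV + (nV + nV)) :=
  block_mx 1%:M (row_mx (q * u ^+ 4)%:M 0) 0
    (block_mx 1%:M 0 (- u ^+ 2)%:M 1%:M).
pose Y : 'M[R]_(nV + (nV + nV)) :=
  block_mx 1%:M 0 (col_mx (q ^+ 2 * u ^+ 2)%:M 0) 1%:M.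
have dX : \det X = 1 by rewrite det_ublock det_lblock !det1 !mulr1.
have dY : \det Y = 1 by rewrite det_lblock !det1 !mulr1.
rewrite -[LHS]mul1r -dY -[LHS]mulr1 -dX -!det_mulmx /Li /X /Y.
rewrite mulmx_block !mul1mx !mul0mx !mulmx1 !addr0 add_col_mx addr0.
have -> : (q ^+ 2 * u ^+ 2)%:M + (- q ^+ 2 * u ^+ 2)%:M = 0 :> 'M[R]_nV.
  by rewrite -raddfD /= -[RHS](raddf0 (@scalar_mx _ nV)); congr _%:M; ring.
rewrite col_mx0 mulmx_block !mul0mx !mulmx0 !mul1mx !add0r !addr0.
rewrite det_ublock det1 mul1r mul_col_row !mulmx0 !mul0mx add_block_mx.
rewrite !add0r mulmx_block !mulmx1 !mulmx0 mul1mx -scalar_mxM !add0r.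
have -> : (u ^+ 2)%:M + (- u ^+ 2)%:M = 0 :> 'M[R]_nV.
  by rewrite -raddfD /= subrr raddf0.
rewrite det_ublock det1 mulr1; congr (\det _).
rewrite mul_mx_scalar.
by apply/matrixP => i j; rewrite !mxE; ring.
Qed.

Let det_Nh : \det Nh = (1 - u ^+ 3) ^+ nV * \det (vertex_mx (u ^+ 2) A2 A1).
Proof.
(* X and Y are the column and row operations that reduce the first block row of Nh to 1,
   0, 0. *)
pose Z : 'M[R]_nV :=
  u *: A2 - (q * u ^+ 3) *: A1 + (q * u ^+ 2 + q ^+ 3 * u ^+ 5)%:M.
pose X : 'M[R]_(nV + (nV + nV)) :=
  block_mx 1%:M (row_mx (- u)%:M (- Z)) 0 1%:M.
pose Y : 'M[R]_(nV + (nV + nV)) :=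
  block_mx 1%:M (row_mx (- (q * u))%:M (q ^+ 2 * u ^+ 2)%:M) 0 1%:M.
have dX : \det X = 1 by rewrite det_ublock !det1 mulr1.
have dY : \det Y = 1 by rewrite det_ublock !det1 mulr1.
transitivity (\det (Y *m Nh *m X)).
  by rewrite !det_mulmx dX dY mul1r mulr1.
rewrite /Nh /X /Y.
rewrite mulmx_block !mul1mx !mul0mx !add0r mul_row_col mul_row_block add_row_mx.
rewrite mulmx_block !mulmx1 !mulmx0 !addr0 mul_mx_row add_row_mx.
rewrite mul_col_row add_block_mx.
set a11 := (X in block_mx X _ _ _).
have {a11}-> : a11 = 1%:M.
  by rewrite /a11 -!scalar_mxM -!raddfD /=; congr _%:M; ring.
rewrite ?mul1mx.
set a12 := (X in row_mx X _).
have {a12}-> : a12 = 0.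
  rewrite /a12 !mulmxDl -!scalar_mxM -!raddfD /= -[RHS](raddf0 (@scalar_mx _ nV)).
  by congr _%:M; ring.
set a13 := (X in row_mx _ X).
have {a13}-> : a13 = 0.
  rewrite /a13 /Z ?mulmxDl -?mulmxA ?mul_scalar_mx.
  by apply/matrixP => i j; rewrite !mxE; ring.
rewrite row_mx0 det_lblock det1 mul1r.
set a32 := (X in block_mx _ _ X _).
have {a32}-> : a32 = 0.
  rewrite /a32 -!scalar_mxM -!raddfD /= -[RHS](raddf0 (@scalar_mx _ nV)).
  by congr _%:M; ring.
rewrite det_ublock; congr (_ * _).
  rewrite -!scalar_mxM -!raddfD /= det_scalar; congr (_ ^+ _).
  by ring.
congr (\det _); rewrite /Z !mul_scalar_mx.
by apply/matrixP => i j; rewrite !mxE; ring.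
Qed.

(** [det_perturb_intertwined] for the invariant space [Theta]; the vertex determinant at
    u^2 occurs on both sides and is cancelled. *)
Lemma edge_det_identity :
    N \in unitmx -> vertex_mx (u ^+ 2) A2 A1 \in unitmx ->
    (1 - u ^+ 3) \is a GRing.unit ->
  (1 - u ^+ 3) ^+ nV * (\det (1%:M - u *: Lt) * \det (1%:M - u ^+ 2 *: Lt^T)) =
  \det N * \det (vertex_mx u A1 A2).
Proof.
move=> uN uD u3.
have uNh : Nh \in unitmx.
  by rewrite unitmxE det_Nh unitrM unitrX //= -unitmxE.
have := det_perturb_intertwined S uN uNh NTheta.
rewrite -PE PhE !det_mulmx det_Lo det_Li det_Nh => E.
have uD' : \det (vertex_mx (u ^+ 2) A2 A1) \is a GRing.unit by rewrite -unitmxE.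
apply: (mulIr uD'); rewrite -[RHS]mulrA -E.
by rewrite mulrAC mulrC mulrA.
Qed.

End EdgeIdentity.

Section ChamberIdentity.
Variables (R : comUnitRingType) (nE nB : nat).
Variables (D0 D1 D2 : 'M[R]_(nE, nB)) (Sg : 'M[R]_nB) (q u : R).
Hypothesis D0Sg : D0 *m Sg = D1.
Hypothesis D1Sg : D1 *m Sg = D2.
Hypothesis D2Sg : D2 *m Sg = D0.
Hypothesis SgSgT : Sg *m Sg^T = 1%:M.
Hypothesis Sg3 : Sg *m (Sg *m Sg) = 1%:M.
Hypothesis D00 : D0 *m D0^T = (q + 1)%:M.

Lemma face11 : D1 *m D1^T = (q + 1)%:M.
Proof.
by rewrite -D0Sg trmx_mul mulmxA -(mulmxA D0) SgSgT mulmx1.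
Qed.

Lemma face_rotate : D2 *m D1^T = D1 *m D0^T.
Proof.
by rewrite -D1Sg -D0Sg trmx_mul mulmxA -(mulmxA (D0 *m Sg)) SgSgT mulmx1.
Qed.

Lemma face20 : D2 *m D0^T = (D1 *m D0^T)^T.
Proof.
rewrite trmx_mul trmxK -D0Sg trmx_mul -{2}D2Sg.
by rewrite -!mulmxA [Sg *m (Sg^T *m _)]mulmxA SgSgT mul1mx.
Qed.

(** As Sg^3 = 1, the matrix J satisfies (1 - u Sg) J = 1 - u^3. Factoring 1 - u Sg out
    leaves a perturbation of 1 that factors through the edges, and the relations between
    Sg and the faces express D1 J D0^T by M = D1 D0^T and its transpose. *)
Lemma chamber_det_identity : 1 - u ^+ 3 \is a GRing.unit ->
  (1 - u ^+ 3) ^+ nE * \det (1%:M + u *: (D0^T *m D1 - Sg)) =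
  \det (1%:M - u *: Sg) * \det (chamber_mx (D1 *m D0^T) q u).
Proof.
move=> uc; set c := 1 - u ^+ 3 in uc *.
pose J : 'M[R]_nB := 1%:M + u *: Sg + u ^+ 2 *: (Sg *m Sg).
have KJ : (1%:M - u *: Sg) *m J = c%:M.
  rewrite /J mulmxBl !mul1mx !mulmxDr mulmx1 -!scalemxAl -!scalemxAr Sg3.
  by apply/matrixP => i j; rewrite /c !mxE; ring.
have -> : 1%:M + u *: (D0^T *m D1 - Sg) =
    (1%:M - u *: Sg) *m (1%:M - (- (u / c) *: (J *m D0^T)) *m D1).
  rewrite mulmxBr mulmx1 -!scalemxAl -!scalemxAr -(mulmxA J) [_ *m (J *m _)]mulmxA KJ.
  rewrite mul_scalar_mx scalerA mulNr divrK // scaleNr opprK scalerBr.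
  by rewrite addrCA addrC.
rewrite det_mulmx det_1BmulmxC mulrCA -det_scalar -det_mulmx.
congr (_ * \det _); rewrite mulmxBr mulmx1 mul_scalar_mx -scalemxAr scalerA.
rewrite mulrN mulrCA divrr // mulr1 scaleNr opprK /J.
rewrite !(mulmxDl, mulmxDr) mul1mx -!scalemxAl -!scalemxAr -mulmxA.
rewrite [D1 *m (Sg *m D0^T)]mulmxA [D1 *m (Sg *m (Sg *m _))]mulmxA D1Sg.
rewrite [D2 *m (Sg *m _)]mulmxA D2Sg D00 face20 /chamber_mx.
by apply/matrixP => i j; rewrite /c !mxE; ring.
Qed.

End ChamberIdentity.

Section ComplexIdentity.
Variables (R : comUnitRingType) (nV nE nB : nat).
Variables (s e : 'M[R]_(nV, nE)) (D0 D1 D2 : 'M[R]_(nE, nB)) (Sg : 'M[R]_nB).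
Variables (q u : R).
Let M := D1 *m D0^T.
Hypothesis eD0 : e *m D0 = s *m D1.
Hypothesis D0Sg : D0 *m Sg = D1.
Hypothesis D1Sg : D1 *m Sg = D2.
Hypothesis D2Sg : D2 *m Sg = D0.
Hypothesis SgSgT : Sg *m Sg^T = 1%:M.
Hypothesis Sg3 : Sg *m (Sg *m Sg) = 1%:M.
Hypothesis D00 : D0 *m D0^T = (q + 1)%:M.
Hypothesis MMt : M *m M^T = q%:M + s^T *m s.
Hypothesis MtM : M^T *m M = q%:M + e^T *m e.

Let tr_eq m n k (A A' : 'M[R]_(m, n)) (B B' : 'M[R]_(n, k)) :
  A *m B = A' *m B' -> B^T *m A^T = B'^T *m A'^T.
Proof. by move=> E; rewrite -!trmx_mul E. Qed.

Lemma face_end : M *m e^T = (q + 1) *: s^T.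
Proof.
rewrite /M -mulmxA (tr_eq eD0) mulmxA (face11 D0Sg SgSgT D00).
by rewrite mul_scalar_mx.
Qed.

Lemma face_start : M^T *m s^T = (q + 1) *: e^T.
Proof.
by rewrite /M trmx_mul trmxK -mulmxA -(tr_eq eD0) mulmxA D00 mul_scalar_mx.
Qed.

Lemma face_start_end : M *m s^T = M^T *m e^T.
Proof.
transitivity (D2 *m D1^T *m s^T); first by rewrite (face_rotate D0Sg D1Sg SgSgT).
by rewrite -mulmxA -(tr_eq eD0) mulmxA (face20 D0Sg D2Sg SgSgT).
Qed.

(** The number of edges that leave a vertex is a consequence of the other relations: M
    M^T s^T can be computed from M M^T, or from M^T s^T and M e^T. *)
Lemma out_degree_mul : s^T *m (s *m s^T) = (q ^+ 2 + q + 1) *: s^T.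
Proof.
have : M *m (M^T *m s^T) = q *: s^T + s^T *m (s *m s^T).
  by rewrite mulmxA MMt mulmxDl mul_scalar_mx -mulmxA.
rewrite face_start -scalemxAr face_end scalerA => E.
apply: (addrI (q *: s^T)); rewrite -E -scalerDl; congr (_ *: _); ring.
Qed.

Lemma in_degree_mul : e^T *m (e *m e^T) = (q ^+ 2 + q + 1) *: e^T.
Proof.
have : M^T *m (M *m e^T) = q *: e^T + e^T *m (e *m e^T).
  by rewrite mulmxA MtM mulmxDl mul_scalar_mx -mulmxA.
rewrite face_end -scalemxAr face_start scalerA => E.
apply: (addrI (q *: e^T)); rewrite -E -scalerDl; congr (_ *: _); ring.
Qed.

(** Eliminates det N, with N the matrix [chamber_mx], between the edge and the chamber
    identity. The powers of 1 - u^3 that remain, together with det (1 - u Sg), make up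
    the Euler characteristic. *)
Lemma complex_det_identity :
    s *m s^T = (q ^+ 2 + q + 1)%:M -> e *m e^T = (q ^+ 2 + q + 1)%:M ->
    chamber_mx M q u \in unitmx ->
    vertex_mx q (u ^+ 2) (s *m e^T) (e *m s^T) \in unitmx ->
    1 - u ^+ 3 \is a GRing.unit ->
  (1 - u ^+ 3) ^+ nV * \det (1%:M - u *: Sg) *
    (\det (1%:M - u *: (s^T *m e - M)) * \det (1%:M - u ^+ 2 *: (s^T *m e - M)^T)) =
  (1 - u ^+ 3) ^+ nE * (\det (vertex_mx q u (e *m s^T) (s *m e^T)) *
    \det (1%:M + u *: (D0^T *m D1 - Sg))).
Proof.
move=> ss ee uN uV u3.
rewrite [RHS]mulrCA (chamber_det_identity D0Sg D1Sg D2Sg SgSgT Sg3 D00) // mulrAC.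
rewrite (edge_det_identity MMt MtM face_end face_start face_start_end) //.
by rewrite -/M; ring.
Qed.

End ComplexIdentity.

Lemma unit_quotient (S : comUnitRingType) (U a b d e : S) (v n c : nat) :
    U \is a GRing.unit -> a \is a GRing.unit -> b \is a GRing.unit ->
    d \is a GRing.unit -> e \is a GRing.unit ->
  U ^+ v * U ^+ c * (d * e) = U ^+ n * (a * b) ->
  d^-1 / e = U ^ (v%:Z - n%:Z + c%:Z) / (a * b).
Proof.
move=> uU ua ub ud ue key; have uab : a * b \is a GRing.unit by rewrite unitrM ua.
have ude : d * e \is a GRing.unit by rewrite unitrM ud.
rewrite !exprzDr // -exprnN -!exprnP -invrM // [e * d]mulrC.
apply: (mulrI ude); rewrite divrr //.
apply: (mulrI (_ : U ^+ n * (a * b) \is a GRing.unit)); first by rewrite unitrM unitrX.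
rewrite mulr1 -[in LHS]key.
have un : U ^+ n \is a GRing.unit by rewrite unitrX.
transitivity ((U ^+ v * U ^+ c * (d * e)) * ((U ^+ n / U ^+ n) * ((a * b) / (a * b)))).
  by rewrite !divrr // !mulr1.
by ring.
Qed.

(** * Words, powers and rotations *)

Section Words.
Variable T : choiceType.
Implicit Types (C D E w x y z : seq T) (r : rel T).

Definition wpow k D : seq T := flatten (nseq k D).

Lemma wpowS k D : wpow k.+1 D = D ++ wpow k D.
Proof. by []. Qed.

Lemma wpowD a b D : wpow (a + b) D = wpow a D ++ wpow b D.
Proof. by rewrite /wpow nseqD flatten_cat. Qed.

Lemma wpow1 D : wpow 1 D = D.
Proof. by rewrite /wpow /= cats0. Qed.

Lemma wpowSr k D : wpow k.+1 D = wpow k D ++ D.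
Proof. by rewrite -addn1 wpowD wpow1. Qed.

Lemma wpowM k l D : wpow k (wpow l D) = wpow (k * l) D.
Proof. by elim: k => // k IH; rewrite wpowS IH mulSn wpowD. Qed.

Lemma size_wpow k D : size (wpow k D) = (k * size D)%N.
Proof. by elim: k => // k IH; rewrite wpowS size_cat IH mulSn. Qed.

Lemma mem_wpow k D : (0 < k)%N -> wpow k D =i D.
Proof.
case: k => // k _ a; elim: k => [|k IH]; first by rewrite wpow1.
by rewrite wpowS mem_cat IH orbb.
Qed.

Lemma wpow_inj k D E : (0 < k)%N -> wpow k D = wpow k E -> D = E.
Proof.
case: k => // k _ DE; have : size (wpow k.+1 D) = size (wpow k.+1 E) by rewrite DE.
rewrite !size_wpow => /eqP; rewrite eqn_pmul2l // => /eqP sDE.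
by move/eqP: DE; rewrite !wpowS eqseq_cat // => /andP[/eqP].
Qed.

Definition word_primitive C := ~ exists D n, (1 < n)%N /\ C = wpow n D.

Lemma primitive_nil C : word_primitive C -> C <> [::].
Proof. by move=> pC C0; apply: pC; exists [::], 2%N; rewrite C0. Qed.

Lemma primitive_wpow a D : word_primitive (wpow a D) -> a = 1%N.
Proof.
case: a => [|[|a]] // p; last by case: p; exists D, a.+2.
by case: (primitive_nil p).
Qed.

Lemma primitive_root_exists w : w <> [::] ->
  exists D k, [/\ word_primitive D, (0 < k)%N & w = wpow k D].
Proof.
have [n] := ubnP (size w); elim: n w => // n IH w; rewrite ltnS => szw w0.
have [pw|] := pselect (word_primitive w).
  by exists w, 1%N; rewrite wpow1.
move=> /contrapT[D [k [k1 wD]]].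
have D0 : D <> [::] by move=> D0; apply: w0; rewrite wD D0; elim: (k).
have szD : (size D < n)%N.
  apply: leq_trans szw; rewrite wD size_wpow ltn_Pmull //.
  by case: (D) D0.
have [E [l [pE l0 DE]]] := IH D szD D0.
by exists E, (k * l)%N; split; rewrite ?muln_gt0 ?l0 ?(ltnW k1) // wD DE wpowM.
Qed.

(** Euclid's algorithm on the lengths: the shorter word is a prefix of the longer one,
    and the rest commutes with it. *)
Lemma commuting_words x y : x ++ y = y ++ x ->
  exists z a b, x = wpow a z /\ y = wpow b z.
Proof.
have [n] := ubnP (size x + size y); elim: n x y => // n IH x y.
rewrite ltnS => szn xy.
case: (eqVneq x [::]) => [->|x0]; first by exists y, 0%N, 1%N; rewrite wpow1.
case: (eqVneq y [::]) => [->|y0]; first by exists x, 1%N, 0%N; rewrite wpow1.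
wlog lexy : x y szn xy x0 y0 / (size x <= size y)%N.
  move=> W; have [/W|/ltnW/W] := leqP (size x) (size y); first exact.
  by rewrite addnC => /(_ szn (esym xy) y0 x0) [z [a [b [? ?]]]]; exists z, b, a.
have yE : y = x ++ drop (size x) y.
  rewrite -[LHS](cat_take_drop (size x)); congr (_ ++ _).
  move: (congr1 (take (size x)) xy); rewrite take_size_cat // take_cat.
  case: ltnP => [_ <-//|le ->]; have sxy : size x = size y by apply/eqP; rewrite eqn_leq lexy.
  by rewrite sxy subnn take0 cats0 take_size.
move: yE; set y' := drop _ _ => yE; move: xy szn; rewrite yE -!catA => /eqP.
rewrite eqseq_cat // eqxx /= => /eqP xy' szn.
have [|z [a [b [xz yz]]]] := IH x y' _ xy'.
  by case: (x) x0 szn => //= ? ? _; rewrite size_cat; lia.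
by exists z, a, (a + b)%N; rewrite {1}xz wpowD -xz -yz.
Qed.

(** If powers of D and E agree then D and E commute, hence are powers of one word. *)
Lemma primitive_root_unique D E k l : word_primitive D -> word_primitive E ->
  (0 < k)%N -> (0 < l)%N -> wpow k D = wpow l E -> D = E.
Proof.
case: k l => // k [] // l pD pE _ _ DE; set w := wpow k.+1 D in DE.
have wD : w ++ D = D ++ w by rewrite /w -wpowSr.
have wE : w ++ E = E ++ w by rewrite DE -wpowSr.
have : (D ++ E) ++ (wpow l E ++ wpow k D) = (E ++ D) ++ (wpow k D ++ wpow l E).
  rewrite -!catA [E ++ (wpow l E ++ _)]catA -wpowS -DE [D ++ (w ++ _)]catA -wD.
  rewrite [D ++ (wpow k D ++ _)]catA -wpowS -/w [E ++ (w ++ _)]catA -wE.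
  by rewrite -!catA -wpowS -/w -wpowS -DE.
move/eqP; rewrite eqseq_cat ?size_cat 1?addnC // => /andP[/eqP comm _].
have [z [a [b [Dz Ez]]]] := commuting_words comm.
move: pD pE; rewrite Dz Ez => /primitive_wpow -> /primitive_wpow -> //.
Qed.

Lemma wpow_cat_shift n x y : wpow n (x ++ y) ++ x = x ++ wpow n (y ++ x).
Proof. by elim: n => [|n IH]; rewrite ?cats0 // !wpowS -!catA IH. Qed.

Lemma rot1_wpow n D : rot 1 (wpow n D) = wpow n (rot 1 D).
Proof.
case: D n => [|a D] [|n] //; first by rewrite /wpow; elim: n.
transitivity (rot (size [:: a]) ([:: a] ++ (D ++ wpow n ([:: a] ++ D)))) => //.
by rewrite rot_size_cat -catA wpow_cat_shift rot1_cons -cats1 wpowS -!catA.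
Qed.

Lemma rot_wpow n j D : exists D', rot j (wpow n D) = wpow n D'.
Proof.
elim: j => [|j [D' IH]]; first by exists D; rewrite rot0.
have [lt|le] := ltnP j (size (wpow n D)); last first.
  by exists D; rewrite rot_oversize // ltnW.
by exists (rot 1 D'); rewrite rotS // IH rot1_wpow.
Qed.

Lemma primitive_rot j C : word_primitive C -> word_primitive (rot j C).
Proof.
move=> pC [D [n [n1 rC]]]; apply: pC.
have [D' D'E] := rot_wpow n (size (rot j C) - j) D; exists D', n; split => //.
by rewrite -D'E -rC -/(rotr j (rot j C)) rotK.
Qed.

(** Otherwise a rotation of C would split into two commuting nonempty words and be a
    proper power. *)
Lemma primitive_rot_inj C i j : word_primitive C ->
  (i < size C)%N -> (j < size C)%N -> rot i C = rot j C -> i = j.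
Proof.
move=> pC; wlog lij : i j / (i <= j)%N.
  move=> W li lj E; have [/W|/ltnW/W] := leqP i j; first exact.
  by move=> /(_ lj li (esym E)).
move=> li lj; rewrite -{1}(subnK lij) rotD; last by rewrite subnK // ltnW.
set C' := rot i C; set d := (j - i)%N => E; apply/eqP; rewrite eqn_leq lij /=.
rewrite -subn_eq0 -/d; apply/negPn/negP => d0.
have pC' : word_primitive C' by apply: primitive_rot.
have ld : (d < size C')%N by rewrite size_rot /d; lia.
have [|z [a [b [tz dz]]]] := @commuting_words (take d C') (drop d C').
  by rewrite cat_take_drop [LHS]E.
apply: pC'; exists z, (a + b)%N; split; last first.
  by rewrite wpowD -tz -dz cat_take_drop.
have : size (take d C') = d by rewrite size_take ld.
have : size (drop d C') = (size C' - d)%N by rewrite size_drop.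
rewrite tz dz !size_wpow; case: (a) (b) => [|a'] [|b'] //=; lia.
Qed.

Lemma cycle_wpow r k D : (0 < k)%N -> cycle r (wpow k D) = cycle r D.
Proof.
case: k => // k _; case: D => [|x s]; first by rewrite /wpow; elim: k.
have split_x rest : path r x (rcons (s ++ x :: rest) x) =
    path r x (rcons s x) && path r x (rcons rest x).
  by rewrite rcons_cat cat_path /= !rcons_path -!andbA.
rewrite wpowS cat_cons /cycle.
elim: k => [|k IH]; first by rewrite cats0.
by rewrite wpowS cat_cons split_x IH andbb.
Qed.

Definition rotation_class C : set (seq T) := [set C' | exists n, C' = rot n C].

Lemma rotation_class_rot n C : rotation_class (rot n C) = rotation_class C.
Proof.
apply/seteqP; split => [_ [m ->]|_ [m ->]].
  by exists (rot_add C n m); rewrite rot_rot_add.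
exists (rot_add (rot n C) (size (rot n C) - n) m).
by rewrite -rot_rot_add -/(rotr n (rot n C)) rotK.
Qed.

Lemma size_rotation_class C C' : rotation_class C C' -> size C' = size C.
Proof. by move=> [n ->]; rewrite size_rot. Qed.

Lemma rotation_class_refl C : rotation_class C C.
Proof. by exists 0%N; rewrite rot0. Qed.

Lemma xget_rotation_class C : rotation_class C (xget [::] (rotation_class C)).
Proof. by apply: xgetPex; exists C; apply: rotation_class_refl. Qed.

End Words.

(** * Logarithmic derivatives of power series *)

Section LogDerivative.
Implicit Types f g h t : fps int.

(** The derivation u d/du, which preserves degrees. *)
Definition fps_theta f : fps int := Fps (fun n => f n *+ n).

Lemma fps_coef_theta f n : fps_theta f n = f n *+ n. Proof. by []. Qed.
Lemma fps_coefD f g n : (f + g) n = f n + g n. Proof. by []. Qed.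
Lemma fps_coefN f n : (- f) n = - f n. Proof. by []. Qed.
Lemma fps_coefM f g n : (f * g) n = \sum_(i < n.+1) f i * g (n - i)%N.
Proof. by []. Qed.
Lemma fps_coef1 n : (1 : fps int) n = (n == 0)%:R. Proof. by []. Qed.

Lemma fps_coefM0 f g : (f * g) 0%N = f 0%N * g 0%N.
Proof. by rewrite fps_coefM big_ord1. Qed.

Lemma fps_coef_sum I (r : seq I) (P : pred I) (F : I -> fps int) n :
  (\sum_(i <- r | P i) F i) n = \sum_(i <- r | P i) F i n.
Proof. by elim/big_rec2: _ => // i y1 y2 _ <-. Qed.

Lemma fps_coefX_mul f n : (fpsX int * f) n = if n is m.+1 then f m else 0.
Proof.
rewrite fps_coefM; case: n => [|n]; first by rewrite big_ord1 mul0r.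
rewrite big_ord_recl mul0r add0r big_ord_recl subn1 mul1r [X in _ + X]big1.
  by rewrite addr0.
by move=> i _; rewrite mul0r.
Qed.

Lemma fps_coefXn_mul k f n :
  (fpsX int ^+ k * f) n = if (k <= n)%N then f (n - k)%N else 0.
Proof.
elim: k n => [|k IH] n; first by rewrite expr0 mul1r subn0.
by rewrite exprS -mulrA fps_coefX_mul; case: n.
Qed.

Lemma fps_coefXn k n : (fpsX int ^+ k) n = (n == k)%:R.
Proof.
rewrite -[fpsX _ ^+ k]mulr1 fps_coefXn_mul fps_coef1 subn_eq0.
by case: ltngtP => // /ltnW.
Qed.

Lemma fps_unitE f : (f \is a GRing.unit) = (f 0%N \is a GRing.unit).
Proof. by []. Qed.

Lemma fps_unit_coef1 f : f 0%N = 1 -> f \is a GRing.unit.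
Proof. by rewrite fps_unitE => ->; apply: unitr1. Qed.

Lemma fps_coefV0 f : f 0%N = 1 -> f^-1 0%N = 1.
Proof.
move=> f0; have /mulVr/(congr1 (fun h : fps int => h 0%N)) := fps_unit_coef1 f0.
by rewrite fps_coefM0 f0 mulr1.
Qed.

Lemma fps_theta1 : fps_theta 1 = 0.
Proof. by apply: fpsP => -[|n] //=; rewrite mul0rn. Qed.

Lemma fps_thetaM f g : fps_theta (f * g) = fps_theta f * g + f * fps_theta g.
Proof.
apply: fpsP => n; rewrite fps_coefD !fps_coefM -big_split /=.
rewrite -sumrMnl; apply: eq_bigr => i _ /=.
by rewrite mulrnAl mulrnAr -mulrnDr subnKC // leq_ord.
Qed.

(** The logarithmic derivative u f'(u) / f(u) replaces the logarithm, which would need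
    rational coefficients. *)
Definition log_theta f t := f 0%N = 1 /\ fps_theta f = f * t.

Lemma log_theta1 : log_theta 1 0.
Proof. by split=> //; rewrite fps_theta1 mulr0. Qed.

Lemma log_thetaM f g t t' :
  log_theta f t -> log_theta g t' -> log_theta (f * g) (t + t').
Proof.
move=> [f0 ft] [g0 gt]; split; first by rewrite fps_coefM0 f0 g0.
by rewrite fps_thetaM ft gt; ring.
Qed.

Lemma log_thetaV f t : log_theta f t -> log_theta f^-1 (- t).
Proof.
move=> [f0 ft]; split; first exact: fps_coefV0.
have uf := fps_unit_coef1 f0.
have : fps_theta (f * f^-1) = 0 by rewrite divrr // fps_theta1.
rewrite fps_thetaM ft => E; apply: (mulrI uf).
apply/eqP; rewrite mulrA divrr // mul1r -addr_eq0 addrC.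
by rewrite -E -mulrA mulrCA divrr // mulr1.
Qed.

(** In u f' = f t the coefficient of u^m expresses m f_m by t and the coefficients of f
    below m; the truncated form compares an infinite product with its finite subproducts. *)
Lemma log_theta_coef_eq n f g t t' : log_theta f t -> log_theta g t' ->
    (forall m, (0 < m <= n)%N -> t m = t' m) ->
  forall m, (m <= n)%N -> f m = g m.
Proof.
have t0 h k : log_theta h k -> k 0%N = 0.
  move=> [h0 hk]; have := congr1 (fun h : fps int => h 0%N) hk.
  by rewrite fps_coefM0 h0 mul1r.
move=> ft gt tt; have {}tt m : (m <= n)%N -> t m = t' m.
  by case: m => [|m] le; [rewrite (t0 _ _ ft) (t0 _ _ gt) | apply: tt].
elim/ltn_ind => -[|m] IH le; first by case: ft gt => -> _ [->].
have E h k : log_theta h k -> h m.+1 *+ m.+1 = \sum_(i < m.+1) h i * k (m.+1 - i)%N.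
  move=> hk; have [_ /(congr1 (fun h : fps int => h m.+1))] := hk.
  by rewrite fps_coefM big_ord_recr /= subnn (t0 _ _ hk) mulr0 addr0.
apply/eqP; rewrite -[_ == _]/((m.+1 == 0)%N || _) -eqrMn2r (E _ _ ft) (E _ _ gt).
apply/eqP/eq_bigr => i _; congr (_ * _); last by rewrite tt // (leq_trans _ le) ?leq_subr.
by apply: IH => //; apply: leq_trans le; apply: ltnW.
Qed.

Lemma log_theta_unique f g t : log_theta f t -> log_theta g t -> f = g.
Proof. by move=> ft gt; apply: fpsP => n; apply: (log_theta_coef_eq ft gt _ (leqnn n)). Qed.

(** The shape of the logarithmic derivative of a function of u^l. *)
Definition fps_multiples l (c : nat -> int) : fps int :=
  Fps (fun m => if (0 < m)%N && (l %| m)%N then c (m %/ l)%N else 0).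

Lemma log_theta_1BXn l : (0 < l)%N ->
  log_theta (1 - fpsX int ^+ l) (- fps_multiples l (fun=> l%:R)).
Proof.
move=> l0; split.
  by rewrite fps_coefD fps_coefN fps_coefXn fps_coef1 (ltn_eqF l0) subr0.
rewrite mulrBl mul1r; apply: fpsP => n.
rewrite fps_coefD !fps_coefN fps_coefXn_mul /=.
rewrite fps_coefXn; case: (ltngtP n l) => [lt|gt|->].
- rewrite subr0 oppr0 addr0; case: n lt => [|n] lt; first by rewrite mulr0n oppr0.
  by rewrite mul0rn gtnNdvd ?andbF // oppr0.
- have n0 : (0 < n)%N by apply: leq_ltn_trans gt.
  rewrite n0 subn_gt0 gt /= (dvdn_subl (ltnW gt) (dvdnn l)).
  by rewrite gtn_eqF // subrr mul0rn addrN.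
- by rewrite subnn l0 dvdnn /= (gtn_eqF l0) oppr0 subr0 sub0r mulNrn.
Qed.

Lemma fps_coef_inv_1BXn l n : (0 < l)%N ->
  (1 - fpsX int ^+ l)^-1 n = (l %| n)%N%:R.
Proof.
move=> l0; pose f : fps int := Fps (fun n => (l %| n)%N%:R).
suff -> : (1 - fpsX int ^+ l)^-1 = f by [].
have u : (1 - fpsX int ^+ l) \is a GRing.unit.
  by apply: fps_unit_coef1; have [] := log_theta_1BXn l0.
apply: (mulrI u); rewrite divrr // mulrBl mul1r; apply: fpsP => m.
rewrite fps_coefD fps_coefN fps_coefXn_mul fps_coef1 /=.
case: leqP => [le|lt].
  by rewrite (dvdn_subl le (dvdnn l)) subrr gtn_eqF // (leq_trans l0 le).
by rewrite oppr0 addr0; case: m lt => [|m] lt; rewrite ?dvdn0 // gtnNdvd.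
Qed.

(** Jacobi's formula: by the Leibniz rule one row at a time is differentiated. *)
Lemma fps_theta_det n (A : 'M[fps int]_n) :
  fps_theta (\det A) = \sum_i \sum_j fps_theta (A i j) * cofactor A i j.
Proof.
pose dA i := \matrix_(k, j) if k == i then fps_theta (A k j) else A k j.
transitivity (\sum_i \det (dA i)); last first.
  apply: eq_bigr => i _; rewrite (expand_det_row _ i); apply: eq_bigr => j _.
  rewrite mxE eqxx; congr (_ * _); rewrite /cofactor; congr (_ * \det _).
  by apply/matrixP => a b; rewrite !mxE eq_sym (negPf (neq_lift _ _)).
have theta_sum I (r : seq I) (F : I -> fps int) :
    fps_theta (\sum_(i <- r) F i) = \sum_(i <- r) fps_theta (F i).
  apply: (big_morph fps_theta) => [f g|]; last by apply: fpsP => k /=; rewrite mul0rn.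
  by apply: fpsP => k /=; rewrite mulrnDl.
have theta_prod (F : 'I_n -> fps int) (r : seq 'I_n) : uniq r ->
    fps_theta (\prod_(i <- r) F i) =
    \sum_(i <- r) \prod_(k <- r) if k == i then fps_theta (F k) else F k.
  elim: r => [|a r IH] /=; first by rewrite !big_nil fps_theta1.
  move=> /andP[ar ur]; rewrite !big_cons fps_thetaM IH // eqxx; congr (_ * _ + _).
    apply: eq_big_seq => k kr; case: eqP => // ka; by rewrite -ka kr in ar.
  rewrite big_distrr /=; apply: eq_big_seq => i ir; rewrite big_cons.
  by case: eqP => // ai; rewrite ai ir in ar.
rewrite /determinant theta_sum exchange_big /=; apply: eq_bigr => s _.
have -> : fps_theta ((-1) ^+ s * \prod_i A i (s i)) =
    (-1) ^+ s * fps_theta (\prod_i A i (s i)).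
  case: (odd_perm s); rewrite ?expr0 ?expr1 ?mul1r ?mulN1r //.
  by apply: fpsP => k /=; rewrite mulNrn.
rewrite theta_prod ?index_enum_uniq // big_distrr /=; apply: eq_bigr => i _.
by congr (_ * _); apply: eq_bigr => k _; rewrite mxE.
Qed.

Definition fps_const (c : int) : fps int := Fps (fun n => if n is 0 then c else 0).

(** Jacobi's formula gives the trace of the adjugate of 1 - u^l T times -l u^l T, and the
    adjugate is the determinant times G, the geometric series of u^l T. *)
Lemma log_theta_det_1BXn l N (T : 'M[int]_N) : (0 < l)%N ->
  log_theta (\det (1%:M - fpsX int ^+ l *: map_mx fps_const T))
            (- fps_multiples l (fun m => l%:R * \tr (T ^+ m))).
Proof.
move=> l0; set u := fpsX int ^+ l; set Tu := map_mx fps_const T.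
have coef_const c f k : (fps_const c * f) k = c * f k.
  by rewrite fps_coefM big_ord_recl subn0 big1 ?addr0 // => i _; rewrite mul0r.
pose G : 'M[fps int]_N := \matrix_(i, j)
  Fps (fun m => if (l %| m)%N then (T ^+ (m %/ l)) i j else 0).
have uTG : u *: (Tu *m G) = \matrix_(i, j)
    fps_multiples l (fun m => (T ^+ m) i j).
  apply/matrixP => i j; rewrite !mxE; apply: fpsP => m; rewrite fps_coefXn_mul /=.
  have [le|lt] := leqP l m; last first.
    by case: m lt => // m lt; rewrite gtnNdvd ?andbF.
  rewrite (leq_trans l0 le) /= -{2 3}(subnK le) dvdn_addl // divnDr // divnn l0 addn1.
  rewrite exprS -mulmxE mxE fps_coef_sum; case: ifP => d; last first.
    by rewrite big1 // => k _; rewrite !mxE coef_const /= d mulr0.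
  by apply: eq_bigr => k _; rewrite !mxE coef_const /= d.
have AG : (1%:M - u *: Tu) *m G = 1%:M.
  rewrite mulmxBl mul1mx -scalemxAl uTG; apply/matrixP => i j; rewrite !mxE.
  apply: fpsP => m; rewrite fps_coefD fps_coefN /=; case: m => [|m].
    by rewrite dvdn0 div0n expr0 subr0 -[1]/(1%:M) mxE; case: eqP.
  by rewrite subrr; case: eqP.
split.
  rewrite /determinant fps_coef_sum (bigD1 1%g) // odd_perm1 expr0 mul1r.
  have c0 i j : (1%:M - u *: Tu) i j 0%N = (i == j)%:R.
    rewrite !mxE fps_coefD fps_coefN fps_coefXn_mul leqNgt l0 subr0.
    by case: eqP.
  have p0 I (r : seq I) (F : I -> fps int) :
      (\prod_(i <- r) F i) 0%N = \prod_(i <- r) F i 0%N.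
    by apply: (big_morph (fun f : fps int => f 0%N)) => // f g; rewrite fps_coefM0.
  rewrite p0 big1 => [|i _]; last by rewrite c0 perm1 eqxx.
  rewrite big1 ?addr0 // => s s1; rewrite fps_coefM0 p0.
  have [i si] : exists i, s i != i.
    apply/existsP; apply: contraNT s1 => /existsPn H.
    by apply/eqP/permP => i; rewrite perm1; apply/eqP; move: (H i); rewrite negbK.
  by rewrite (bigD1 i) //= c0 eq_sym (negPf si) mul0r mulr0.
rewrite fps_theta_det.
have thetaA i j : fps_theta ((1%:M - u *: Tu) i j) = - (l%:R * (u *: Tu) i j).
  rewrite !mxE; apply: fpsP => m; rewrite fps_coef_theta fps_coefD !fps_coefN mulr_natl.
  have -> : (u * fps_const (T i j) *+ l) m = (u * fps_const (T i j)) m *+ l.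
    by elim: (l) => [|k IH]; rewrite ?mulr0n // !mulrS -IH.
  have -> : ((i == j)%:R : fps int) m = (i == j)%:R * (m == 0%N)%:R.
    by case: (i == j); rewrite ?mul1r ?mul0r.
  rewrite !fps_coefXn_mul /=.
  case: ltngtP => [lt|gt|<-]; last 1 first.
  - by rewrite (gtn_eqF l0) mulr0 sub0r mulNrn.
  - have [m' ->] : exists m', (m - l)%N = m'.+1 by exists (m - l).-1; lia.
    by rewrite (gtn_eqF (leq_ltn_trans _ lt)) // mulr0 subr0 !mul0rn oppr0.
  - by case: m gt => [|m] _; rewrite ?mulr0n ?mulr0 ?subr0 !mul0rn ?oppr0.
transitivity (- (l%:R * \tr (u *: Tu *m \adj (1%:M - u *: Tu)))).
  rewrite /mxtrace big_distrr /= -sumrN; apply: eq_bigr => i _.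
  rewrite !mxE big_distrr /= -sumrN; apply: eq_bigr => j _.
  by rewrite thetaA mulNr mulrA !mxE.
have -> : \adj (1%:M - u *: Tu) = \det (1%:M - u *: Tu) *: G.
  transitivity (\adj (1%:M - u *: Tu) *m ((1%:M - u *: Tu) *m G)).
    by rewrite AG mulmx1.
  by rewrite mulmxA mul_adj_mx mul_scalar_mx.
rewrite -scalemxAr mxtraceZ -scalemxAl uTG mulrCA mulrN; congr (- (_ * _)).
apply: fpsP => m; rewrite mulr_natl.
have -> (f : fps int) : (f *+ l) m = f m *+ l.
  by elim: (l) => [|k IH]; rewrite ?mulr0n // !mulrS -IH.
rewrite /mxtrace fps_coef_sum /=; case: ifP => d.
  by rewrite mulr_natl; congr (_ *+ _); apply: eq_bigr => i _; rewrite mxE /= d.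
by rewrite big1 ?mul0rn // => i _; rewrite mxE /= d.
Qed.
Lemma log_theta_exp f t n : log_theta f t -> log_theta (f ^+ n) (t *+ n).
Proof.
move=> ft; elim: n => [|n IH]; first by rewrite expr0 mulr0n; apply: log_theta1.
by rewrite exprS mulrS; apply: log_thetaM.
Qed.

(** Both sides have the same logarithmic derivative, since the trace of P^m is n if 3
    divides m and 0 otherwise. *)
Lemma det_order3 N n (P : 'M[int]_n) : P ^+ 3 = 1 -> \tr P = 0 -> \tr (P ^+ 2) = 0 ->
  n = (3 * N)%N ->
  \det (1%:M - fpsX int *: map_mx fps_const P) = (1 - fpsX int ^+ 3) ^+ N.
Proof.
move=> P3 tP tP2 nE.
have := log_theta_det_1BXn P (ltn0Sn 0); rewrite expr1 => /log_theta_unique; apply.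
have /(log_theta_exp N) := log_theta_1BXn (ltn0Sn 2).
congr log_theta; rewrite mulNrn; congr (- _); apply: fpsP => m.
have coefMn (f : fps int) j : (f *+ N) j = f j *+ N.
  by elim: (N) => [|M IH]; rewrite ?mulr0n // !mulrS -IH.
rewrite coefMn /= dvd1n divn1 andbT mul1r.
case: ifP => [/andP[+ /dvdnP[j mE]]|m3]; first rewrite mE => m0.
  rewrite m0 mulnC exprM P3 expr1n [\tr _]mxtrace1 -[3 *+ N]mulr_natr -natrM.
  by congr _%:R; rewrite nE.
have [_|m0] := posnP m; first by rewrite mul0rn.
rewrite m0 /= in m3.
rewrite mul0rn (divn_eq m 3) exprD mulnC exprM P3 expr1n mul1r.
have : (m %% 3 < 3)%N by rewrite ltn_pmod.
move: m3; rewrite /dvdn; by case: (m %% 3)%N => [|[|[|r]]].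
Qed.

End LogDerivative.

(** * The Euler product over primitive cycles of a relation *)

Section EulerProduct.
Variables (T : choiceType) (A : set T) (r : rel T).
Hypothesis finA : finite_set A.

Let e : seq T := fset_set A.
Let N := size e.
Let x := tnth (in_tuple e).
Let T0 : 'M[int]_N := \matrix_(i, j) (r (x i) (x j))%:R.

Let mem_e a : (a \in e) = (a \in A).
Proof. by rewrite /e in_fset_set. Qed.

Let x_mem i : x i \in e. Proof. exact: mem_tnth. Qed.

Let x_eq i j : (x i == x j) = (i == j).
Proof. by rewrite /x (tnth_nth (x i)) [tnth _ j](tnth_nth (x i)) nth_uniq ?fset_uniq. Qed.

Let sum_x (F : T -> int) : \sum_i F (x i) = \sum_(a <- e) F a.
Proof. by rewrite [RHS]big_tnth. Qed.

Fixpoint words m : seq (seq T) :=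
  if m is m'.+1 then [seq a :: w | a <- e, w <- words m'] else [:: [::]].

Lemma mem_words m w : (w \in words m) = (size w == m) && all (mem e) w.
Proof.
elim: m w => [|m IH] [|a w] //=.
  by apply/allpairsP => -[[a w] [_ _]].
apply/allpairsP/idP => [[[b v] [/= be vm [-> ->]]]|/andP[sw /andP[ae we]]].
  by move: vm; rewrite IH be eqSS.
by exists (a, w); split => //=; rewrite IH we -eqSS sw.
Qed.

Lemma words_uniq m : uniq (words m).
Proof.
elim: m => //= m IH; apply: allpairs_uniq => //; first exact: fset_uniq.
by move=> [a v] [b w] _ _ [-> ->].
Qed.

Let pathsE m i j : (T0 ^+ m) i j =
  \sum_(w <- words m) (path r (x i) w && (last (x i) w == x j))%:R.
Proof.
elim: m i => [|m IH] i; first by rewrite expr0 big_seq1 /= x_eq -[1]/(1%:M) mxE.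
rewrite exprS -mulmxE mxE big_allpairs_dep -sum_x; apply: eq_bigr => k _.
rewrite mxE IH big_distrr /=; apply: eq_bigr => w _.
by rewrite -andbA; case: (r _ _); rewrite ?mul1r ?mul0r.
Qed.

Let tr_pow m : \tr (T0 ^+ m.+1) = \sum_(w <- words m.+1) (cycle r w)%:R.
Proof.
rewrite big_allpairs_dep -sum_x; apply: eq_bigr => i _.
rewrite exprSr -mulmxE mxE.
under [LHS]eq_bigr do rewrite pathsE mxE big_distrl /=.
rewrite exchange_big /= -/(words m); apply: eq_big_seq => w; rewrite mem_words => /andP[_ we].
have : last (x i) w \in e.
  by have := mem_last (x i) w; rewrite inE => /predU1P[->|/(allP we)].
move=> /(tnthP (in_tuple e))[k Ek]; rewrite (bigD1 k) //= -/x big1 => [|j jk].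
  by rewrite rcons_path Ek eqxx andbT addr0; case: path; rewrite ?mul1r ?mul0r.
rewrite Ek -/x x_eq.
by rewrite eq_sym (negPf jk) andbF mul0r.
Qed.

Definition primitive_cycles : set (seq T) :=
  [set C | [/\ C <> [::], forall a, a \in C -> A a, cycle r C & word_primitive C]].

Definition primitive_classes : set (set (seq T)) :=
  [set rotation_class C | C in primitive_cycles].

Let clen (c : set (seq T)) := size (xget [::] c).

Let clenE C : clen (rotation_class C) = size C.
Proof. exact: size_rotation_class (xget_rotation_class C). Qed.

Let clen_gt0 c : primitive_classes c -> (0 < clen c)%N.
Proof. by move=> [C [C0 _ _ _] <-]; rewrite clenE; case: C C0. Qed.

(** The primitive word of which w is a power; the default value is taken only for the
    empty word. *)
Let root (w : seq T) : seq T := xget [::] [set D | word_primitive D /\ exists2 k, (0 < k)%N & w = wpow k D].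

Let rootE w D k : word_primitive D -> (0 < k)%N -> w = wpow k D -> root w = D.
Proof.
move=> pD k0 wD.
have [pR [l l0 wR]] : word_primitive (root w) /\
    exists2 k, (0 < k)%N & w = wpow k (root w).
  by apply: (@xgetPex _ [::] [set D | word_primitive D /\ exists2 k, (0 < k)%N & w = wpow k D]);
    exists D; split => //; exists k.
by apply: (primitive_root_unique pR pD l0 k0); rewrite -wR.
Qed.

Let primitive_cycles_rot j C : primitive_cycles C -> primitive_cycles (rot j C).
Proof.
move=> [C0 CA Cr Cp]; split.
- by move/(congr1 (rotr j)); rewrite rotK.
- by move=> a; rewrite mem_rot; apply: CA.
- by rewrite rot_cycle.
- exact: primitive_rot.
Qed.

(** The closed walks of length m whose primitive root is a rotation of C are the powers
    of the rotations of C with exponent m / size C, and these are distinct. *)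
Let count_class m c : (0 < m)%N -> primitive_classes c ->
  count (fun w => cycle r w && (rotation_class (root w) == c)) (words m) =
  if (clen c %| m)%N then clen c else 0%N.
Proof.
move=> m0 [C pcC <-{c}]; rewrite clenE; set s := size C.
have [C0 CA Cr Cp] := pcC.
have s0 : (0 < s)%N by rewrite /s; case: (C) C0.
rewrite -size_filter; set F := seq.filter _ _.
have FP w : w \in F -> exists2 j, (j < s)%N & [/\ (s %| m)%N & w = wpow (m %/ s) (rot j C)].
  rewrite mem_filter mem_words => /andP[/andP[wr /eqP wC] /andP[/eqP sw we]].
  have w0 : w <> [::] by move=> w0; rewrite -sw w0 in m0.
  have [D [k [pD k0 wD]]] := primitive_root_exists w0.
  have rC : rotation_class C D.
    by rewrite -wC (rootE pD k0 wD); apply: rotation_class_refl.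
  have [n Dn] := rC.
  have sm : m = (k * s)%N by rewrite -sw wD size_wpow Dn size_rot.
  have Dk : w = wpow (m %/ s) D by rewrite sm mulnK.
  have dsm : (s %| m)%N by rewrite sm dvdn_mull.
  have [lt|le] := ltnP n s; first by exists n; rewrite // -Dn.
  by exists 0%N; rewrite // rot0 -(rot_oversize le) -Dn.
case: ifP => ds; last first.
  by case E: F => [//|w F']; have [|j _ []] := FP w; rewrite ?E ?mem_head ?ds.
have k0 : (0 < m %/ s)%N by rewrite divn_gt0 // dvdn_leq.
rewrite -[RHS](size_iota 0) -(size_map (fun j => wpow (m %/ s) (rot j C))).
apply: perm_size; apply: uniq_perm.
- by rewrite filter_uniq // words_uniq.
- rewrite map_inj_in_uniq ?iota_uniq // => i j; rewrite !mem_iota /= => li lj.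
  by move/(wpow_inj k0)/(primitive_rot_inj Cp); apply.
- move=> w; apply/idP/mapP => [/FP[j lj [_ ->]]|[j]].
    by exists j; rewrite ?mem_iota.
  rewrite mem_iota /= => lj ->; have [_ RA Rr Rp] := primitive_cycles_rot j pcC.
  rewrite mem_filter mem_words size_wpow size_rot divnK // eqxx cycle_wpow // Rr /=.
  rewrite (rootE Rp k0) // rotation_class_rot eqxx /=.
  by apply/allP => a; rewrite mem_wpow // => /RA/mem_set; rewrite -mem_e.
Qed.

(** Every closed walk is a power of exactly one primitive cycle, so the closed walks
    counted by the trace can be sorted by the class of their root. *)
Let tr_classes m (S : seq (set (seq T))) : (0 < m)%N -> uniq S ->
    (forall c, c \in S -> primitive_classes c) ->
    (forall c, primitive_classes c -> (clen c <= m)%N -> c \in S) ->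
  \tr (T0 ^+ m) = \sum_(c <- S) (if (clen c %| m)%N then (clen c)%:R else 0).
Proof.
move=> m0 uS SP PS.
transitivity (\sum_(w <- words m) (cycle r w)%:R : int).
  by case: (m) m0 => // m' _; apply: tr_pow.
transitivity (\sum_(w <- words m) \sum_(c <- S)
    (cycle r w && (rotation_class (root w) == c))%:R : int).
  apply: eq_big_seq => w; rewrite mem_words => /andP[/eqP sw we].
  case wr: (cycle r w); last by rewrite big1.
  have w0 : w <> [::] by move=> w0; rewrite -sw w0 in m0.
  have [D [k [pD k0 wD]]] := primitive_root_exists w0.
  have cS : rotation_class D \in S.
    apply: PS.
      exists D => //; split=> //; first exact: primitive_nil.
        move=> a aD; have : a \in w by rewrite wD mem_wpow.
        by move/(allP we); rewrite /= mem_e => /set_mem.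
      by rewrite -(cycle_wpow _ _ k0) -wD.
    by rewrite clenE -sw wD size_wpow leq_pmull.
  rewrite (rootE pD k0 wD) /= (bigD1_seq _ cS) //= eqxx big1 ?addr0 // => c.
  by rewrite eq_sym => /negPf ->.
rewrite exchange_big /=; apply: eq_big_seq => c /SP pc.
have sum_count (P : pred (seq T)) ws : \sum_(w <- ws) (P w)%:R = (count P ws)%:R :> int.
  by rewrite -natr_sum -sum1_count [in RHS]big_mkcond; congr _%:R; apply: eq_bigr => w _; case: P.
by rewrite sum_count count_class //; case: ifP.
Qed.

Let finite_classes n : finite_set [set c | primitive_classes c /\ (clen c <= n)%N].
Proof.
have : finite_set ((@rotation_class T) @`
    [set` flatten [seq words m | m <- iota 0 n.+1]]) by apply: finite_image.
apply: sub_finite_set => c [[C [C0 CA Cr Cp] <-]]; rewrite clenE => le.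
exists C; last by [].
rewrite /mkset; apply/flatten_mapP; exists (size C); first by rewrite mem_iota.
by rewrite mem_words eqxx; apply/allP => a /CA/mem_set; rewrite -mem_e.
Qed.

(** Up to degree n only finitely many factors differ from 1, and their product has the
    logarithmic derivative of the right side up to degree n: the former is given by the
    classes of cycles, the latter by traces, and [tr_classes] equates them. *)
Lemma euler_product l : (0 < l)%N ->
  fps_prod primitive_classes (fun c => (1 - fpsX int ^+ (l * clen c))^-1) =
  (\det (1%:M - fpsX int ^+ l *: mx_on A (fun a b => (r a b)%:R)))^-1.
Proof.
move=> l0.
have -> : mx_on A (fun a b => (r a b)%:R) = map_mx fps_const T0.
  apply/matrixP => i j; rewrite !mxE; apply: fpsP => -[|n];
  by rewrite -/e -/x; case: (r _ _).
have logdet := log_thetaV (log_theta_det_1BXn T0 l0).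
apply: fpsP => n; rewrite /fps_prod /=.
set S := [set c | _ /\ _].
have SE : S = [set c | primitive_classes c /\ (l * clen c <= n)%N].
  apply/seteqP; split => c [pc].
    move=> [k /andP[k0 kn]]; rewrite fps_coef_inv_1BXn ?muln_gt0 ?l0 ?clen_gt0 //.
    case: (boolP (_ %| _)%N) => [/(dvdn_leq k0) d _|_]; last by rewrite eqxx.
    by split => //; apply: leq_trans d kn.
  move=> le; split => //; have c0 := clen_gt0 pc.
  exists (l * clen c)%N; first by rewrite muln_gt0 l0 c0.
  by rewrite fps_coef_inv_1BXn ?muln_gt0 ?l0 ?c0 // dvdnn.
have finS : finite_set S.
  rewrite SE; apply: sub_finite_set (finite_classes n) => c [pc le]; split => //.
  by apply: leq_trans le; rewrite leq_pmull.
have memS c : (c \in (fset_set S : seq _)) = (c \in S) by rewrite in_fset_set.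
have inS c : c \in (fset_set S : seq _) -> primitive_classes c /\ (l * clen c <= n)%N.
  by rewrite memS => /set_mem; rewrite SE.
pose G c := fps_multiples (l * clen c) (fun=> (l * clen c)%:R).
have logprod : log_theta (\prod_(c <- fset_set S) (1 - fpsX int ^+ (l * clen c))^-1)
    (\sum_(c <- fset_set S) G c).
  rewrite big_seq [X in log_theta _ X]big_seq.
  apply: (big_ind2 log_theta) => [|f f' g g' H H'|c]; first exact: log_theta1.
    exact: log_thetaM.
  move=> /inS[pc _]; rewrite -[G c]opprK; apply: log_thetaV.
  by apply: log_theta_1BXn; rewrite muln_gt0 l0 clen_gt0.
apply: (log_theta_coef_eq (n := n) logprod logdet) => // m /andP[m0 mn].
rewrite opprK fps_coef_sum /= m0 /=; case: ifP => [/dvdnP[m' mE]|d]; last first.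
  rewrite big1 // => c _; case: ifP => // dm.
  by rewrite (dvdn_trans (dvdn_mulr _ (dvdnn l)) dm) in d.
have m'0 : (0 < m')%N by move: m0; rewrite mE muln_gt0 => /andP[].
rewrite mE mulnK // (@tr_classes _ (fset_set S)) ?fset_uniq //; last 2 first.
- by move=> c /inS[].
- move=> c pc le; rewrite memS; apply/mem_set; rewrite SE; split => //.
  by apply: leq_trans mn; rewrite mE mulnC leq_mul2r le orbT.
rewrite big_distrr /=; apply: eq_bigr => c _; rewrite [(m' * l)%N]mulnC dvdn_pmul2l //.
by case: ifP => _; rewrite ?mulr0 // natrM.
Qed.

End EulerProduct.

(** * Valuation and residue field *)

Section Valuation.
Variables (F : fieldType) (ord : F -> int) (pi : F) (q : nat).
Hypothesis localF : nonarch_local_field ord pi q.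
Local Notation O := (ord_ge ord 0).
Implicit Types x y c : F.

Lemma ord_one : ord 1 = 0.
Proof.
have := ordM localF (oner_neq0 F) (oner_neq0 F); rewrite mulr1 => E.
by apply: (addrI (ord 1)); rewrite -E addr0.
Qed.

Lemma ordV x : x != 0 -> ord x^-1 = - ord x.
Proof.
move=> x0; have := ordM localF x0 (invr_neq0 x0); rewrite divff // ord_one => E.
by apply: (addrI (ord x)); rewrite -E subrr.
Qed.

Lemma ordX x n : x != 0 -> ord (x ^+ n) = ord x *+ n.
Proof.
move=> x0; elim: n => [|n IH]; first by rewrite ord_one.
by rewrite exprS mulrS (ordM localF) ?expf_neq0 // IH.
Qed.

Lemma ordN1 : ord (- 1) = 0.
Proof.
have n1 : - 1 != 0 :> F by rewrite oppr_eq0 oner_eq0.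
have := ordM localF n1 n1; rewrite mulrNN mulr1 ord_one => /eqP.
by rewrite eq_sym -mulr2n mulrn_eq0 => /eqP.
Qed.

Lemma pi_neq0 : pi != 0. Proof. by case: (uniformizer localF). Qed.
Lemma ord_pi : ord pi = 1. Proof. by case: (uniformizer localF). Qed.

Lemma ord_geM m n x y : ord_ge ord m x -> ord_ge ord n y -> ord_ge ord (m + n) (x * y).
Proof.
rewrite /ord_ge mulf_eq0; case: (eqVneq x 0) => //= x0; case: (eqVneq y 0) => //= y0.
by move=> mx ny; rewrite (ordM localF) // lerD.
Qed.

Lemma ord_ge0 n : ord_ge ord n 0. Proof. by rewrite /ord_ge eqxx. Qed.

Lemma O1 : O 1. Proof. by rewrite /ord_ge ord_one lexx orbT. Qed.
Lemma O0 : O 0. Proof. exact: ord_ge0. Qed.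
Lemma OM x y : O x -> O y -> O (x * y). Proof. exact: (@ord_geM 0 0). Qed.
Lemma OD x y : O x -> O y -> O (x + y). Proof. exact: (ord_geD localF). Qed.
Lemma O_pi : O pi. Proof. by rewrite /ord_ge ord_pi orbT. Qed.
Lemma ord_ge_opp n x : ord_ge ord n (- x) = ord_ge ord n x.
Proof.
rewrite /ord_ge oppr_eq0; case: eqP => //= /eqP x0.
by rewrite -mulN1r (ordM localF) ?oppr_eq0 ?oner_eq0 // ordN1 add0r.
Qed.
Lemma ON x : O x -> O (- x). Proof. by rewrite ord_ge_opp. Qed.
Lemma OB x y : O x -> O y -> O (x - y).
Proof. by move=> Ox Oy; apply: OD => //; apply: ON. Qed.

Lemma ord_ge_le m n x : m <= n -> ord_ge ord n x -> ord_ge ord m x.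
Proof. by move=> le /orP[/eqP->|nx]; rewrite /ord_ge ?eqxx // (le_trans le) ?orbT. Qed.

Lemma O_sum I (r : seq I) (P : pred I) (f : I -> F) :
  (forall i, P i -> O (f i)) -> O (\sum_(i <- r | P i) f i).
Proof. by move=> Of; apply: (big_ind (fun x => O x)) => //; [apply: O0|apply: OD]. Qed.

Lemma O_prod I (r : seq I) (P : pred I) (f : I -> F) :
  (forall i, P i -> O (f i)) -> O (\prod_(i <- r | P i) f i).
Proof. by move=> Of; apply: (big_ind (fun x => O x)) => //; [apply: O1|apply: OM]. Qed.

Lemma ord_ge_pi n x : ord_ge ord (n + 1) (pi * x) = ord_ge ord n x.
Proof.
rewrite /ord_ge mulf_eq0 (negPf pi_neq0) /=; case: eqP => //= /eqP x0.
by rewrite (ordM localF) ?pi_neq0 // ord_pi addrC lerD2l.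
Qed.

Lemma ord_ge1P x : ord_ge ord 1 x -> exists2 y, O y & x = pi * y.
Proof.
move=> x1; exists (x / pi); last by rewrite mulrCA divff ?mulr1 ?pi_neq0.
by rewrite -ord_ge_pi add0r mulrCA divff ?mulr1 ?pi_neq0.
Qed.

Lemma O_unit x : O x -> ~~ ord_ge ord 1 x -> x != 0 /\ O x^-1.
Proof.
rewrite /ord_ge invr_eq0; case: eqP => //= /eqP x0 x0' x1; split=> //.
by rewrite ordV // oppr_ge0; move: x1; rewrite -ltNge -[1]add0r ltzD1.
Qed.

Lemma ord_eq0 x : x != 0 -> O x -> O x^-1 -> ord x = 0.
Proof.
move=> x0; rewrite /ord_ge invr_eq0 (negPf x0) /= ordV // oppr_ge0 => a b.
by apply/eqP; rewrite eq_le a b.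
Qed.

(** Only the values of [red] on O_F matter, and [lift] is merely a set of
    representatives. Through them lattices are studied by linear algebra over a finite
    field. *)
Record residue_field (k : finFieldType) (red : F -> k) (lift : k -> F) : Prop :=
  ResidueField {
    card_residue : #|k| = q;
    lift_O : forall a, O (lift a);
    liftK : cancel lift red;
    redD : forall x y, O x -> O y -> red (x + y) = red x + red y;
    redM : forall x y, O x -> O y -> red (x * y) = red x * red y;
    red1 : red 1 = 1;
    red_eq0 : forall x, O x -> (red x == 0) = ord_ge ord 1 x }.

Section Quotient.
Variables (res : F -> 'I_q) (rep : 'I_q -> F).
Hypothesis rep_O : forall a, O (rep a).
Hypothesis repK : cancel rep res.
Hypothesis res_eq : forall x y, O x -> O y -> res x = res y <-> ord_ge ord 1 (x - y).

(** The quotient of O_F by pi O_F, carried over to 'I_q by the enumeration of the cosets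
    so that it is a finite type. The hypotheses occur in the body because the field
    structure depends on them. *)
Definition residue_type : Type := let _ := (rep_O, repK, res_eq) in 'I_q.

HB.instance Definition _ := Finite.on residue_type.

Let k := residue_type.
Implicit Types a b d : k.
Let rk (x : F) : k := res x.
Let lk (a : k) : F := rep a.
Let lkO a : O (lk a). Proof. exact: rep_O. Qed.
Let lkK a : rk (lk a) = a. Proof. exact: repK. Qed.
Let rk_eq x y : O x -> O y -> rk x = rk y <-> ord_ge ord 1 (x - y).
Proof. exact: res_eq. Qed.
Let rk_lk x : O x -> ord_ge ord 1 (lk (rk x) - x).
Proof. by move=> Ox; apply/rk_eq => //; rewrite lkK. Qed.

Definition residue_add a b : k := rk (lk a + lk b).
Definition residue_mul a b : k := rk (lk a * lk b).
Definition residue_opp a : k := rk (- lk a).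
Definition residue_inv a : k := if a == rk 0 then a else rk (lk a)^-1.

Let rkD x y : O x -> O y -> rk (x + y) = residue_add (rk x) (rk y).
Proof.
move=> Ox Oy; apply/rk_eq; rewrite ?OD //.
by rewrite opprD addrACA; apply: (ord_geD localF); rewrite -ord_ge_opp opprB rk_lk.
Qed.

Let rkM x y : O x -> O y -> rk (x * y) = residue_mul (rk x) (rk y).
Proof.
move=> Ox Oy; apply/rk_eq; rewrite ?OM //.
have -> : x * y - lk (rk x) * lk (rk y) = (x - lk (rk x)) * y + lk (rk x) * (y - lk (rk y)).
  by rewrite mulrBl mulrBr addrA subrK.
apply: (ord_geD localF).
  by rewrite -[1]addr0; apply: ord_geM => //; rewrite -ord_ge_opp opprB rk_lk.
by rewrite -[1]add0r; apply: ord_geM => //; rewrite -ord_ge_opp opprB rk_lk.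
Qed.

Let addA : associative residue_add.
Proof.
move=> a b d; rewrite -[a]lkK -[b]lkK -[d]lkK -!rkD ?OD //.
by rewrite addrA.
Qed.
Let addC : commutative residue_add.
Proof. by move=> a b; rewrite /residue_add addrC. Qed.
Let add0 : left_id (rk 0) residue_add.
Proof. by move=> a; rewrite -{1}[a]lkK -rkD ?O0 // add0r lkK. Qed.
Let addN : left_inverse (rk 0) residue_opp residue_add.
Proof.
by move=> a; rewrite -{2}[a]lkK /residue_opp -rkD ?ON // addNr.
Qed.

HB.instance Definition _ := GRing.isZmodule.Build residue_type addA addC add0 addN.

Let mulA : associative residue_mul.
Proof.
by move=> a b d; rewrite -[a]lkK -[b]lkK -[d]lkK -!rkM ?OM // mulrA.
Qed.
Let mulC : commutative residue_mul.
Proof. by move=> a b; rewrite /residue_mul mulrC. Qed.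
Let mul1 : left_id (rk 1) residue_mul.
Proof. by move=> a; rewrite -{1}[a]lkK -rkM ?O1 // mul1r lkK. Qed.
Let mulDl : left_distributive residue_mul residue_add.
Proof.
by move=> a b d; rewrite -[a]lkK -[b]lkK -[d]lkK -!(rkM, rkD) ?OM ?OD // mulrDl.
Qed.
Let one_neq0 : rk 1 != rk 0.
Proof.
by apply/eqP => /(rk_eq O1 O0); rewrite subr0 /ord_ge oner_eq0 ord_one.
Qed.

HB.instance Definition _ :=
  GRing.Zmodule_isComNzRing.Build residue_type mulA mulC mul1 mulDl one_neq0.

Let mulV a : a != 0 -> residue_inv a * a = 1.
Proof.
move=> a0; rewrite /residue_inv (negPf a0).
have [l0 Ol] : lk a != 0 /\ O (lk a)^-1.
  apply: O_unit => //; apply: contra a0 => l1; apply/eqP.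
  by rewrite -[LHS]lkK; apply/(rk_eq (lkO a) O0); rewrite subr0.
by rewrite -{2}[a]lkK -[LHS]rkM // mulVf.
Qed.

Let invr0 : residue_inv 0 = 0.
Proof. by rewrite /residue_inv eqxx. Qed.

HB.instance Definition _ := GRing.ComNzRing_isField.Build residue_type mulV invr0.

Lemma residue_type_residue_field :
  residue_field (rk : F -> residue_type : finFieldType) lk.
Proof.
split=> //.
- exact: card_ord.
- by move=> x Ox; apply/eqP/idP => [/(rk_eq Ox O0)|]; rewrite ?subr0 // => x1;
    apply/(rk_eq Ox O0); rewrite subr0.
Qed.

End Quotient.

Lemma residue_field_exists :
  exists (k : finFieldType) (red : F -> k) (lift : k -> F), residue_field red lift.
Proof.
have /card_set_bijP[f [fF fI fS]] := residue_card localF.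
set P := [set pi * x | x in O_F ord] in fF fI fS.
pose cos x : set F := [set x + y | y in P].
have cos_sub x y : O x -> O y -> cos x = cos y <-> ord_ge ord 1 (x - y).
  move=> Ox Oy; split=> [|xy].
    move/seteqP => [/(_ x) sub _].
    have [|_ [z Oz <-] zE] := sub; first by exists 0; [exists 0; [exact: O0|rewrite mulr0]|rewrite addr0].
    by rewrite -zE addrAC subrr add0r -[1]add0r ord_ge_pi.
  have [d Od dE] := ord_ge1P xy.
  have key u v w : O w -> u - v = pi * w -> cos u `<=` cos v.
    move=> Ow uv _ [_ [z Oz <-] <-]; exists (pi * (w + z)).
      by exists (w + z) => //; apply: OD.
    by rewrite mulrDr -uv addrA addrCA subrr addr0.
  apply/seteqP; split; first exact: key dE.
  by apply: (key _ _ (- d)); rewrite ?ON // mulrN -dE opprB.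
have fcos x : O x -> (f (cos x) < q)%N.
  by move=> Ox; apply: fF; exists x.
have q0 : (0 < q)%N by apply: leq_ltn_trans (fcos 0 O0).
pose res x : 'I_q := insubd (Ordinal q0) (f (cos x)).
have res_val x : O x -> res x = f (cos x) :> nat.
  by move=> Ox; rewrite val_insubd fcos.
have res_eq x y : O x -> O y -> res x = res y <-> ord_ge ord 1 (x - y).
  move=> Ox Oy; rewrite -cos_sub //; split=> [/(congr1 val)|E].
    rewrite /= !res_val // => E; apply: fI => //; apply/mem_set; first by exists x.
    by exists y.
  by apply: val_inj; rewrite /= !res_val // E.
have /choice[rep repP] (a : 'I_q) : exists x, O x /\ res x = a.
  have [_ [x Ox <-] fx] := fS a (ltn_ord a).
  by exists x; split => //; apply: val_inj; rewrite /= res_val.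
have rO a : O (rep a) by case: (repP a).
have rK : cancel rep res by move=> a; case: (repP a).
exists (residue_type rO rK res_eq : finFieldType); eexists; eexists.
exact: residue_type_residue_field.
Qed.

End Valuation.

(** * Lattices between L and pi L *)

Section Lattices.
Variables (F : fieldType) (ord : F -> int) (pi : F) (q : nat).
Hypothesis localF : nonarch_local_field ord pi q.
Variables (k : finFieldType) (red : F -> k) (lift : k -> F).
Hypothesis resF : residue_field ord q red lift.
Local Notation O := (ord_ge ord 0).
Local Notation lat := (lattice_of ord).
Implicit Types (g h : 'M[F]_3) (x y : 'cV[F]_3) (c : F).

Lemma red0 : red 0 = 0.
Proof. by apply/eqP; rewrite (red_eq0 resF) ?(O0 ord) // ord_ge0. Qed.

Lemma redN (x : F) : O x -> red (- x) = - red x.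
Proof.
move=> Ox; apply: (addrI (red x)); rewrite -(redD resF) ?(ON localF) //.
by rewrite !subrr red0.
Qed.

Lemma red_sum I (r : seq I) (P : pred I) (f : I -> F) :
  (forall i, P i -> O (f i)) ->
  red (\sum_(i <- r | P i) f i) = \sum_(i <- r | P i) red (f i).
Proof.
move=> Of; have [] // : O (\sum_(i <- r | P i) f i) /\
  red (\sum_(i <- r | P i) f i) = \sum_(i <- r | P i) red (f i).
apply: (big_ind2 (fun u v => O u /\ red u = v)) => [|u u' v v' [Ou <-] [Ov <-]|i Pi].
- by rewrite red0; split => //; apply: O0.
- by split; [apply: (OD localF)|rewrite (redD resF)].
- by split => //; apply: Of.
Qed.

Lemma red_prod I (r : seq I) (P : pred I) (f : I -> F) :
  (forall i, P i -> O (f i)) ->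
  red (\prod_(i <- r | P i) f i) = \prod_(i <- r | P i) red (f i).
Proof.
move=> Of; have [] // : O (\prod_(i <- r | P i) f i) /\
  red (\prod_(i <- r | P i) f i) = \prod_(i <- r | P i) red (f i).
apply: (big_ind2 (fun u v => O u /\ red u = v)) => [|u u' v v' [Ou <-] [Ov <-]|i Pi].
- by rewrite (red1 resF); split => //; apply: (O1 localF).
- by split; [apply: (OM localF)|rewrite (redM resF)].
- by split => //; apply: Of.
Qed.

Definition integral m n (A : 'M[F]_(m, n)) := forall i j, O (A i j).

Lemma integral_mul m n p (A : 'M[F]_(m, n)) (B : 'M_(n, p)) :
  integral A -> integral B -> integral (A *m B).
Proof.
by move=> OA OB i j; rewrite mxE; apply: (O_sum localF) => l _; apply: (OM localF).
Qed.

Lemma integral_det n (A : 'M[F]_n) : integral A -> O (\det A).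
Proof.
move=> OA; apply: (O_sum localF) => s _; apply: (OM localF).
  by case: odd_perm; rewrite ?expr0 ?expr1 ?(ON localF) ?(O1 localF).
by apply: (O_prod localF).
Qed.

Lemma integral_inv n (A : 'M[F]_n) :
  integral A -> A \in unitmx -> O (\det A)^-1 -> integral (invmx A).
Proof.
move=> OA uA Od i j; rewrite /invmx uA !mxE; apply: (OM localF) => //.
rewrite /cofactor; apply: (OM localF).
  by rewrite -signr_odd; case: odd; rewrite ?expr0 ?expr1 ?(ON localF) ?(O1 localF).
by apply: integral_det => a b; rewrite !mxE.
Qed.

Lemma red_det n (A : 'M[F]_n) : integral A -> red (\det A) = \det (map_mx red A).
Proof.
move=> OA; rewrite /determinant red_sum => [|s _]; last first.
  apply: (OM localF); last exact: (O_prod localF).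
  by case: odd_perm; rewrite ?expr0 ?expr1 ?(ON localF) ?(O1 localF).
apply: eq_bigr => s _; rewrite (redM resF); last exact: (O_prod localF).
  congr (_ * _); last by rewrite red_prod //; apply: eq_bigr => i _; rewrite mxE.
  by case: odd_perm; rewrite ?expr0 ?expr1 ?redN ?(red1 resF) ?(O1 localF).
by case: odd_perm; rewrite ?expr0 ?expr1 ?(ON localF) ?(O1 localF).
Qed.

Lemma red_mul m n p (A : 'M[F]_(m, n)) (B : 'M_(n, p)) :
  integral A -> integral B -> map_mx red (A *m B) = map_mx red A *m map_mx red B.
Proof.
move=> OA OB; apply/matrixP => i j; rewrite !mxE red_sum => [|l _].
  by apply: eq_bigr => l _; rewrite !mxE (redM resF).
exact: (OM localF).
Qed.

(** The determinant is a unit of O because its reduction is not 0. *)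
Lemma integral_unit n (A : 'M[F]_n) : integral A -> map_mx red A \in unitmx ->
  A \in unitmx /\ integral (invmx A).
Proof.
move=> OA; rewrite unitmxE unitfE -red_det // (red_eq0 resF) ?integral_det // => d.
have [d0 Od] := O_unit localF (integral_det OA) d.
have uA : A \in unitmx by rewrite unitmxE unitfE.
by split => //; apply: integral_inv.
Qed.

Lemma GL3M g h : GL3 g -> GL3 h -> GL3 (g *m h).
Proof. by rewrite /GL3 /mkset unitmx_mul => -> ->. Qed.

Lemma GL3_scalar c : c != 0 -> GL3 (c%:M : 'M[F]_3).
Proof. by move=> c0; rewrite /GL3 /mkset unitmxE det_scalar unitfE expf_neq0. Qed.

Lemma mem_lattice g x : GL3 g -> lat g x <-> integral (invmx g *m x).
Proof.
move=> ug; split => [[y Oy <-] i j|Ox].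
  by rewrite mulKmx // [j]ord1; apply: Oy.
by exists (invmx g *m x); [move=> i; apply: Ox|rewrite mulKVmx].
Qed.

(** The coordinates of x in the basis g, reduced modulo pi, identify L / pi L with k^3
    for L the lattice of g. *)
Definition redv g x : 'rV[k]_3 := \row_i red ((invmx g *m x) i 0).

Lemma redvE g x i : redv g x 0 i = red ((invmx g *m x) i 0).
Proof. by rewrite mxE. Qed.

(** As W runs over the subspaces of k^3 these are all the O-modules between pi L and L,
    by [submodule_sublattice]. *)
Definition sublattice g m (W : 'M[k]_(m, 3)) : set 'cV[F]_3 :=
  [set x | lat g x /\ (redv g x <= W)%MS].

Lemma latticeD g x y : lat g x -> lat g y -> lat g (x + y).
Proof.
move=> [a Oa <-] [b Ob <-]; exists (a + b); last by rewrite mulmxDr.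
by move=> i; rewrite mxE; apply: (OD localF (Oa i) (Ob i)).
Qed.

Lemma latticeZ g c x : O c -> lat g x -> lat g (c *: x).
Proof.
move=> Oc [a Oa <-]; exists (c *: a); last by rewrite scalemxAr.
by move=> i; rewrite mxE; apply: (OM localF Oc (Oa i)).
Qed.

Lemma lattice0 g : lat g 0.
Proof. by exists 0; [move=> i; rewrite mxE; apply: O0|rewrite mulmx0]. Qed.

Lemma redvD g x y : GL3 g -> lat g x -> lat g y ->
  redv g (x + y) = redv g x + redv g y.
Proof.
move=> ug /(mem_lattice _ ug) Ox /(mem_lattice _ ug) Oy.
apply/rowP => i; rewrite redvE mulmxDr [(redv g x + _) _ _]mxE !redvE.
by rewrite [X in red X]mxE (redD resF).
Qed.

Lemma redvZ g c x : GL3 g -> O c -> lat g x -> redv g (c *: x) = red c *: redv g x.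
Proof.
move=> ug Oc /(mem_lattice _ ug) Ox.
apply/rowP => i; rewrite redvE -scalemxAr [(_ *: redv g x) _ _]mxE redvE.
by rewrite [X in red X]mxE (redM resF).
Qed.

Definition liftv g (w : 'rV[k]_3) : 'cV[F]_3 := g *m \col_i lift (w 0 i).

Lemma liftv_lattice g w : lat g (liftv g w).
Proof. by eexists => // i; rewrite mxE; apply: (lift_O resF). Qed.

Lemma liftvK g w : GL3 g -> redv g (liftv g w) = w.
Proof.
by move=> ug; apply/rowP => i; rewrite /liftv mxE mulKmx // mxE (liftK resF).
Qed.

Lemma redv_eq0 g x : GL3 g -> lat g x -> redv g x = 0 <-> scale_set pi (lat g) x.
Proof.
move=> ug gx; have /(mem_lattice _ ug) Ox := gx; split=> [r0|[y gy <-]].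
  exists (pi^-1 *: x); last by rewrite scalerA divff ?scale1r ?(pi_neq0 localF).
  apply/(mem_lattice _ ug) => i j; rewrite -scalemxAr mxE.
  have : red ((invmx g *m x) i j) == 0.
    by move/rowP/(_ i): r0; rewrite mxE [j]ord1 => ->; rewrite mxE.
  rewrite (red_eq0 resF) // => /(ord_ge1P localF)[z Oz ->].
  by rewrite mulrA mulVf ?mul1r ?(pi_neq0 localF).
rewrite redvZ ?(O_pi localF) //; have /eqP-> : red pi == 0; last by rewrite scale0r.
by rewrite (red_eq0 resF) ?(O_pi localF) // /ord_ge (ord_pi localF) lexx orbT.
Qed.

Lemma sublattice_sub g m (W : 'M[k]_(m, 3)) : sublattice g W `<=` lat g.
Proof. by move=> x []. Qed.

Lemma pi_sub_sublattice g m (W : 'M[k]_(m, 3)) : GL3 g ->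
  scale_set pi (lat g) `<=` sublattice g W.
Proof.
move=> ug x gx; have lx : lat g x.
  by case: gx => y gy <-; apply: latticeZ => //; apply: O_pi localF.
by split => //; have -> := (redv_eq0 ug lx).2 gx; rewrite sub0mx.
Qed.

Lemma sublattice_full g m (W : 'M[k]_(m, 3)) : row_full W -> sublattice g W = lat g.
Proof.
move=> fW; apply/seteqP; split; first exact: sublattice_sub.
by move=> x gx; split => //; apply: submx_full.
Qed.

Lemma sublattice_0 g m : GL3 g -> sublattice g (0 : 'M_(m, 3)) = scale_set pi (lat g).
Proof.
move=> ug; apply/seteqP; split; last exact: pi_sub_sublattice.
by move=> x [gx /submx0null /(redv_eq0 ug gx)].
Qed.

Lemma sublattice_le g m n (W : 'M[k]_(m, 3)) (W' : 'M[k]_(n, 3)) : GL3 g ->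
  sublattice g W `<=` sublattice g W' <-> (W <= W')%MS.
Proof.
move=> ug; split=> [sub|le x [gx xW]]; last by split => //; apply: submx_trans xW le.
apply/rV_subP => w wW; have [] : sublattice g W' (liftv g w).
  by apply: sub; split; [apply: liftv_lattice|rewrite liftvK].
by rewrite liftvK.
Qed.

Lemma sublattice_eq g m n (W : 'M[k]_(m, 3)) (W' : 'M[k]_(n, 3)) : GL3 g ->
  sublattice g W = sublattice g W' <-> (W :=: W')%MS.
Proof.
move=> ug; split=> [E|E].
  by apply/eqmxP/andP; split; apply/(sublattice_le _ _ ug); rewrite E.
by apply/seteqP; split; apply/(sublattice_le _ _ ug); rewrite E.
Qed.

Definition submodule (M : set 'cV[F]_3) :=
  [/\ M 0, forall x y, M x -> M y -> M (x + y) & forall c x, O c -> M x -> M (c *: x)].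

Lemma lattice_submodule g : submodule (lat g).
Proof. by split; [apply: lattice0|apply: latticeD|apply: latticeZ]. Qed.

Lemma sublattice_submodule g m (W : 'M[k]_(m, 3)) : GL3 g ->
  submodule (sublattice g W).
Proof.
move=> ug; split.
- by apply: pi_sub_sublattice => //; exists 0; rewrite ?scaler0 //; apply: lattice0.
- move=> x y [gx xW] [gy yW]; split; first exact: latticeD.
  by rewrite redvD // addmx_sub.
- move=> c x Oc [gx xW]; split; first exact: latticeZ.
  by rewrite redvZ // scalemx_sub.
Qed.

(** W is the image of M. A vector of L with reduction in W differs from an element of M
    by an element of pi L, which is in M too. *)
Lemma submodule_sublattice g (M : set 'cV[F]_3) : GL3 g -> submodule M ->
  scale_set pi (lat g) `<=` M -> M `<=` lat g ->
  exists W : 'M[k]_3, M = sublattice g W.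
Proof.
move=> ug [M0 MD MZ] piM Mg.
pose P (w : 'rV[k]_3) := `[< exists2 x, M x & redv g x = w >].
exists (\sum_(w | P w) <<w>>)%MS; apply/seteqP; split => x.
  move=> Mx; split; first exact: Mg.
  rewrite (sumsmx_sup (redv g x)) ?genmxE //.
  by apply/asboolP; exists x.
move=> [gx /sub_sumsmxP[u xE]].
have [y My yE] : exists2 y, M y & redv g y = redv g x.
  rewrite xE; apply: (big_ind (fun w => exists2 y, M y & redv g y = w)).
  - by exists 0 => //; apply/redv_eq0 => //; [apply: lattice0|exists 0; rewrite ?scaler0 //; apply: lattice0].
  - by move=> _ _ [y My <-] [z Mz <-]; exists (y + z); rewrite ?redvD //; [apply: MD|apply: Mg|apply: Mg].
  - move=> w /asboolP[y My yw].
    have : (u w *m <<w>>%MS <= w)%MS by rewrite (submx_trans (submxMl _ _)) ?genmxE.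
    case/sub_rVP => a ->; exists (lift a *: y); first by apply: MZ => //; apply: (lift_O resF).
    by rewrite redvZ ?(liftK resF) ?yw //; [apply: (lift_O resF)|apply: Mg].
have gy := Mg _ My.
have gNy : lat g (- y) by rewrite -scaleN1r; apply: latticeZ => //; apply: (ON localF); apply: (O1 localF).
have -> : x = (x - y) + y by rewrite subrK.
apply: MD => //; apply: piM; apply/redv_eq0 => //; first exact: latticeD.
rewrite redvD // -scaleN1r redvZ // ?(ON localF) ?(O1 localF) // redN ?(O1 localF) //.
by rewrite (red1 resF) scaleN1r yE subrr.
Qed.

Lemma copid_mxE (R : nzRingType) n r (i j : 'I_n) :
  copid_mx r i j = ((i == j) && (r <= i)%N)%:R :> R.
Proof.
rewrite !mxE val_eqE; case: eqVneq => [->|_]; last by rewrite subrr.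
by case: ltnP => _; rewrite ?subrr ?subr0.
Qed.

(** A basis of k^3 that starts with one of W lifts to a matrix A over O. In the basis g A
    the vectors of the sublattice are those whose last coordinates are divisible by pi. *)
Lemma sublattice_is_lattice g m (W : 'M[k]_(m, 3)) : GL3 g ->
  exists (A : 'M[F]_3) (D : 'rV[F]_3),
    [/\ A \in unitmx, integral A, integral (invmx A),
        forall i, D 0 i = if (i < \rank W)%N then 1 else pi &
        GL3 (g *m A *m diag_mx D) /\
        sublattice g W = lat (g *m A *m diag_mx D)].
Proof.
move=> ug; set r := \rank W; set R := row_ebase W.
have uR : R \in unitmx by apply: row_ebase_unit.
pose A : 'M[F]_3 := \matrix_(i, j) lift (R j i).
have OA : integral A by move=> i j; rewrite mxE; apply: (lift_O resF).
have redA : map_mx red A = R^T by apply/matrixP => i j; rewrite !mxE (liftK resF).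
have [uA OV] : A \in unitmx /\ integral (invmx A).
  by apply: integral_unit; rewrite ?redA ?unitmx_tr.
have redV : map_mx red (invmx A) = (invmx R)^T.
  rewrite trmx_inv -redA; have u : map_mx red A \in unitmx by rewrite redA unitmx_tr.
  apply: (can_inj (mulKmx u)); rewrite mulmxV // -red_mul // mulmxV //.
  by apply/matrixP => i j; rewrite !mxE; case: eqP; rewrite ?(red1 resF) ?red0.
pose D : 'rV[F]_3 := \row_i if (i < r)%N then 1 else pi.
have D0 i : D 0 i != 0 by rewrite mxE; case: ifP; rewrite ?oner_eq0 ?(pi_neq0 localF).
have uD : diag_mx D \in unitmx.
  by rewrite unitmxE det_diag unitfE; apply/prodf_neq0 => i _; apply: D0.
have uh : GL3 (g *m A *m diag_mx D) by rewrite /GL3 /mkset !unitmx_mul uA uD andbT; apply/andP; split.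
exists A, D; split => // [i|]; first by rewrite mxE.
split => //; apply/seteqP; split => x.
  move=> [gx xW]; have /(mem_lattice _ ug) Ox := gx.
  pose z := invmx A *m (invmx g *m x).
  have Oz : integral z by apply: integral_mul.
  have zr (i : 'I_3) : (r <= i)%N -> ord_ge ord 1 (z i 0).
    move=> ri; rewrite -(red_eq0 resF) //; apply/eqP.
    have : map_mx red z = (redv g x *m invmx R)^T.
      rewrite red_mul // redV trmx_mul; congr (_ *m _); apply/matrixP => a b.
      by rewrite !mxE [b]ord1.
    move/matrixP/(_ i 0); rewrite [LHS]mxE [RHS]mxE => ->.
    move: xW; rewrite submxE /cokermx -/R -/r mulmxA => /eqP/rowP/(_ i).
    rewrite mxE (bigD1 i) //= big1 ?addr0 => [|j ji]; last first.
      by rewrite copid_mxE (negPf ji) mulr0.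
    by rewrite copid_mxE eqxx ri mulr1 => ->; rewrite mxE.
  exists (\col_i (z i 0 / D 0 i)).
    move=> i; rewrite /O_F /= mxE [D 0 i]mxE; case: ltnP => [_|ri]; first by rewrite divr1.
    have [y Oy ->] := ord_ge1P localF (zr i ri).
    by rewrite mulrAC divff ?mul1r ?(pi_neq0 localF).
  have -> : \col_i (z i 0 / D 0 i) = invmx (diag_mx D) *m z.
    apply: (can_inj (mulKmx uD)); rewrite mulKVmx //; apply/colP => i.
    by rewrite mul_diag_mx [LHS]mxE [(\col_l _) _ _]mxE mulrC divfK ?D0 // [i in RHS]ord1.
  by rewrite -mulmxA mulKVmx // -mulmxA /z !mulKVmx.
move=> [z Oz <-]; set y := diag_mx D *m z.
have Oy : integral y.
  move=> i j; rewrite /y mul_diag_mx mxE [j]ord1 mxE.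
  by case: ifP => _; rewrite ?mul1r ?(OM localF) ?(O_pi localF) //; apply: Oz.
have E : invmx g *m (g *m A *m diag_mx D *m z) = A *m y by rewrite -!mulmxA mulKmx.
split; first by apply/mem_lattice => //; rewrite E; apply: integral_mul.
have -> : redv g (g *m A *m diag_mx D *m z) = (map_mx red y)^T *m R.
  apply: (can_inj trmxK); rewrite trmx_mul trmxK -redA -red_mul //.
  by apply/matrixP => i j; rewrite [j]ord1 [LHS]mxE redvE E [RHS]mxE.
rewrite submxE /cokermx -/R -/r mulmxA mulmxK //; apply/eqP/rowP => i.
rewrite mxE big1 ?mxE // => j _; rewrite copid_mxE.
case: (eqVneq j i) => [->|]; last by rewrite mulr0.
case: (leqP r i) => ri; last by rewrite mulr0.
have yi : y i 0 = pi * z i 0 by rewrite /y mul_diag_mx mxE mxE ltnNge ri.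
rewrite mulr1 [LHS]mxE [LHS]mxE yi; apply/eqP.
have Ozi : O (z i 0) by apply: Oz.
by rewrite (red_eq0 resF) ?(OM localF) ?(O_pi localF) // -[1]add0r (ord_ge_pi localF).
Qed.

End Lattices.

(** * Homothety classes of sublattices *)

Section Neighbours.
Variables (F : fieldType) (ord : F -> int) (pi : F) (q : nat).
Hypothesis localF : nonarch_local_field ord pi q.
Variables (k : finFieldType) (red : F -> k) (lift : k -> F).
Hypothesis resF : residue_field ord q red lift.
Local Notation O := (ord_ge ord 0).
Local Notation lat := (lattice_of ord).
Local Notation sub := (sublattice ord red).
Local Notation vtx := (set (set 'cV[F]_3)).
Implicit Types (g h : 'M[F]_3) (x y : 'cV[F]_3) (c : F) (L M : set 'cV[F]_3).

Lemma residue_card_gt1 : (1 < q)%N.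
Proof.
rewrite -(card_residue resF); apply/card_gt1P; exists 0, 1; split => //.
by rewrite eq_sym oner_eq0.
Qed.

(** Reduction followed by the projection modulo W' maps the larger module onto W / W',
    and its fibres are the cosets of the smaller one. *)
Lemma sublattice_index g m n (W : 'M[k]_(m, 3)) (W' : 'M[k]_(n, 3)) :
  GL3 g -> (W' <= W)%MS -> has_index (sub g W) (sub g W') (q ^ (\rank W - \rank W')).
Proof.
move=> ug le; rewrite /has_index.
pose cos x : set 'cV[F]_3 := [set x + y | y in sub g W'].
pose phi x := redv red g x *m cokermx W'.
pose f (c : set 'cV[F]_3) := phi (xget 0 c).
have [S0 SD SZ] := sublattice_submodule localF resF W' ug.
have SN x : sub g W' x -> sub g W' (- x).
  by move=> Sx; rewrite -scaleN1r; apply: SZ => //; apply: (ON localF (O1 localF)).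
have fcos x : lat g x -> f (cos x) = phi x.
  move=> gx; have : cos x (xget 0 (cos x)).
    by apply: xgetPex; exists x; exists 0 => //; rewrite addr0.
  move=> [y [gy yW] xy]; rewrite /f -xy /phi (redvD resF) // mulmxDl.
  by move: yW; rewrite submxE => /eqP ->; rewrite addr0.
have latN x : lat g x -> lat g (- x).
  by move=> gx; rewrite -scaleN1r; apply: (latticeZ localF) => //; apply: (ON localF (O1 localF)).
set S := [set [set x + y | y in sub g W'] | x in sub g W].
have fI : {in S &, injective f}.
  move=> _ _ /set_mem[x [gx _] <-] /set_mem[y [gy _] <-].
  rewrite -/(cos x) -/(cos y) !fcos // => E.
  have xy : sub g W' (x - y).
    have gNy := latN _ gy.
    split; first exact: (latticeD localF).
    rewrite submxE (redvD resF) // -scaleN1r.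
    rewrite (redvZ resF) ?(ON localF) ?(O1 localF) //.
    rewrite (redN localF resF) ?(O1 localF) // (red1 resF) scaleN1r mulmxBl.
    by rewrite subr_eq0; apply/eqP.
  apply/seteqP; split => _ [z Sz <-].
    by exists (x - y + z); [apply: SD|rewrite addrA addrCA subrr addr0].
  exists (- (x - y) + z); first by apply: SD => //; apply: SN.
  by rewrite addrA opprB addrCA subrr addr0.
apply: card_eq_trans (card_esym (inj_card_eq fI)) _.
have -> : [set f c | c in S] = [set` rowg (W *m cokermx W')].
  apply/seteqP; split => [_ [_ [x [gx xW] <-] <-]|v].
    by rewrite -/(cos x) fcos // /mkset mem_rowg submxMr.
  rewrite /mkset mem_rowg => /submxP[u vE].
  have gx := liftv_lattice resF g (u *m W).
  exists (cos (liftv lift g (u *m W))).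
    exists (liftv lift g (u *m W)) => //; split => //.
    by rewrite (liftvK resF) // submxMl.
  by rewrite fcos // /phi (liftvK resF) // vE -mulmxA.
have -> : [set` rowg (W *m cokermx W')] =
    [set` [fset v in rowg (W *m cokermx W')]%fset].
  apply/seteqP; split => v; rewrite /mkset => Hv.
    by apply/imfsetP; exists v.
  by case/imfsetP: Hv => w /= wW ->.
apply/card_eq_fsetP; rewrite card_finset card_rowg (card_residue resF).
congr (_ ^ _)%N; have := mxrank_mul_ker W (cokermx W').
have -> : \rank (W :&: kermx (cokermx W'))%MS = \rank W'; last by move=> <-; rewrite addnK.
apply/eqmx_rank/andP; split.
  by rewrite submxE; apply/eqP/sub_kermxP/capmxSr.
by rewrite sub_capmx le; apply/sub_kermxP; rewrite mulmx_coker.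
Qed.

Lemma has_index_unique (V : zmodType) (A B : set V) m n :
  has_index A B m -> has_index A B n -> m = n.
Proof. by move=> Hm Hn; apply/card_eq_II; apply: card_eq_trans (card_esym Hm) Hn. Qed.

Lemma scale_setM c d L : scale_set c (scale_set d L) = scale_set (c * d) L.
Proof.
apply/seteqP; split => [_ [_ [x Lx <-] <-]|_ [x Lx <-]].
  by exists x; rewrite ?scalerA.
by exists (d *: x); [exists x|rewrite scalerA].
Qed.

Lemma scale_set1 L : scale_set 1 L = L.
Proof.
apply/seteqP; split => [_ [x Lx <-]|x Lx]; first by rewrite scale1r.
by exists x; rewrite ?scale1r.
Qed.

Lemma scale_setK c L : c != 0 -> scale_set c^-1 (scale_set c L) = L.
Proof. by move=> c0; rewrite scale_setM mulVf // scale_set1. Qed.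

Lemma scale_setS c L M : L `<=` M -> scale_set c L `<=` scale_set c M.
Proof. by move=> LM _ [x /LM Mx <-]; exists x. Qed.

Lemma homothety_class_scale c L : c != 0 ->
  homothety_class (scale_set c L) = homothety_class L.
Proof.
move=> c0; apply/seteqP; split => [_ [d d0 <-]|_ [d d0 <-]].
  by exists (d * c); rewrite ?scale_setM //; apply: mulf_neq0.
exists (d / c); first by apply: mulf_neq0 => //; apply: invr_neq0.
by rewrite scale_setM divfK.
Qed.

Lemma homothety_class_refl L : homothety_class L L.
Proof. by exists 1; [apply: oner_neq0|rewrite scale_set1]. Qed.

Lemma scale_set_sub c L : submodule ord L -> O c -> scale_set c L `<=` L.
Proof. by move=> [_ _ LZ] Oc _ [x Lx <-]; apply: LZ. Qed.

Lemma scale_set_unit c L : submodule ord L -> c != 0 -> ord c = 0 -> scale_set c L = L.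
Proof.
move=> sL c0 oc; apply/seteqP; split.
  by apply: scale_set_sub => //; rewrite /ord_ge oc orbT.
rewrite -{1}(scale_setK L (invr_neq0 c0)) invrK; apply: scale_setS.
by apply: scale_set_sub => //; rewrite /ord_ge (ordV localF) // oc oppr0 orbT.
Qed.

Lemma submodule_scale c L : submodule ord L -> submodule ord (scale_set c L).
Proof.
move=> [L0 LD LZ]; split.
- by exists 0; rewrite ?scaler0.
- by move=> _ _ [x Lx <-] [y Ly <-]; exists (x + y); rewrite ?scalerDr //; apply: LD.
- move=> d _ Od [x Lx <-]; exists (d *: x); first exact: LZ.
  by rewrite !scalerA mulrC.
Qed.

(** If c were not a unit then M or c M would lie in pi L, hence be equal to it, and M
    would be homothetic to L. *)
Lemma between_unique c L M : c != 0 -> submodule ord L -> submodule ord M ->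
    homothety_class M <> homothety_class L ->
    scale_set pi L `<=` M -> M `<=` L ->
    scale_set pi L `<=` scale_set c M -> scale_set c M `<=` L ->
  scale_set c M = M.
Proof.
move=> c0 sL sM ML piM LM pic cL.
have pi0 := pi_neq0 localF.
have key d N : d != 0 -> 0 < ord d -> submodule ord N -> N `<=` L ->
    scale_set d N `<=` scale_set pi L.
  move=> d0 od sN NL; have -> : d = pi * (d / pi) by rewrite mulrCA divff ?mulr1.
  rewrite -scale_setM; apply: scale_setS; apply: subset_trans NL.
  apply: scale_set_sub => //; rewrite -(ord_ge_pi localF) add0r mulrCA divff // mulr1.
  by rewrite /ord_ge -gtz0_ge1 od orbT.
have [oc|oc|oc] := ltgtP (ord c) 0; last exact: scale_set_unit.
  case: ML; have : scale_set c^-1 (scale_set c M) `<=` scale_set pi L.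
    apply: key => //; first exact: invr_neq0.
      by rewrite (ordV localF) // oppr_gt0.
    exact: submodule_scale.
  rewrite scale_setK // => Mpi; have -> : M = scale_set pi L by apply/seteqP; split.
  exact: homothety_class_scale.
case: ML; have Mpi : scale_set c M = scale_set pi L.
  by apply/seteqP; split => //; apply: key.
by rewrite -(homothety_class_scale M c0) Mpi homothety_class_scale.
Qed.

Lemma vertex_lattice (v : vtx) L : vertex ord v -> v L ->
  exists g, [/\ GL3 g, L = lat g & v = homothety_class L].
Proof.
move=> [g ug <-] [c c0 <-]; exists (c *: g); split.
- by rewrite /GL3 /mkset unitmxZ // unitfE.
- apply/seteqP; split => [_ [_ [x Ox <-] <-]|_ [x Ox <-]].
    by exists x; rewrite // scalemxAl.
  by exists (g *m x); [exists x|rewrite scalemxAl].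
- by rewrite homothety_class_scale.
Qed.

Lemma vertex_class (v : vtx) : vertex ord v ->
  exists2 g, GL3 g & v = homothety_class (lat g).
Proof. by move=> [g ug <-]; exists g. Qed.

Lemma vertex_lat g : GL3 g -> vertex ord (homothety_class (lat g)).
Proof. by move=> ug; exists g. Qed.

Lemma vertex_sublattice g m (W : 'M[k]_(m, 3)) : GL3 g ->
  vertex ord (homothety_class (sub g W)).
Proof.
move=> ug; have [A [D [_ _ _ _ [uh ->]]]] := sublattice_is_lattice localF resF W ug.
exact: vertex_lat.
Qed.

Definition img_set (gam : 'M[F]_3) L : set 'cV[F]_3 := [set gam *m x | x in L].

Lemma img_lattice gam g : img_set gam (lat g) = lat (gam *m g).
Proof.
apply/seteqP; split => [_ [_ [x Ox <-] <-]|_ [x Ox <-]].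
  by exists x; rewrite // mulmxA.
by exists (g *m x); [exists x|rewrite mulmxA].
Qed.

Lemma img_sublattice gam g m (W : 'M[k]_(m, 3)) : GL3 gam -> GL3 g ->
  img_set gam (sub g W) = sub (gam *m g) W.
Proof.
move=> uga ug; have ugg := GL3M uga ug.
have inv x : invmx (gam *m g) *m (gam *m x) = invmx g *m x.
  apply: (can_inj (mulKmx ugg)); rewrite mulKVmx // -mulmxA mulKVmx //.
have redE x : redv red (gam *m g) (gam *m x) = redv red g x.
  by apply/rowP => i; rewrite !redvE inv.
apply/seteqP; split => [_ [x [gx xW] <-]|x [gx xW]].
  by split; [rewrite -img_lattice; exists x|rewrite redE].
move: gx; rewrite -img_lattice => -[y gy xE]; exists y => //; split => //.
by rewrite -redE xE.
Qed.

Lemma scale_img c L : scale_set c L = img_set c%:M L.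
Proof. by congr (image _ _); apply/funext => x; rewrite mul_scalar_mx. Qed.

Lemma act_class gam L : act gam (homothety_class L) = homothety_class (img_set gam L).
Proof.
apply/seteqP; split => [_ [_ [c c0 <-] <-]|_ [c c0 <-]].
  exists c => //; apply/seteqP; split => [_ [_ [x Lx <-] <-]|_ [_ [x Lx <-] <-]].
    by exists (c *: x); [exists x|rewrite scalemxAr].
  by exists (gam *m x); [exists x|rewrite scalemxAr].
exists (scale_set c L); first by exists c.
apply/seteqP; split => [_ [_ [x Lx <-] <-]|_ [_ [x Lx <-] <-]].
  by exists (gam *m x); [exists x|rewrite scalemxAr].
by exists (c *: x); [exists x|rewrite scalemxAr].
Qed.

Lemma lattice_scale_sub c g : GL3 g -> scale_set c (lat g) `<=` lat g -> O c.
Proof.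
move=> ug sub; pose x : 'cV[F]_3 := delta_mx 0 0.
have gx : lat g (g *m x).
  by exists x => // i; rewrite mxE andbT; case: eqP => _; [apply: O1 localF|apply: O0].
have : lat g (c *: (g *m x)) by apply: sub; exists (g *m x).
move/(mem_lattice ord _ ug)/(_ 0 0); rewrite -scalemxAr mulKmx // !mxE /=.
by rewrite mulr1.
Qed.

(** A factor c from L to the sublattice would have valuation 0 or 1, and the sublattice
    would be L or pi L. *)
Lemma sublattice_class_neq g m (W : 'M[k]_(m, 3)) : GL3 g -> (0 < \rank W < 3)%N ->
  homothety_class (sub g W) <> homothety_class (lat g).
Proof.
move=> ug /andP[W0 W3] E; have pi0 := pi_neq0 localF.
have : homothety_class (lat g) (sub g W) by rewrite -E; apply: homothety_class_refl.
move=> [c c0 cE].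
have Oc : O c by apply: (lattice_scale_sub ug); rewrite cE; apply: sublattice_sub.
have Oc' : O (pi / c).
  apply: (lattice_scale_sub ug); rewrite mulrC -scale_setM.
  rewrite -[X in _ `<=` X](scale_setK _ c0); apply: scale_setS; rewrite cE.
  exact: (pi_sub_sublattice localF resF _ ug).
have [c1|c1] := boolP (ord_ge ord 1 c); last first.
  have [_ OV] := O_unit localF Oc c1.
  move: cE; rewrite (scale_set_unit (lattice_submodule localF g) c0 (ord_eq0 localF c0 Oc OV)).
  have -> : lat g = sub g (1%:M : 'M[k]_3).
    by rewrite sublattice_full // row_full_unit unitmx1.
  by move/(sublattice_eq resF _ _ ug)/eqmxP/eqmx_rank => r; rewrite -r mxrank1 in W3.
have [d Od cd] := ord_ge1P localF c1.
have d0 : d != 0 by apply: contraNneq c0 => d0; rewrite cd d0 mulr0.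
have OV : O d^-1 by rewrite -[d^-1]mul1r -(divff pi0) -mulrA -invfM -cd.
move: cE; rewrite cd -scale_setM.
rewrite (scale_set_unit (lattice_submodule localF g) d0 (ord_eq0 localF d0 Od OV)).
rewrite -(sublattice_0 localF resF 3 ug).
by move/(sublattice_eq resF _ _ ug)/eqmxP/eqmx_rank => r; rewrite -r mxrank0 in W0.
Qed.

Lemma sublattice_class_inj g m n (W : 'M[k]_(m, 3)) (W' : 'M[k]_(n, 3)) :
    GL3 g -> (0 < \rank W < 3)%N ->
  homothety_class (sub g W) = homothety_class (sub g W') -> (W :=: W')%MS.
Proof.
move=> ug rW E; apply/(sublattice_eq resF _ _ ug).
have : homothety_class (sub g W) (sub g W') by rewrite E; apply: homothety_class_refl.
move=> [c c0 cE]; rewrite -cE; apply/esym.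
apply: (@between_unique _ (lat g)) => //.
- exact: (lattice_submodule localF).
- exact: (sublattice_submodule localF resF).
- exact: sublattice_class_neq.
- exact: (pi_sub_sublattice localF resF).
- exact: sublattice_sub.
- by rewrite cE; apply: (pi_sub_sublattice localF resF).
- by rewrite cE; apply: sublattice_sub.
Qed.

(** The representatives that witness an adjacency need only be scaled to L; W is not 0 or
    k^3 because the vertices are distinct. *)
Lemma between_sublattice g (v : vtx) L L' : GL3 g -> vertex ord v ->
    v <> homothety_class (lat g) -> homothety_class (lat g) L -> v L' ->
    scale_set pi L `<=` L' -> L' `<=` L ->
  exists c (W : 'M[k]_3), [/\ c != 0, (0 < \rank W < 3)%N, L = scale_set c (lat g),
    L' = scale_set c (sub g W) & v = homothety_class (sub g W)].
Proof.
move=> ug Vv vg [c c0 <-] vL' piL L'L; have [h [uh L'E vE]] := vertex_lattice Vv vL'.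
have sL' : submodule ord (scale_set c^-1 L').
  by apply: submodule_scale; rewrite L'E; apply: (lattice_submodule localF).
have [||W WE] := submodule_sublattice localF resF ug sL'.
- have -> : scale_set pi (lat g) = scale_set c^-1 (scale_set pi (scale_set c (lat g))).
    by rewrite !scale_setM mulrAC mulVf // mul1r.
  exact: scale_setS.
- by rewrite -[X in _ `<=` X](scale_setK _ c0); apply: scale_setS.
have L'W : L' = scale_set c (sub g W).
  by rewrite -WE -{1}[c]invrK scale_setK ?invr_neq0.
have vW : v = homothety_class (sub g W) by rewrite vE L'W homothety_class_scale.
exists c, W; split => //; rewrite lt0n; apply/andP; split.
  apply/negP; rewrite mxrank_eq0 => /eqP W0; apply: vg.
  by rewrite vW W0 (sublattice_0 localF resF) // homothety_class_scale ?(pi_neq0 localF).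
rewrite ltn_neqAle rank_leq_col andbT; apply/negP => fW; apply: vg.
by rewrite vW sublattice_full.
Qed.

End Neighbours.

(** * The link of a vertex of the building *)

Section Link.
Variables (F : fieldType) (ord : F -> int) (pi : F) (q : nat).
Hypothesis localF : nonarch_local_field ord pi q.
Variables (k : finFieldType) (red : F -> k) (lift : k -> F).
Hypothesis resF : residue_field ord q red lift.
Local Notation O := (ord_ge ord 0).
Local Notation lat := (lattice_of ord).
Local Notation sub := (sublattice ord red).
Local Notation vtx := (set (set 'cV[F]_3)).
Local Notation cls := homothety_class.
Local Notation te := (adjacent_type ord pi q).
Local Notation adj := (adjacent ord pi).
Local Notation pc := (pointed_chamber ord pi).
Implicit Types (g h : 'M[F]_3) (x y : 'cV[F]_3) (c : F) (L M : set 'cV[F]_3).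
Implicit Types a b v w z : vtx.

Lemma scale_sublattice g m c (W : 'M[k]_(m, 3)) : GL3 g -> c != 0 ->
  scale_set c (sub g W) = sub (c%:M *m g) W /\ scale_set c (lat g) = lat (c%:M *m g).
Proof.
move=> ug c0; have uc := GL3_scalar c0.
by rewrite !scale_img (img_sublattice _ _ _ uc ug) img_lattice.
Qed.

Lemma adjacentP g v : GL3 g -> adj (cls (lat g)) v <->
  exists2 W : 'M[k]_3, (0 < \rank W < 3)%N & v = cls (sub g W).
Proof.
move=> ug; split=> [[Vg Vv gv [L [L' [gL vL' piL L'L]]]]|[W rW ->]].
  have [c [W [c0 rW _ _ vW]]] :=
    between_sublattice localF resF ug Vv (nesym gv) gL vL' piL L'L.
  by exists W.
split; [exact: vertex_lat|exact: (vertex_sublattice localF resF)| |].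
  by apply: nesym; apply: (sublattice_class_neq localF resF).
exists (lat g), (sub g W); split; try exact: homothety_class_refl.
  exact: (pi_sub_sublattice localF resF).
exact: sublattice_sub.
Qed.

Lemma expq_inj i j : (q ^ i)%N = (q ^ j)%N -> i = j.
Proof. by move/eqP; rewrite eqn_exp2l ?(residue_card_gt1 resF) // => /eqP. Qed.

(** The neighbours of a vertex form a projective plane over k: those of type 1 are the
    planes of k^3 and those of type 2 the lines of k^3. *)
Lemma adjacent_typeP i g v : (0 < i < 3)%N -> GL3 g -> te i (cls (lat g)) v <->
  exists2 W : 'M[k]_3, (\rank W + i = 3)%N & v = cls (sub g W).
Proof.
move=> i3 ug; have full1 : row_full (1%:M : 'M[k]_3) by rewrite row_full_unit unitmx1.
split=> [[Vg Vv gv [L [L' [gL vL' piL L'L LL']]]]|[W rW ->]].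
  have [c [W [c0 rW LE L'E vW]]] :=
    between_sublattice localF resF ug Vv (nesym gv) gL vL' piL L'L.
  exists W => //; move: LL'; rewrite LE L'E.
  have [-> ->] := scale_sublattice W ug c0; set h := _ *m g => Lh.
  have uh : GL3 h by apply: GL3M => //; apply: GL3_scalar.
  have := sublattice_index localF resF uh (submx1 W).
  rewrite (sublattice_full _ _ _ full1) mxrank1 => /(has_index_unique Lh)/expq_inj.
  by move=> ->; rewrite subnKC // ltnW //; case/andP: rW.
have rW' : (0 < \rank W < 3)%N by lia.
have [? ? ? _] := (adjacentP _ ug).2 (ex_intro2 _ _ W rW' erefl); split => //.
exists (lat g), (sub g W); split; try exact: homothety_class_refl.
- exact: (pi_sub_sublattice localF resF).
- exact: sublattice_sub.
have := sublattice_index localF resF ug (submx1 W).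
have iE : (3 - \rank W = i)%N by lia.
by rewrite (sublattice_full _ _ _ full1) mxrank1 iE.
Qed.

(** The chambers at a vertex are the flags of its projective plane. The two neighbours
    come with scaling factors c and d, and c / d is a unit since both scale L to the same
    lattice. *)
Lemma pointed_chamberP g v w : GL3 g -> pc (cls (lat g), v, w) <->
  exists W U : 'M[k]_3, [/\ \rank W = 2%N, \rank U = 1%N, (U <= W)%MS,
    v = cls (sub g W) & w = cls (sub g U)].
Proof.
move=> ug; split=> [[/= Vg Vv Vw [gv vw gw]]|[W [U [rW rU UW -> ->]]]].
  move=> [L [L' [L'' [gL vL' wL'' [piL L''L' L'L]]]]].
  have [c [W [c0 rW LE L'E vW]]] :=
    between_sublattice localF resF ug Vv (nesym gv) gL vL' (subset_trans piL L''L') L'L.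
  have [d [U [d0 rU LE' L''E wU]]] :=
    between_sublattice localF resF ug Vw (nesym gw) gL wL'' piL (subset_trans L''L' L'L).
  have cd : scale_set (d / c) (lat g) = lat g.
    by rewrite mulrC -scale_setM -LE' LE scale_setK.
  have odc : O (d / c) by apply: (lattice_scale_sub localF ug); rewrite cd.
  have ocd : O (c / d).
    apply: (lattice_scale_sub localF ug); rewrite -{2}(scale_setK (lat g) d0) -LE' LE.
    by rewrite scale_setM mulrC.
  have dc0 : d / c != 0 by rewrite mulf_neq0 ?invr_neq0.
  have L''E' : L'' = scale_set c (sub g U).
    rewrite L''E -[d in LHS](divfK c0) mulrC -scale_setM; congr (scale_set c _).
    apply: (scale_set_unit localF _ dc0); first exact: (sublattice_submodule localF resF).
    by apply: (ord_eq0 localF) => //; rewrite invf_div.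
  have UW : (U <= W)%MS.
    apply/(sublattice_le resF _ _ ug).
    rewrite -(scale_setK (sub g U) c0) -(scale_setK (sub g W) c0) -L'E -L''E'.
    exact: scale_setS.
  have UW' : (\rank U < \rank W)%N.
    rewrite (ltn_leqif (mxrank_leqif_sup UW)); apply/negP => WU.
    case: vw; rewrite vW wU; congr cls; apply/(sublattice_eq resF _ _ ug).
    by apply/eqmxP/andP.
  by exists W, U; rewrite vW wU; split => //; move: rW rU => /andP[_ ?] /andP[? _]; lia.
have rW' : (0 < \rank W < 3)%N by rewrite rW.
have rU' : (0 < \rank U < 3)%N by rewrite rU.
split => /=; try exact: (vertex_sublattice localF resF).
- exact: vertex_lat.
- split; [apply: nesym| |apply: nesym]; try exact: (sublattice_class_neq localF resF).
  by move/(sublattice_class_inj localF resF ug rW')/eqmxP/eqmx_rank; rewrite rW rU.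
exists (lat g), (sub g W), (sub g U); split; try exact: homothety_class_refl.
split; first exact: (pi_sub_sublattice localF resF).
  exact/(sublattice_le resF _ _ ug).
exact: sublattice_sub.
Qed.

(** If L' lies between pi L and L then pi L lies between pi L' and L', with the
    complementary index. *)
Lemma adjacent_type_rev i v w : (0 < i < 3)%N -> te i v w -> te (3 - i) w v.
Proof.
move=> i3 vw; have [Vv Vw nvw _] := vw; have [g ug vE] := vertex_class Vv.
move: (vw); rewrite vE => /(adjacent_typeP _ i3 ug)[W rW wW].
split; [by []|exact: vertex_lat|by move=> wv; apply: nvw; rewrite vE|].
exists (sub g W), (scale_set pi (lat g)); split.
- by rewrite wW; apply: homothety_class_refl.
- by exists pi; first exact: (pi_neq0 localF).
- by apply: scale_setS; apply: sublattice_sub.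
- exact: (pi_sub_sublattice localF resF).
have := sublattice_index localF resF ug (sub0mx 3 W).
have -> : (3 - i = \rank W)%N by lia.
by rewrite (sublattice_0 localF resF) // mxrank0 subn0.
Qed.

Lemma adjacent_type_adjacent i v w : te i v w -> adj v w.
Proof. by move=> [? ? ? [L [L' [? ? ? ? _]]]]; split => //; exists L, L'. Qed.

Lemma adjacent_types v w : adj v w -> te 1 v w \/ te 2 v w.
Proof.
move=> vw; have [Vv _ _ _] := vw; have [g ug vE] := vertex_class Vv.
move: vw; rewrite vE => /(adjacentP _ ug)[W rW wW].
have [r1|r2] : \rank W = 1%N \/ \rank W = 2%N by lia.
  by right; apply/(adjacent_typeP _ _ ug) => //; exists W; rewrite ?r1.
by left; apply/(adjacent_typeP _ _ ug) => //; exists W; rewrite ?r2.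
Qed.

Lemma adjacent_type_excl v w : te 1 v w -> te 2 v w -> False.
Proof.
move=> vw; have [Vv _ _ _] := vw; have [g ug vE] := vertex_class Vv.
move: vw; rewrite vE => /(adjacent_typeP _ _ ug)[//|W rW ->].
move=> /(adjacent_typeP _ _ ug)[//|U rU].
have rW' : (0 < \rank W < 3)%N by lia.
by move/(sublattice_class_inj localF resF ug rW')/eqmxP/eqmx_rank; lia.
Qed.

(** The chain L > L' > L'' > pi L continues periodically by powers of pi, so that L' may
    serve as its first term. *)
Lemma pointed_chamber_faces v w z : pc (v, w, z) ->
  [/\ te 1 v w, te 1 w z, te 1 z v & pc (w, z, v)].
Proof.
move=> vwz; have [/= Vv Vw Vz [nvw nwz nvz] _] := vwz.
have [g ug vE] := vertex_class Vv; move: (vwz); rewrite vE.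
move=> /(pointed_chamberP _ _ ug)[W [U [rW rU UW wW zU]]].
have piU : scale_set pi (sub g W) `<=` sub g U.
  apply: subset_trans (pi_sub_sublattice localF resF _ ug).
  by apply: scale_setS; apply: sublattice_sub.
have pi_cls : cls (lat g) (scale_set pi (lat g)).
  by exists pi; first exact: (pi_neq0 localF).
split.
- by apply/(adjacent_typeP _ _ ug) => //; exists W; rewrite ?rW.
- split => //; exists (sub g W), (sub g U); rewrite wW zU.
  split; try exact: homothety_class_refl; first exact: piU.
    exact/(sublattice_le resF _ _ ug).
  by have := sublattice_index localF resF ug UW; rewrite rW rU.
- split => //; [by rewrite -vE|by rewrite -vE; apply: nesym|].
  exists (sub g U), (scale_set pi (lat g)); rewrite zU.
  split; try exact: homothety_class_refl; first exact: pi_cls.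
  + by apply: scale_setS; apply: sublattice_sub.
  + exact: (pi_sub_sublattice localF resF).
  have := sublattice_index localF resF ug (sub0mx 3 U).
  by rewrite (sublattice_0 localF resF) // mxrank0 subn0 rU.
split => //=; rewrite -?vE //; first by split => //; apply: nesym.
exists (sub g W), (sub g U), (scale_set pi (lat g)); rewrite wW zU vE.
split; try exact: homothety_class_refl; first exact: pi_cls.
split.
- by apply: scale_setS; apply: sublattice_sub.
- exact: (pi_sub_sublattice localF resF).
- exact/(sublattice_le resF _ _ ug).
Qed.

(** Two distinct planes of k^3 meet in a line. *)
Lemma two_planes_meet v w z : te 1 v w -> te 1 v z -> w <> z ->
  exists2 t, pc (v, w, t) /\ pc (v, z, t) &
    forall t', pc (v, w, t') -> pc (v, z, t') -> t' = t.
Proof.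
move=> vw; have [Vv _ _ _] := vw; have [g ug vE] := vertex_class Vv.
move: vw; rewrite vE => /(adjacent_typeP _ _ ug)[//|W rW ->].
move=> /(adjacent_typeP _ _ ug)[//|U rU ->] WU.
have nWU : ~ (W :=: U)%MS.
  by move=> E; apply: WU; congr cls; apply/(sublattice_eq resF _ _ ug).
have rS : \rank (W + U)%MS = 3%N.
  have le3 := rank_leq_col (W + U)%MS.
  have leW := mxrank_leqif_sup (addsmxSl W U); have leU := mxrank_leqif_sup (addsmxSr W U).
  apply/eqP; rewrite eqn_leq le3 ltnNge; apply/negP => le2; apply: nWU.
  have sW : (W + U <= W)%MS by rewrite -(geq_leqif leW); lia.
  have sU : (W + U <= U)%MS by rewrite -(geq_leqif leU); lia.
  by apply/eqmxP/andP; split; [apply: submx_trans sU|apply: submx_trans sW];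
    rewrite ?addsmxSl ?addsmxSr.
have rI : \rank (W :&: U)%MS = 1%N by have := mxrank_sum_cap W U; lia.
exists (cls (sub g (W :&: U)%MS)).
  by split; apply/(pointed_chamberP _ _ ug);
    [exists W, (W :&: U)%MS|exists U, (W :&: U)%MS]; split=> //;
    rewrite ?capmxSl ?capmxSr //; lia.
move=> t /(pointed_chamberP _ _ ug)[W' [A [rW' rA AW EW ->]]].
move=> /(pointed_chamberP _ _ ug)[U' [B [rU' rB BU EU EB]]].
have rW2 : (0 < \rank W < 3)%N by lia.
have rU2 : (0 < \rank U < 3)%N by lia.
have rA2 : (0 < \rank A < 3)%N by rewrite rA.
have {}EW := sublattice_class_inj localF resF ug rW2 EW.
have {}EU := sublattice_class_inj localF resF ug rU2 EU.
have {}EB := sublattice_class_inj localF resF ug rA2 EB.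
congr cls; apply/(sublattice_eq resF _ _ ug).
have AI : (A <= W :&: U)%MS by rewrite sub_capmx EW EU AW EB.
apply/eqmxP; rewrite /eqmx AI -(geq_leqif (mxrank_leqif_sup AI)); lia.
Qed.

(** Two distinct lines of k^3 span a plane. *)
Lemma two_lines_span v w z : te 2 v w -> te 2 v z -> w <> z ->
  exists2 t, pc (v, t, w) /\ pc (v, t, z) &
    forall t', pc (v, t', w) -> pc (v, t', z) -> t' = t.
Proof.
move=> vw; have [Vv _ _ _] := vw; have [g ug vE] := vertex_class Vv.
move: vw; rewrite vE => /(adjacent_typeP _ _ ug)[//|W rW ->].
move=> /(adjacent_typeP _ _ ug)[//|U rU ->] WU.
have nWU : ~ (W :=: U)%MS.
  by move=> E; apply: WU; congr cls; apply/(sublattice_eq resF _ _ ug).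
have rI : \rank (W :&: U)%MS = 0%N.
  have leW := mxrank_leqif_sup (capmxSl W U); have leU := mxrank_leqif_sup (capmxSr W U).
  apply/eqP; rewrite -leqn0 leqNgt; apply/negP => le2; apply: nWU.
  have sW : (W <= W :&: U)%MS by rewrite -(geq_leqif leW); lia.
  have sU : (U <= W :&: U)%MS by rewrite -(geq_leqif leU); lia.
  by apply/eqmxP/andP; split; [apply: submx_trans sW _|apply: submx_trans sU _];
    rewrite ?capmxSl ?capmxSr.
have rS : \rank (W + U)%MS = 2%N by have := mxrank_sum_cap W U; lia.
exists (cls (sub g (W + U)%MS)).
  by split; apply/(pointed_chamberP _ _ ug);
    [exists (W + U)%MS, W|exists (W + U)%MS, U]; split=> //;
    rewrite ?addsmxSl ?addsmxSr //; lia.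
move=> t /(pointed_chamberP _ _ ug)[A [W' [rA rW' AW -> EW]]].
move=> /(pointed_chamberP _ _ ug)[B [U' [rB rU' BU EB EU]]].
have rW2 : (0 < \rank W < 3)%N by lia.
have rU2 : (0 < \rank U < 3)%N by lia.
have rA2 : (0 < \rank A < 3)%N by rewrite rA.
have {}EW := sublattice_class_inj localF resF ug rW2 EW.
have {}EU := sublattice_class_inj localF resF ug rU2 EU.
have {}EB := sublattice_class_inj localF resF ug rA2 EB.
congr cls; apply/(sublattice_eq resF _ _ ug).
have AI : (W + U <= A)%MS by rewrite addsmx_sub EW AW EU EB.
apply/eqmxP; rewrite /eqmx AI andbT -(geq_leqif (mxrank_leqif_sup AI)); lia.
Qed.

(** The lines of a plane are the points of a projective line: [Some a] stands for the
    direction (1, a) and [None] for (0, 1). *)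
Lemma lines_in_plane (W : 'M[k]_3) : \rank W = 2%N ->
  exists f : option k -> 'M[k]_3, [/\ forall t, \rank (f t) = 1%N,
    forall t, (f t <= W)%MS, forall t t', (f t :=: f t')%MS -> t = t' &
    forall U : 'M[k]_3, \rank U = 1%N -> (U <= W)%MS -> exists t, (U :=: f t)%MS].
Proof.
move=> rW; have [B BW fB] : exists2 B : 'M[k]_(2, 3), (B :=: W)%MS & row_free B.
  move: (row_base W) (eq_row_base W) (row_base_free W).
  by rewrite rW => B; exists B.
pose e (t : option k) : 'rV[k]_2 :=
  \row_j if t is Some a then (if j == 0 then 1 else a) else (j != 0)%:R.
have e_dec (t : option k) : e t != 0.
  case: t => [a|]; apply/eqP => /rowP; [move/(_ 0)|move/(_ 1)]; rewrite !mxE /= => /eqP;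
  by rewrite oner_eq0.
have lineP (u v : 'rV[k]_2) : v != 0 -> (u <= v)%MS -> u != 0 -> (v <= u)%MS.
  move=> v0 /sub_rVP[c ->]; rewrite scaler_eq0 negb_or => /andP[c0 _].
  by apply/sub_rVP; exists c^-1; rewrite scalerA mulVf // scale1r.
have rank_e t : \rank (e t *m B) = 1%N by rewrite mxrankMfree // rank_rV e_dec.
exists (fun t => <<e t *m B>>%MS); split.
- by move=> t; rewrite genmxE rank_e.
- by move=> t; rewrite genmxE -BW submxMl.
- move=> t t' /eqmxP; rewrite /eqmx !genmxE => /andP[].
  rewrite submxMfree // => /sub_rVP[c] /rowP E _.
  move: (E 0) (E 1); rewrite !mxE /=; case: t t' E => [a|] [a'|] E; rewrite /= ?mulr1 ?mulr0.
  + by move=> <-; rewrite mul1r => ->.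
  + by move=> /eqP; rewrite oner_eq0.
  + by move=> <-; rewrite mul0r => /eqP; rewrite oner_eq0.
  + by [].
- move=> U rU UW; have [u uU] : exists u : 'rV[k]_2, (u *m B :=: U)%MS.
    move: (row_base U) (eq_row_base U); rewrite rU => r rE.
    have /submxP[u uE] : (r <= B)%MS by rewrite BW rE.
    by exists u; rewrite -uE.
  have u0 : u != 0.
    by apply: contra_eq_neq rU => u0; rewrite -uU u0 mul0mx mxrank0.
  suff [t ut] : exists t, (u <= e t)%MS.
    exists t; apply: (eqmx_trans (eqmx_sym uU)); apply: eqmx_sym.
    apply: (eqmx_trans (genmxE _)); apply/eqmxP/andP; split; apply: submxMr => //.
    by apply: lineP.
  have [u00|u00] := eqVneq (u 0 0) 0.
    exists None; apply/sub_rVP; exists (u 0 1); apply/rowP => j; rewrite !mxE.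
    by have [->|->] : j = 0 \/ j = 1 by [case: j => [[|[|//]] ?]; [left|right]; apply: val_inj];
      rewrite /= ?mulr0 ?mulr1.
  exists (Some (u 0 1 / u 0 0)); apply/sub_rVP; exists (u 0 0); apply/rowP => j; rewrite !mxE.
  have [->|->] : j = 0 \/ j = 1 by [case: j => [[|[|//]] ?]; [left|right]; apply: val_inj].
    by rewrite mulr1.
  by rewrite /= mulrCA divff ?mulr1.
Qed.

(** The third vertices are the q + 1 lines in the plane that defines the edge. *)
Lemma chambers_on_edge v w : te 1 v w ->
  exists (I : finType) (f : I -> vtx),
    [/\ #|I| = q.+1, injective f & forall z, pc (v, w, z) <-> exists i, f i = z].
Proof.
move=> vw; have [Vv _ _ _] := vw; have [g ug vE] := vertex_class Vv.
move: vw; rewrite vE => /(adjacent_typeP _ _ ug)[//|W rW ->].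
have {}rW : \rank W = 2%N by lia.
have [f [rf fW f_inj fS]] := lines_in_plane rW.
exists (option k), (fun t => cls (sub g (f t))); split.
- by rewrite card_option (card_residue resF).
- move=> t t' E; apply: f_inj; apply: (sublattice_class_inj localF resF ug _ E).
  by rewrite rf.
move=> z; split=> [/(pointed_chamberP _ _ ug)[W' [U [rW' rU UW' EW ->]]]|[t <-]].
  have rW2 : (0 < \rank W < 3)%N by rewrite rW.
  have {}EW := sublattice_class_inj localF resF ug rW2 EW.
  have [|t Ut] := fS U rU; first by rewrite EW.
  by exists t; congr cls; apply/(sublattice_eq resF _ _ ug); apply: eqmx_sym.
by apply/(pointed_chamberP _ _ ug); exists W, (f t).
Qed.

Lemma adjacent_finite v : vertex ord v -> finite_set [set w | adj v w].
Proof.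
move=> /vertex_class[g ug ->].
pose f (S : {set 'rV[k]_3}) : vtx := cls [set x | lat g x /\ redv red g x \in S].
apply: (@sub_finite_set _ _ (f @` setT)); last exact: finite_image.
move=> w /(adjacentP _ ug)[W _ ->]; exists (rowg W) => //.
by congr cls; apply/seteqP; split => x [gx]; rewrite /mkset mem_rowg.
Qed.

Lemma adjacent_type_exists i v : (0 < i < 3)%N -> vertex ord v -> exists w, te i v w.
Proof.
move=> i3 /vertex_class[g ug ->]; pose W : 'M[k]_3 := pid_mx (3 - i).
exists (cls (sub g W)); apply/(adjacent_typeP _ i3 ug); exists W => //.
by rewrite rank_pid_mx ?leq_subr // subnK //; lia.
Qed.

Lemma act_vertex gam v : GL3 gam -> vertex ord v -> vertex ord (act gam v).
Proof.
move=> uga /vertex_class[g ug ->]; rewrite act_class img_lattice.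
by apply: vertex_lat; apply: GL3M.
Qed.

Lemma act_adjacent_type i gam v w : (0 < i < 3)%N -> GL3 gam ->
  te i v w -> te i (act gam v) (act gam w).
Proof.
move=> i3 uga vw; have [Vv _ _ _] := vw; have [g ug vE] := vertex_class Vv.
move: vw; rewrite vE => /(adjacent_typeP _ i3 ug)[W rW ->].
have ugg := GL3M uga ug.
rewrite !act_class img_lattice (img_sublattice _ _ _ uga ug).
by apply/(adjacent_typeP _ i3 ugg); exists W.
Qed.

Lemma act_adjacent gam v w : GL3 gam -> adj v w -> adj (act gam v) (act gam w).
Proof.
move=> uga /adjacent_types[]; [move: (isT : (0 < 1 < 3)%N)|move: (isT : (0 < 2 < 3)%N)];
  by move=> i3 /(act_adjacent_type i3 uga); apply: adjacent_type_adjacent.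
Qed.

Lemma act_pointed_chamber gam v w z : GL3 gam ->
  pc (v, w, z) -> pc (act gam v, act gam w, act gam z).
Proof.
move=> uga vw; have [/= Vv _ _ _ _] := vw; have [g ug vE] := vertex_class Vv.
move: vw; rewrite vE => /(pointed_chamberP _ _ ug)[W [U [rW rU UW -> ->]]].
have ugg := GL3M uga ug.
rewrite !act_class img_lattice !(img_sublattice _ _ _ uga ug).
by apply/(pointed_chamberP _ _ ugg); exists W, U.
Qed.

Lemma lattice_eq_integral g h : GL3 g -> lat g `<=` lat h -> GL3 h -> integral ord (invmx h *m g).
Proof.
move=> ug gh uh i j; have gx : lat g (g *m delta_mx j 0).
  exists (delta_mx j 0) => // l; rewrite mxE andbT.
  by case: eqP => _; [apply: (O1 localF)|apply: O0].
have := (mem_lattice _ _ uh).1 (gh _ gx) i 0.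
by rewrite mulmxA -colE mxE.
Qed.

Lemma lattice_eq_GL3_O g h : GL3 g -> GL3 h -> lat g = lat h -> GL3_O ord (invmx h *m g).
Proof.
move=> ug uh E; have u : invmx h *m g \in unitmx by rewrite unitmx_mul unitmx_inv; apply/andP.
split => //; first by apply: lattice_eq_integral => //; rewrite E.
have -> : invmx (invmx h *m g) = invmx g *m h.
  apply: (can_inj (mulKmx u)); rewrite mulmxV // -mulmxA mulKVmx // mulVmx //.
by apply: lattice_eq_integral => //; rewrite E.
Qed.

(** If gam fixes the class of the lattice of g, then gam g = c g h with c a scalar and h
    in GL_3(O). *)
Lemma stabilizer_conj_KZ gam v : GL3 gam -> vertex ord v -> act gam v = v ->
  exists2 g, GL3 g & conj_KZ ord g gam.
Proof.
move=> uga /vertex_class[g ug ->]; rewrite act_class img_lattice => E; exists g => //.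
have ugg := GL3M uga ug.
have : cls (lat g) (lat (gam *m g)) by rewrite -E; apply: homothety_class_refl.
move=> [c c0]; have [_ ->] := scale_sublattice (0 : 'M[k]_3) ug c0.
have ucg := GL3M (GL3_scalar c0) ug.
move=> /esym/(lattice_eq_GL3_O ugg ucg) Ok; eexists; exists c; split; first exact: Ok.
  exact: c0.
rewrite mul_scalar_mx; have -> : c *: (invmx (c *: g) *m (gam *m g)) = invmx g *m (gam *m g).
  have uc : c \is a GRing.unit by rewrite unitfE.
  by rewrite invmxZ ?unitmxZ // -scalemxAl scalerA divff // scale1r.
by rewrite mulKVmx // mulmxK.
Qed.

Lemma ord_det_GL3_O g : GL3_O ord g -> ord (\det g) = 0.
Proof.
move=> [ug Og OV]; have d0 : \det g != 0 by rewrite -unitfE -unitmxE.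
apply: (ord_eq0 localF) => //; first exact: (integral_det localF).
by rewrite -det_inv; apply: (integral_det localF).
Qed.

(** The valuation of det g modulo 3 depends only on the vertex defined by g, and it grows
    by 1 along an edge of type 1. *)
Lemma no_loop gam v : GL3 gam -> te 1 v (act gam v) -> ~~ (3%:Z %| ord (\det gam))%Z.
Proof.
move=> uga vw; have [Vv _ _ _] := vw; have [g ug vE] := vertex_class Vv.
move: vw; rewrite vE => /(adjacent_typeP _ _ ug)[//|W rW]; rewrite act_class img_lattice => E.
have ugg := GL3M uga ug.
have : cls (lat (gam *m g)) (sub g W) by rewrite E; apply: homothety_class_refl.
have [A [D [uA OA OV DE [uh ->]]]] := sublattice_is_lattice localF resF W ug.
move=> [c c0]; have [_ ->] := scale_sublattice (0 : 'M[k]_3) ugg c0.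
have uc := GL3_scalar c0.
have ucg := GL3M uc ugg.
move=> /(lattice_eq_GL3_O ucg uh)/ord_det_GL3_O; set h := g *m A *m diag_mx D.
have ne (X : 'M[F]_3) : GL3 X -> \det X != 0 by rewrite /GL3 /mkset unitmxE unitfE.
have oA : ord (\det A) = 0 by apply: ord_det_GL3_O.
have oD : ord (\det (diag_mx D)) = 1.
  rewrite det_diag !big_ord_recl big_ord0 !DE; have -> : \rank W = 2%N by lia.
  by rewrite /= !mul1r mulr1 (ord_pi localF).
have uD : GL3 (diag_mx D) by move: uh; rewrite /GL3 /mkset unitmx_mul => /andP[].
have oh : ord (\det h) = ord (\det g) + 1.
  by rewrite !det_mulmx !(ordM localF) ?mulf_neq0 ?ne // oA oD addr0.
rewrite !det_mulmx det_inv det_scalar !(ordM localF) ?mulf_neq0 ?invr_neq0 ?expf_neq0 ?ne //.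
rewrite (ordV localF) ?ne // oh => E0.
apply/negP => /dvdzP[d dE]; move: E0; rewrite dE.
by move: (ord c) (ord (\det g)) => a b; clear; lia.
Qed.

End Link.

(** * Straight paths *)

Section StraightPaths.
Variables (F : fieldType) (ord : F -> int) (pi : F) (q : nat).
Hypothesis localF : nonarch_local_field ord pi q.
Local Notation O := (ord_ge ord 0).
Local Notation lat := (lattice_of ord).
Local Notation vtx := (set (set 'cV[F]_3)).
Local Notation cls := homothety_class.
Local Notation te := (adjacent_type ord pi q).
Local Notation adj := (adjacent ord pi).
Implicit Types (g h : 'M[F]_3) (x y : 'cV[F]_3) (c : F) (L M : set 'cV[F]_3).
Implicit Types a b v w z : vtx.

(** No vertex of the path can be skipped. *)
Definition straight (s : seq vtx) : Prop :=
  forall s1 a b d s2, s = s1 ++ [:: a, b, d & s2] -> ~ adj a d.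

Lemma straight_behead a s : straight (a :: s) -> straight s.
Proof. by move=> H s1 b d e s2 E; apply: (H (a :: s1) b d e s2); rewrite E. Qed.

Lemma straight_rev s : (forall a b, adj a b -> adj b a) -> straight s -> straight (rev s).
Proof.
move=> adjC H s1 a b d s2 E /adjC; apply: (H (rev s2) d b a (rev s1)).
by rewrite -[LHS]revK E rev_cat !rev_cons -!cats1 -!catA.
Qed.

Lemma path_vertex_last (e : rel vtx) v p : (forall a b, e a b -> vertex ord b) ->
  vertex ord v -> path e v p -> vertex ord (last v p).
Proof. by move=> eV; elim: p v => //= w p IH v _ /andP[/eV]; apply: IH. Qed.

Section Straight1.
Variables (k : finFieldType) (red : F -> k) (lift : k -> F).
Hypothesis resF : residue_field ord q red lift.
Local Notation sub := (sublattice ord red).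

Let piX_sub m n L : submodule ord L -> (m <= n)%N ->
  scale_set (pi ^+ n) L `<=` scale_set (pi ^+ m) L.
Proof.
move=> sL le; rewrite -(subnK le) addnC exprD -scale_setM; apply: scale_setS.
apply: (scale_set_sub sL); rewrite /ord_ge (ordX localF) ?(pi_neq0 localF) //.
by rewrite (ord_pi localF) ler0n orbT.
Qed.

Let scale_set_pi c L x : submodule ord L -> c != 0 -> ord c < 0 -> L (c *: x) ->
  scale_set pi L x.
Proof.
move=> [_ _ LZ] c0 oc Lcx; have pi0 := pi_neq0 localF.
exists ((pi^-1 * c^-1) *: (c *: x)); last first.
  by rewrite !scalerA mulrA divff // mul1r mulVf // scale1r.
apply: LZ Lcx; rewrite /ord_ge mulf_eq0 !invr_eq0 (negPf c0) (negPf pi0) /=.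
by rewrite (ordM localF) ?invr_neq0 // !(ordV localF) // (ord_pi localF); move: oc; lia.
Qed.

(** A sublattice of index q is maximal, for its image is a plane. *)
Let maximal h (W : 'M[k]_3) M : GL3 h -> \rank W = 2%N -> submodule ord M ->
  sub h W `<=` M -> M `<=` lat h -> ~ M `<=` sub h W -> M = lat h.
Proof.
move=> uh rW sM WM Mh nM.
have piM := subset_trans (pi_sub_sublattice localF resF W uh) WM.
have [V VE] := submodule_sublattice localF resF uh sM piM Mh.
rewrite VE in WM nM *; move: WM nM; rewrite !(sublattice_le resF _ _ uh) => WV nV.
apply: sublattice_full; rewrite /row_full.
have := rank_leq_col V; have := mxrank_leqif_sup WV.
move=> [le]; rewrite (introF idP nV) rW => /eqP ne le3.
by move: le ne; rewrite rW; lia.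
Qed.

Let chain_step v w L : te 1 v w -> v L -> exists g (W : 'M[k]_3),
  [/\ GL3 g, L = lat g, \rank W = 2%N & w (sub g W)].
Proof.
move=> vw vL; have [Vv _ _ _] := vw; have [g [ug LE vE]] := vertex_lattice Vv vL.
move: vw; rewrite vE LE => /(adjacent_typeP localF resF _ _ ug)[//|W rW wE].
exists g, W; split => //; first by lia.
by rewrite wE; apply: homothety_class_refl.
Qed.

(** A path of type 1 and length n is a chain L0 > L1 > ... > Ln with steps of index q.
    Straightness means that pi L_j is not contained in L_(j+2), which is maximal in
    L_(j+1); so L_(j+1) = L_(j+2) + pi L_j. By induction L1 = Ln + pi L0, and pi^(n-1) L0
    is not contained in Ln. Here n is the size of p plus 1. *)
Let chain_far v w p L0 : path (fun a b => `[< te 1 a b >]) v (w :: p) ->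
    straight [:: v, w & p] -> v L0 ->
  exists L1 Ln, [/\ submodule ord L0, submodule ord L1, submodule ord Ln, w L1 /\ last w p Ln &
    [/\ scale_set pi L0 `<=` L1 /\ L1 `<=` L0, ~ L1 `<=` scale_set pi L0, Ln `<=` L1,
      forall x, L1 x -> exists (y z : 'cV[F]_3), [/\ Ln y, scale_set pi L0 z & x = y + z] &
      ~ scale_set (pi ^+ size p) L0 `<=` Ln]].
Proof.
elim: p v w L0 => [|w' p IH] v w L0 /= /andP[/asboolP vw wp] st vL0.
all: have [g [W [ug LE rW wW]]] := chain_step vw vL0; subst L0.
all: have s0 := lattice_submodule localF g.
all: have s1 := sublattice_submodule localF resF W ug.
all: have nW : ~ sub g W `<=` scale_set pi (lat g) by
  [rewrite -(sublattice_0 localF resF 3 ug) (sublattice_le resF _ _ ug) => /mxrankS;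
   rewrite rW mxrank0].
  exists (sub g W), (sub g W); split => //; split => //.
  - by split; [apply: (pi_sub_sublattice localF resF)|apply: sublattice_sub].
  - move=> x Wx; exists x, 0; rewrite addr0; split => //.
    by exists 0; rewrite ?scaler0 //; case: s0.
  - rewrite expr0 scale_set1; have -> : lat g = sub g (1%:M : 'M[k]_3).
      by rewrite sublattice_full // row_full_unit unitmx1.
    by rewrite (sublattice_le resF _ _ ug) => /mxrankS; rewrite rW mxrank1.
have [L2 [Ln [_ s2 sn [wL2 lLn] [[pi2 L21] nL2 Ln2 dec nfar]]]] :=
  IH w w' _ wp (straight_behead st) wW.
move: wp => /andP[/asboolP ww' _].
have [h [W2 [uh hE rW2 w'W2]]] := chain_step ww' wW.
have Vw' : vertex ord w' by case: ww'.
have L2E : L2 = sub h W2.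
  have [h' [uh' W2E w'E]] := vertex_lattice Vw' w'W2.
  move: wL2; rewrite w'E => -[c c0 cE]; rewrite -cE.
  have rW2' : (0 < \rank W2 < 3)%N by rewrite rW2.
  apply: (between_unique localF c0 (lattice_submodule localF h)).
  - exact: (sublattice_submodule localF resF).
  - exact: (sublattice_class_neq localF resF).
  - exact: (pi_sub_sublattice localF resF).
  - exact: sublattice_sub.
  - by rewrite cE -hE.
  - by rewrite cE -hE.
have L2g : L2 `<=` lat g by apply: subset_trans L21 _; apply: sublattice_sub.
have npi : ~ scale_set pi (lat g) `<=` L2.
  move=> piL2; apply: (st [::] v w w' p erefl); split; first by case: vw.
  - by case: ww'.
    (* If v = w' then L2 = pi L0, which has index q^2 in L1 and not q. *)
  - move=> vE.
    have [U UE] := submodule_sublattice localF resF ug s2 piL2 L2g.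
    have Vv : vertex ord v by case: vw.
    have [_ [_ _ vcls]] := vertex_lattice Vv vL0.
    have [_ [_ _ w'cls]] := vertex_lattice Vw' wL2.
    have UW : (U <= W)%MS by apply/(sublattice_le resF _ _ ug); rewrite -UE.
    have [uL2|uL2] := boolP (0 < \rank U < 3)%N.
      by apply: (sublattice_class_neq localF resF ug uL2); rewrite -UE -w'cls -vE.
    have U0 : \rank U = 0%N by have := mxrankS UW; lia.
    have i1 := sublattice_index localF resF ug UW.
    have i2 := sublattice_index localF resF uh (submx1 W2).
    have fl : sub h (1%:M : 'M[k]_3) = lat h.
      by rewrite sublattice_full // row_full_unit unitmx1.
    move: i1 i2; rewrite -UE L2E hE fl => i1.
    by move/(has_index_unique i1)/(expq_inj resF); rewrite U0 rW rW2 mxrank1.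
  by exists (lat g), L2; split.
(* L1 = Ln + pi L0 because L2 is maximal in L1 and does not contain pi L0. *)
pose S : set 'cV[F]_3 := [set x | exists (y z : 'cV[F]_3), [/\ Ln y, scale_set pi (lat g) z & x = y + z]].
have sp : submodule ord (scale_set pi (lat g)) by apply: submodule_scale.
have sS : submodule ord S.
  split.
  - by exists 0, 0; split; rewrite ?addr0 //; [case: sn|case: sp].
  - move=> _ _ [y [z [Ly Lz ->]]] [y' [z' [Ly' Lz' ->]]]; exists (y + y'), (z + z').
    by split; [case: sn => _ + _; apply|case: sp => _ + _; apply|rewrite addrACA].
  - move=> c _ Oc [y [z [Ly Lz ->]]]; exists (c *: y), (c *: z).
    by split; [case: sn => _ _; apply|case: sp => _ _; apply|rewrite scalerDr].
have L2S : L2 `<=` S.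
  move=> x /dec[y [z [Ly [u Wu uz] ->]]]; exists y, z; split => //.
  by exists u => //; apply: sublattice_sub Wu.
have SL1 : S `<=` sub g W.
  move=> _ [y [z [Ly Lz ->]]]; case: s1 => _ + _; apply; first exact/L21/Ln2.
  exact: (pi_sub_sublattice localF resF).
have SE : S = lat h.
  apply: (maximal uh rW2 sS); rewrite -?L2E -?hE //.
  move=> SL2; apply: npi => x xx; apply: SL2; exists 0, x; split; rewrite ?add0r //.
  by case: sn.
exists (sub g W), Ln; split => //; split => //.
- by split; [apply: (pi_sub_sublattice localF resF)|apply: sublattice_sub].
- exact: subset_trans Ln2 L21.
- by move=> x; rewrite hE -SE.
move=> far; apply: nfar => _ [x Wx <-].
move: (Wx); rewrite hE -SE => -[y [z [Ly [u gu <-] ->]]]; rewrite scalerDr.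
case: sn => _ nD nZ; apply: nD.
  apply: nZ => //; rewrite /ord_ge (ordX localF) ?(pi_neq0 localF) //.
  by rewrite (ord_pi localF) ler0n orbT.
by apply: far; exists u; rewrite // scalerA -exprSr.
Qed.

Let adj_step v w L : adj v w -> v L -> exists M, [/\ w M, scale_set pi L `<=` M & M `<=` L].
Proof.
move=> vw vL; have [Vv _ _ _] := vw; have [g [ug LE vE]] := vertex_lattice Vv vL.
move: vw; rewrite vE LE => /(adjacentP localF resF _ ug)[W rW ->].
exists (sub g W); split; first exact: homothety_class_refl.
  exact: (pi_sub_sublattice localF resF).
exact: sublattice_sub.
Qed.

Let path_near v p L : path (fun a b => `[< adj a b >]) v p -> v L ->
  exists M, [/\ last v p M, scale_set (pi ^+ size p) L `<=` M & M `<=` L].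
Proof.
elim: p v L => [|w p IH] v L /=.
  by move=> _ vL; exists L; rewrite expr0 scale_set1; split.
move=> /andP[/asboolP vw wp] vL; have [M [wM piM ML]] := adj_step vw vL.
have [N [lN piN NM]] := IH w M wp wM; exists N; split => //.
  rewrite exprSr -scale_setM; apply: subset_trans piN; exact: scale_setS.
exact: subset_trans NM ML.
Qed.

(** A path of length m from the class of L0 ends at a module M that contains pi^m L0 and
    lies in L0. If M = c Ln then c is integral, since otherwise Ln, and with it L1 = Ln +
    pi L0, would lie in pi L0. So pi^m L0 is contained in Ln, and m >= n by [chain_far]. *)
Lemma straight_path1_geodesic v p : vertex ord v ->
  path (fun a b => `[< te 1 a b >]) v p -> straight (v :: p) -> one_geodesic ord pi v p.
Proof.
move=> Vv vp st; split.
  split => //; apply: sub_path vp => a b /asboolP[? ? ? [L [L' [? ? ? ? _]]]].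
  by apply/asboolP; split => //; exists L, L'.
move=> p' [_ vp'] lE; case: p vp st lE => // w p vp st lE.
have [L0 vL0] : exists L0, v L0.
  by have [g _ ->] := vertex_class Vv; eexists; apply: homothety_class_refl.
have [L1 [Ln [s0 s1 sn [wL1 lLn] [[pi1 L10] nL1 Ln1 dec nfar]]]] := chain_far vp st vL0.
have [M [lM farM ML0]] := path_near vp' vL0.
have Vl : vertex ord (last v (w :: p)).
  by apply: (path_vertex_last _ Vv vp) => a b /asboolP[].
move: lM; rewrite lE; have [h [_ _ ->]] := vertex_lattice Vl lLn.
move=> [c c0 cE].
have Oc : O c.
  apply/negPn/negP => nOc; apply: nL1 => x /dec[y [z [Ly Lz ->]]].
  case: (submodule_scale pi s0) => _ + _; apply => //.
  have oc : ord c < 0 by move: nOc; rewrite /ord_ge (negPf c0) /= -ltNge.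
  have cy : L0 (c *: y) by apply: ML0; rewrite -cE; exists y.
  exact: (scale_set_pi s0 c0 oc).
rewrite /= ltnNge; apply/negP => le; apply: nfar.
apply: subset_trans (piX_sub s0 le) _; apply: subset_trans farM _; rewrite -cE.
exact: (scale_set_sub sn Oc).
Qed.

(** The two edges give a chain L > L1 > L2 of steps of index q, and the adjacency of v
    and z a multiple c^-1 L2 between pi L and L. A comparison according to the sign of
    the valuation of c shows that pi L lies in L2, so that L, L1, L2 is the chain of a
    chamber. *)
Lemma adjacent_pointed_chamber v w z : te 1 v w -> te 1 w z ->
  adj v z <-> pointed_chamber ord pi (v, w, z).
Proof.
move=> vw wz; split=> [vz|/(pointed_chamber_faces localF resF)[_ _ zv _]]; last first.
  exact: adjacent_type_adjacent (adjacent_type_rev localF resF (isT : (0 < 1 < 3)%N) zv).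
have [Vv Vw nvw _] := vw; have [_ Vz nwz _] := wz; have [_ _ nvz _] := vz.
have [L vL] : exists L, v L.
  by have [g _ ->] := vertex_class Vv; eexists; apply: homothety_class_refl.
have [g [W [ug LE rW wW]]] := chain_step vw vL.
have [h [W2 [uh hE rW2 zW2]]] := chain_step wz wW.
have [M [zM piM ML]] := adj_step vz vL.
have sL : submodule ord L by rewrite LE; apply: (lattice_submodule localF).
have [_ [_ _ zE]] := vertex_lattice Vz zM.
have s2 := sublattice_submodule localF resF W2 uh.
have WL : sub g W `<=` L by rewrite LE; apply: sublattice_sub.
have W2W : sub h W2 `<=` sub g W by rewrite hE; apply: sublattice_sub.
suff piW2 : scale_set pi L `<=` sub h W2.
  split => //; exists L, (sub g W), (sub h W2); split => //; split => //.
move: (zW2); rewrite zE => -[c c0 cE].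
have [oc|oc|oc] := ltgtP (ord c) 0.
- (* Here M lies in pi L, so that z would be v. *)
  case: nvz; have [_ [_ _ ->]] := vertex_lattice Vv vL; rewrite zE.
  have pi0 := pi_neq0 localF.
  suff -> : M = scale_set pi L by rewrite homothety_class_scale.
  apply/seteqP; split => // x Mx.
  have Lcx : L (c *: x) by apply/WL/W2W; rewrite -cE; exists x.
  exact: (scale_set_pi sL c0 oc).
- have W2pi : sub h W2 `<=` scale_set pi L.
    rewrite -cE => _ [x /ML Lx <-]; exists ((c / pi) *: x).
      case: sL => _ _; apply => //; rewrite -(ord_ge_pi localF) add0r.
      rewrite mulrCA divff ?mulr1 ?(pi_neq0 localF) // /ord_ge.
      by apply/orP; right; move: oc; lia.
    by rewrite scalerA mulrCA divff ?mulr1 ?(pi_neq0 localF).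
  apply: contrapT => nsub.
  have : scale_set pi L = lat h.
    apply: (maximal uh rW2) => //; first exact: submodule_scale.
    by rewrite -hE LE; apply: (pi_sub_sublattice localF resF).
  rewrite -hE LE -(sublattice_0 localF resF 3 ug).
  by move/(sublattice_eq resF _ _ ug)/eqmxP/eqmx_rank; rewrite rW mxrank0.
- rewrite -cE (scale_set_unit localF _ c0 oc) //.
  have [g' [ug' -> _]] := vertex_lattice Vz zM; exact: (lattice_submodule localF).
Qed.

Lemma adjacent_sym v w : adj v w -> adj w v.
Proof.
case/(adjacent_types localF resF) => vw.
  exact: adjacent_type_adjacent (adjacent_type_rev localF resF (isT : (0 < 1 < 3)%N) vw).
exact: adjacent_type_adjacent (adjacent_type_rev localF resF (isT : (0 < 2 < 3)%N) vw).
Qed.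

Lemma is_path_rev v p : is_path ord pi v p -> is_path ord pi (last v p) (rev (belast v p)).
Proof.
move=> [Vv vp]; split.
  by apply: (path_vertex_last _ Vv vp) => a b /asboolP[].
by rewrite rev_path; apply: sub_path vp => a b /asboolP ab; apply/asboolP/adjacent_sym.
Qed.

Lemma last_rev_belast v p : last (last v p) (rev (belast v p)) = v.
Proof. by case: p => //= w p; rewrite rev_cons last_rcons. Qed.

(** Paths of type 2 become paths of type 1 by reversal. *)
Lemma straight_path_geodesic i v p : (0 < i < 3)%N -> vertex ord v ->
  path (fun a b => `[< te i a b >]) v p -> straight (v :: p) -> one_geodesic ord pi v p.
Proof.
move=> i3 Vv vp st; have [i1|i2] : i = 1%N \/ i = 2%N by lia.
  by rewrite i1 in vp; apply: straight_path1_geodesic.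
have isp : is_path ord pi v p.
  split => //; apply: sub_path vp => a b /asboolP ab; apply/asboolP.
  exact: adjacent_type_adjacent ab.
have [Vl _] := is_path_rev isp.
have rp : path (fun a b => `[< te 1 a b >]) (last v p) (rev (belast v p)).
  rewrite rev_path; apply: sub_path vp => a b /asboolP; rewrite i2 => ab; apply/asboolP.
  exact: (adjacent_type_rev localF resF (isT : (0 < 2 < 3)%N)) ab.
have rst : straight (last v p :: rev (belast v p)).
  have -> : last v p :: rev (belast v p) = rev (v :: p) by rewrite [in RHS]lastI rev_rcons.
  by apply: straight_rev st => a b; apply: adjacent_sym.
have [_ min] := straight_path1_geodesic Vl rp rst.
split => // p' isp' lE.
have := min (rev (belast v p')); rewrite !size_rev !size_belast; apply.
  by rewrite -lE; apply: is_path_rev.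
by rewrite last_rev_belast -lE last_rev_belast.
Qed.

(** Adjacent vertices two steps apart would provide a shortcut. *)
Lemma geodesic_is_straight v p : one_geodesic ord pi v p -> straight (v :: p).
Proof.
move=> [[Vv vp] min] [|u s1] a b d s2 /= [].
  move=> va pE ad; rewrite va pE in vp min.
  have := min (d :: s2); rewrite /= ltnn => H; suff : false by []; apply: H => //.
  split; first by rewrite -va.
  by move: vp => /= /and3P[_ _ ds]; apply/andP; split => //; apply/asboolP.
move=> vu pE ad; rewrite pE in vp min.
have := min (s1 ++ [:: a, d & s2]); rewrite !size_cat /= leq_add2l ltnn => H.
suff : false by []; apply: H.
  split => //; move: vp; rewrite !cat_path /= => /and5P[-> -> _ _ ->].
  by rewrite andbT /=; apply/asboolP.
by rewrite !last_cat.
Qed.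

End Straight1.
End StraightPaths.

(** * Matrices indexed by finite sets *)

Section FiniteSetMatrices.
Variable S : comNzRingType.

(** The rectangular companion of [mx_on]: [mx_on A f] is convertible to [mx_on2 A A f]. *)
Definition mx_on2 (T U : choiceType) (A : set T) (B : set U) (f : T -> U -> S) :
    'M[S]_(size (fset_set A), size (fset_set B)) :=
  \matrix_(i, j) f (tnth (in_tuple (fset_set A : seq T)) i)
                   (tnth (in_tuple (fset_set B : seq U)) j).

Lemma tnth_fset_set (T : choiceType) (A : set T) i : finite_set A ->
  A (tnth (in_tuple (fset_set A : seq T)) i).
Proof.
move=> fA; have := mem_tnth i (in_tuple (fset_set A : seq T)).
by rewrite in_fset_set // => /set_mem.
Qed.

Lemma tnth_fset_set_inj (T : choiceType) (A : set T) :
  injective (tnth (in_tuple (fset_set A : seq T))).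
Proof.
move=> i j; set x0 := tnth _ i; rewrite /x0 (tnth_nth x0) [tnth _ j](tnth_nth x0) => /eqP.
by rewrite nth_uniq ?fset_uniq // => /eqP /val_inj.
Qed.

Lemma eq_mx_on2 (T U : choiceType) (A : set T) (B : set U) (f g : T -> U -> S) :
  finite_set A -> finite_set B -> (forall a b, A a -> B b -> f a b = g a b) ->
  mx_on2 A B f = mx_on2 A B g.
Proof. by move=> fA fB fg; apply/matrixP => i j; rewrite !mxE fg //; apply: tnth_fset_set. Qed.

Lemma mx_on2_mul (T U V : choiceType) (A : set T) (B : set U) (C : set V)
    (f : T -> U -> S) (g : U -> V -> S) :
  mx_on2 A B f *m mx_on2 B C g =
  mx_on2 A C (fun a c => \sum_(b <- fset_set B) f a b * g b c).
Proof.
apply/matrixP => i j; rewrite !mxE [RHS]big_tnth.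
by apply: eq_bigr => l _; rewrite !mxE.
Qed.

Lemma mx_on2_tr (T U : choiceType) (A : set T) (B : set U) (f : T -> U -> S) :
  (mx_on2 A B f)^T = mx_on2 B A (fun b a => f a b).
Proof. by apply/matrixP => i j; rewrite !mxE. Qed.

Lemma mx_on2_scalar (T : choiceType) (A : set T) (c : S) :
  c%:M = mx_on2 A A (fun a b => c *+ (a == b)).
Proof.
apply/matrixP => i j; rewrite !mxE; congr (_ *+ nat_of_bool _).
by rewrite (inj_eq (@tnth_fset_set_inj _ _)).
Qed.

Lemma mx_on2D (T U : choiceType) (A : set T) (B : set U) (f g : T -> U -> S) :
  mx_on2 A B f + mx_on2 A B g = mx_on2 A B (fun a b => f a b + g a b).
Proof. by apply/matrixP => i j; rewrite !mxE. Qed.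

Lemma mx_on2N (T U : choiceType) (A : set T) (B : set U) (f : T -> U -> S) :
  - mx_on2 A B f = mx_on2 A B (fun a b => - f a b).
Proof. by apply/matrixP => i j; rewrite !mxE. Qed.

Lemma sum_delta (T : choiceType) (A : set T) (f : T -> S) a : finite_set A -> A a ->
  \sum_(x <- fset_set A) f x * (x == a)%:R = f a.
Proof.
move=> fA Aa; have aA : a \in (fset_set A : seq T) by rewrite in_fset_set //; apply/mem_set.
rewrite (bigD1_seq _ aA) ?fset_uniq //= eqxx mulr1 big1 ?addr0 // => x /negPf ->.
by rewrite mulr0.
Qed.

Lemma sum_delta_sym (T : choiceType) (A : set T) (f : T -> S) a : finite_set A -> A a ->
  \sum_(x <- fset_set A) f x * (a == x)%:R = f a.
Proof.
by move=> fA Aa; rewrite -[RHS](sum_delta f fA Aa); apply: eq_bigr => x _; rewrite eq_sym.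
Qed.

Lemma sum_bij (T : choiceType) (A : set T) (P : T -> bool) (I : finType) (h : I -> T) :
  finite_set A -> injective h -> (forall i, A (h i) /\ P (h i)) ->
  (forall x, A x -> P x -> exists i, h i = x) ->
  \sum_(x <- fset_set A) (P x)%:R = #|I|%:R :> S.
Proof.
move=> fA hI hP hS; rewrite -natr_sum; congr _%:R.
have -> : (\sum_(x <- fset_set A) P x = count P (fset_set A))%N.
  by rewrite -sum1_count [RHS]big_mkcond; apply: eq_bigr => x _; case: (P x).
rewrite -size_filter cardE -(size_map h); apply/perm_size/uniq_perm.
- by rewrite filter_uniq ?fset_uniq.
- by rewrite map_inj_uniq ?enum_uniq.
move=> x; rewrite mem_filter in_fset_set //; apply/andP/mapP.
  by move=> [Px /set_mem Ax]; have [i <-] := hS x Ax Px; exists i; rewrite ?mem_enum.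
by move=> [i _ ->]; have [? ?] := hP i; split => //; apply/mem_set.
Qed.

Lemma sum_unique (T : choiceType) (A : set T) (P : T -> bool) a :
  finite_set A -> A a -> P a -> (forall x, A x -> P x -> x = a) ->
  \sum_(x <- fset_set A) (P x)%:R = 1 :> S.
Proof.
move=> fA Aa Pa u; rewrite (@sum_bij _ _ _ unit (fun=> a)) ?card_unit //.
  by case=> [] [].
by move=> x Ax Px; exists tt; rewrite (u x).
Qed.

Lemma sum_none (T : choiceType) (A : set T) (P : T -> bool) :
  finite_set A -> (forall x, A x -> ~ P x) -> \sum_(x <- fset_set A) (P x)%:R = 0 :> S.
Proof.
move=> fA nP; apply: big1_seq => x /andP[_]; rewrite in_fset_set // => /set_mem Ax.
by case E : (P x) => //; case: (nP x Ax).
Qed.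

Lemma card_sum (T : choiceType) (A : set T) (P : T -> bool) : finite_set A ->
  (Defs.card [set x | A x /\ P x])%:R = \sum_(x <- fset_set A) (P x)%:R :> S.
Proof.
move=> fA; rewrite -natr_sum; congr _%:R.
have -> : (\sum_(x <- fset_set A) P x = count P (fset_set A))%N.
  by rewrite -sum1_count [RHS]big_mkcond; apply: eq_bigr => x _; case: (P x).
have fAP : finite_set [set x | A x /\ P x] by apply: sub_finite_set fA => x [].
rewrite -size_filter /Defs.card; apply/perm_size/uniq_perm.
- exact: fset_uniq.
- by rewrite filter_uniq ?fset_uniq.
move=> x; rewrite in_fset_set // mem_filter in_fset_set //.
by apply/idP/andP => [/set_mem[? ?]|[? /set_mem ?]]; [split => //; apply/mem_set|apply/mem_set].
Qed.

End FiniteSetMatrices.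

Lemma card_set_bij (T U : choiceType) (A : set T) (B : set U) (f : T -> U) :
  finite_set A -> set_bij A B f -> Defs.card A = Defs.card B.
Proof.
move=> fA [fAB fI fS]; have fB : finite_set B.
  apply: (@sub_finite_set _ _ (f @` A)); last exact: finite_image.
  by move=> b /fS[a Aa <-]; exists a.
rewrite /Defs.card -(size_map f); apply/perm_size/uniq_perm; last 1 first.
- move=> b; rewrite in_fset_set //; apply/mapP/idP => [[a]|/set_mem /fS[a Aa <-]].
    by rewrite in_fset_set // => /set_mem Aa ->; apply/mem_set/fAB.
  by exists a; rewrite // in_fset_set //; apply/mem_set.
- rewrite map_inj_in_uniq ?fset_uniq // => a b; rewrite !in_fset_set //.
  exact: fI.
- exact: fset_uniq.
Qed.

(** The enumerations of A and B differ by a permutation, which acts on rows and columns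
    alike so that the signs cancel. *)
Lemma det_mx_on_bij (R : comNzRingType) (T U : choiceType) (A : set T) (B : set U)
    (phi : T -> U) (f : T -> T -> R) (g : U -> U -> R) (c : R) :
  finite_set A -> set_bij A B phi ->
  (forall x y, A x -> A y -> f x y = g (phi x) (phi y)) ->
  \det (1%:M - c *: mx_on A f) = \det (1%:M - c *: mx_on B g).
Proof.
move=> fA bij fg; have cAB : size (fset_set A) = size (fset_set B) := card_set_bij fA bij.
have [phiAB phiI phiS] := bij.
have fB : finite_set B.
  apply: (@sub_finite_set _ _ (phi @` A)); last exact: finite_image.
  by move=> b /phiS[a Aa <-]; exists a.
set xA := tnth (in_tuple (fset_set A : seq T)).
set xB := tnth (in_tuple (fset_set B : seq U)).
have Ax i : A (xA i) by apply: tnth_fset_set.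
have mB i : phi (xA i) \in (fset_set B : seq U).
  by rewrite in_fset_set //; apply/mem_set/phiAB.
have lt i : (index (phi (xA i)) (fset_set B : seq U) < size (fset_set B))%N.
  by rewrite index_mem.
pose s0 i := cast_ord (esym cAB) (Ordinal (lt i)).
have xBs i : xB (cast_ord cAB (s0 i)) = phi (xA i).
  by rewrite /xB (tnth_nth (phi (xA i))) /= nth_index.
have s0_inj : injective s0.
  move=> i j /(congr1 (fun l => xB (cast_ord cAB l))); rewrite !xBs => E.
  by apply/(@tnth_fset_set_inj _ A)/phiI => //; apply/mem_set.
pose s := perm s0_inj.
have E : 1%:M - c *: mx_on A f =
    row_perm s (col_perm s (castmx (esym cAB, esym cAB) (1%:M - c *: mx_on B g))).
  apply/matrixP => i j; rewrite !mxE castmxE !mxE /= !esymK !permE.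
  rewrite -/xA -/xB !xBs fg //; congr (_ - _).
  by rewrite (inj_eq (@cast_ord_inj _ _ _)) (inj_eq s0_inj).
rewrite E row_permE col_permE !det_mulmx !det_perm mulrCA mulrC -mulrA.
rewrite odd_permV mulrA -signr_addb addbb expr0 mul1r.
have det_cast m n (mn : m = n) (M : 'M[R]_m) : \det (castmx (mn, mn) M) = \det M.
  by case: n / mn; rewrite castmx_id.
exact: det_cast.
Qed.

(** * Incidence in the quotient complex *)

Section Actions.
Variables (F : fieldType) (Gamma : set 'M[F]_3).
Hypothesis subG : GL3_subgroup Gamma.

(** The laws are required of all matrices: the maps that occur here satisfy them even for
    singular ones, and this keeps Gamma out of the way. *)
Definition is_act (T : Type) (a : 'M[F]_3 -> T -> T) :=
  (forall x, a 1%:M x = x) /\ forall g h x, a (g *m h) x = a g (a h x).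

Lemma act_is_act : is_act (@act F).
Proof.
have img1 (L : set 'cV[F]_3) : [set 1%:M *m x | x in L] = L.
  by apply/seteqP; split => [_ [x Lx <-]|x Lx]; [rewrite mul1mx|exists x; rewrite ?mul1mx].
have imgM (g h : 'M[F]_3) (L : set 'cV[F]_3) :
    [set (g *m h) *m x | x in L] = [set g *m x | x in [set h *m x | x in L]].
  apply/seteqP; split => [_ [x Lx <-]|_ [_ [x Lx <-] <-]].
    by exists (h *m x); [exists x|rewrite mulmxA].
  by exists x; rewrite ?mulmxA.
split=> [v|g h v]; apply/seteqP; split.
- by move=> _ [L vL <-]; rewrite img1.
- by move=> L vL; exists L; rewrite ?img1.
- by move=> _ [L vL <-]; exists [set h *m x | x in L]; rewrite ?imgM //; exists L.
- by move=> _ [_ [L vL <-] <-]; exists L; rewrite ?imgM.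
Qed.

Lemma act2_is_act : is_act (@act2 F).
Proof.
have [a1 aM] := act_is_act.
by split=> [[v w]|g h [v w]]; rewrite /act2 /= ?a1 ?aM.
Qed.

Lemma act3_is_act : is_act (@act3 F).
Proof.
have [a1 aM] := act_is_act; have [b1 bM] := act2_is_act.
by split=> [[v w]|g h [v w]]; rewrite /act3 /= ?a1 ?aM ?b1 ?bM.
Qed.

Lemma act33_is_act : is_act (@act33 F).
Proof.
have [b1 bM] := act3_is_act.
by split=> [[v w]|g h [v w]]; rewrite /act33 /= ?b1 ?bM.
Qed.

Lemma act_set_is_act : is_act (@act_set F).
Proof.
have [a1 aM] := act_is_act; split=> [s|g h s]; apply/seteqP; split.
- by move=> _ [v sv <-]; rewrite a1.
- by move=> v sv; exists v; rewrite ?a1.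
- by move=> _ [v sv <-]; rewrite aM; exists (act h v) => //; exists v.
- by move=> _ [_ [v sv <-] <-]; exists v; rewrite ?aM.
Qed.

Lemma orbit_refl (T : Type) (a : 'M[F]_3 -> T -> T) x : is_act a ->
  Defs.orbit Gamma a x x.
Proof. by move=> [a1 _]; exists 1%:M; [apply: subgroup1 subG|rewrite a1]. Qed.

Lemma orbit_act (T : Type) (a : 'M[F]_3 -> T -> T) x g : is_act a -> Gamma g ->
  Defs.orbit Gamma a (a g x) = Defs.orbit Gamma a x.
Proof.
move=> [a1 aM] Gg; apply/seteqP; split => [_ [h Gh <-]|_ [h Gh <-]].
  by exists (h *m g); [apply: (subgroupM subG)|rewrite aM].
exists (h *m invmx g).
  by apply: (subgroupM subG) => //; apply: (subgroupV subG).
by rewrite -aM mulmxKV //; apply: (subgroup_GL3 subG).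
Qed.

Lemma orbit_eq (T : Type) (a : 'M[F]_3 -> T -> T) x y : is_act a ->
  Defs.orbit Gamma a x = Defs.orbit Gamma a y -> exists2 g, Gamma g & a g x = y.
Proof.
move=> aP E; have : Defs.orbit Gamma a x y by rewrite E; apply: orbit_refl.
by move=> [g Gg <-]; exists g.
Qed.

Lemma image_orbit (T U : Type) (a : 'M[F]_3 -> T -> T) (b : 'M[F]_3 -> U -> U)
    (f : T -> U) x : (forall g y, f (a g y) = b g (f y)) ->
  f @` Defs.orbit Gamma a x = Defs.orbit Gamma b (f x).
Proof.
move=> fab; apply/seteqP; split => [_ [_ [g Gg <-] <-]|_ [g Gg <-]].
  by exists g; rewrite ?fab.
by exists (a g x); [exists g|rewrite fab].
Qed.

End Actions.

Arguments act_is_act {F}.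
Arguments act2_is_act {F}.
Arguments act3_is_act {F}.
Arguments act33_is_act {F}.
Arguments act_set_is_act {F}.

Section QuotientComplex.
Variables (F : fieldType) (ord : F -> int) (pi : F) (q : nat) (Gamma : set 'M[F]_3).
Hypothesis localF : nonarch_local_field ord pi q.
Variables (k : finFieldType) (red : F -> k) (lift : k -> F).
Hypothesis resF : residue_field ord q red lift.
Hypothesis subG : GL3_subgroup Gamma.
Hypothesis KZ_G : forall g, GL3 g -> Gamma `&` conj_KZ ord g = [set 1%:M].
Hypothesis detG : forall g, Gamma g -> (3%:Z %| ord (\det g))%Z.
Hypothesis finV : finite_set (Xvertex ord Gamma).

Local Notation vtx := (set (set 'cV[F]_3)).
Local Notation te := (adjacent_type ord pi q).
Local Notation adj := (adjacent ord pi).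
Local Notation pc := (pointed_chamber ord pi).
Local Notation ov := (Defs.orbit Gamma (@act F)).
Local Notation oe := (Defs.orbit Gamma (@act2 F)).
Local Notation ob := (Defs.orbit Gamma (@act3 F)).
Local Notation XV := (Xvertex ord Gamma).
Local Notation XT := (Xtyped_edge ord pi q Gamma).
Local Notation XE := (Xtyped_edge ord pi q Gamma 1).
Local Notation XB := (Xpointed_chamber ord pi Gamma).
Implicit Types (v w z : vtx).

Let lt13 : (0 < 1 < 3)%N := isT.
Let lt23 : (0 < 2 < 3)%N := isT.

(** Stabilizers of vertices are contained in conjugates of KZ, which meet Gamma
    trivially. *)
Lemma free_action g v : Gamma g -> vertex ord v -> act g v = v -> g = 1%:M.
Proof.
move=> Gg Vv /(stabilizer_conj_KZ localF red (subgroup_GL3 subG Gg) Vv)[h uh hg].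
have : (Gamma `&` conj_KZ ord h) g by [].
by rewrite KZ_G.
Qed.

Lemma oe_eq v w v' w' : oe (v, w) = oe (v', w') ->
  exists g, [/\ Gamma g, act g v = v' & act g w = w'].
Proof.
by move/(orbit_eq subG act2_is_act) => [g Gg [<- <-]]; exists g.
Qed.

(** The action being free, an edge of the quotient has at most one lift with a given end
    point. All counts in the quotient reduce to the building in this way. *)
Lemma oe_lift_unique v w w' : vertex ord v -> oe (v, w) = oe (v, w') -> w = w'.
Proof.
move=> Vv /oe_eq[g [Gg gv <-]]; rewrite (free_action Gg Vv gv).
by rewrite act_is_act.1.
Qed.

Lemma oe_lift_unique_l v w w' : vertex ord v -> oe (w, v) = oe (w', v) -> w = w'.
Proof.
move=> Vv /oe_eq[g [Gg <- gv]]; rewrite (free_action Gg Vv gv).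
by rewrite act_is_act.1.
Qed.

Lemma ob_eq v w z v' w' z' : ob (v, w, z) = ob (v', w', z') ->
  exists g, [/\ Gamma g, act g v = v', act g w = w' & act g z = z'].
Proof.
by move/(orbit_eq subG act3_is_act) => [g Gg [<- <- <-]]; exists g.
Qed.

(** The incidence maps of the quotient. Images of orbits under equivariant maps are
    orbits, by [image_orbit]. *)
Definition qstart (e : set (vtx * vtx)) : set vtx := fst @` e.
Definition qend (e : set (vtx * vtx)) : set vtx := snd @` e.
Definition qswap (e : set (vtx * vtx)) : set (vtx * vtx) := (fun e => (e.2, e.1)) @` e.
Definition qface0 (b : set (vtx * vtx * vtx)) : set (vtx * vtx) := fst @` b.
Definition qface1 (b : set (vtx * vtx * vtx)) : set (vtx * vtx) :=
  (fun c => (c.1.2, c.2)) @` b.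
Definition qface2 (b : set (vtx * vtx * vtx)) : set (vtx * vtx) :=
  (fun c => (c.2, c.1.1)) @` b.
Definition qrot (b : set (vtx * vtx * vtx)) : set (vtx * vtx * vtx) :=
  (fun c => (c.1.2, c.2, c.1.1)) @` b.

Lemma qstartE v w : qstart (oe (v, w)) = ov v.
Proof. exact: image_orbit. Qed.
Lemma qendE v w : qend (oe (v, w)) = ov w.
Proof. exact: image_orbit. Qed.
Lemma qswapE v w : qswap (oe (v, w)) = oe (w, v).
Proof. exact: image_orbit. Qed.
Lemma qface0E v w z : qface0 (ob (v, w, z)) = oe (v, w).
Proof. exact: image_orbit. Qed.
Lemma qface1E v w z : qface1 (ob (v, w, z)) = oe (w, z).
Proof. exact: image_orbit. Qed.
Lemma qface2E v w z : qface2 (ob (v, w, z)) = oe (z, v).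
Proof. exact: image_orbit. Qed.
Lemma qrotE v w z : qrot (ob (v, w, z)) = ob (w, z, v).
Proof. exact: image_orbit. Qed.

Lemma XTP i e : XT i e -> exists v w, te i v w /\ e = oe (v, w).
Proof. by move=> [[v w] vw <-]; exists v, w. Qed.

Lemma XBP b : XB b -> exists v w z, pc (v, w, z) /\ b = ob (v, w, z).
Proof. by move=> [[[v w] z] vwz <-]; exists v, w, z. Qed.

Lemma XT_oe i v w : te i v w -> XT i (oe (v, w)).
Proof. by move=> vw; exists (v, w). Qed.

Lemma XB_ob v w z : pc (v, w, z) -> XB (ob (v, w, z)).
Proof. by move=> vw; exists (v, w, z). Qed.

Lemma te_vertices i v w : te i v w -> vertex ord v /\ vertex ord w.
Proof. by case. Qed.

Let faces v w z := @pointed_chamber_faces _ _ _ _ localF _ _ _ resF v w z.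
Let te_act i g v w (i3 : (0 < i < 3)%N) (Gg : Gamma g) :=
  @act_adjacent_type _ _ _ _ localF _ _ _ resF i g v w i3 (subgroup_GL3 subG Gg).
Let pc_act g v w z (Gg : Gamma g) :=
  @act_pointed_chamber _ _ _ _ localF _ _ _ resF g v w z (subgroup_GL3 subG Gg).

Lemma lift_start i e v : (0 < i < 3)%N -> XT i e -> qstart e = ov v ->
  exists2 w, te i v w & e = oe (v, w).
Proof.
move=> i3 /XTP[v' [w' [vw ->]]]; rewrite qstartE => /(orbit_eq subG act_is_act)[g Gg <-].
exists (act g w'); first exact: te_act.
by rewrite -(orbit_act subG (v', w') act2_is_act Gg).
Qed.

Lemma lift_end i e v : (0 < i < 3)%N -> XT i e -> qend e = ov v ->
  exists2 w, te i w v & e = oe (w, v).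
Proof.
move=> i3 /XTP[v' [w' [vw ->]]]; rewrite qendE => /(orbit_eq subG act_is_act)[g Gg <-].
exists (act g v'); first exact: te_act.
by rewrite -(orbit_act subG (v', w') act2_is_act Gg).
Qed.

Lemma lift_face0 b v w : XB b -> qface0 b = oe (v, w) ->
  exists2 z, pc (v, w, z) & b = ob (v, w, z).
Proof.
move=> /XBP[v' [w' [z' [vw ->]]]]; rewrite qface0E => /oe_eq[g [Gg <- <-]].
exists (act g z'); first exact: pc_act.
by rewrite -(orbit_act subG (v', w', z') act3_is_act Gg).
Qed.

Lemma lift_face1 b v w : XB b -> qface1 b = oe (v, w) ->
  exists2 z, pc (z, v, w) & b = ob (z, v, w).
Proof.
move=> /XBP[v' [w' [z' [vw ->]]]]; rewrite qface1E => /oe_eq[g [Gg <- <-]].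
exists (act g v'); first exact: pc_act.
by rewrite -(orbit_act subG (v', w', z') act3_is_act Gg).
Qed.

Lemma XB_face0 b : XB b -> XE (qface0 b).
Proof. by move=> /XBP[v [w [z [/faces[vw wz zv _] ->]]]]; rewrite qface0E; apply: XT_oe. Qed.
Lemma XB_face1 b : XB b -> XE (qface1 b).
Proof. by move=> /XBP[v [w [z [/faces[vw wz zv _] ->]]]]; rewrite qface1E; apply: XT_oe. Qed.

Lemma XB_rot b : XB b -> XB (qrot b).
Proof. by move=> /XBP[v [w [z [/faces[_ _ _ p] ->]]]]; rewrite qrotE; apply: XB_ob. Qed.
Lemma XT_start i e : XT i e -> XV (qstart e).
Proof. by move=> /XTP[v [w [[Vv _ _ _] ->]]]; rewrite qstartE; exists v. Qed.
Lemma XT_end i e : XT i e -> XV (qend e).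
Proof. by move=> /XTP[v [w [[_ Vw _ _] ->]]]; rewrite qendE; exists w. Qed.

Lemma face0_rot b : XB b -> qface0 (qrot b) = qface1 b.
Proof. by move=> /XBP[v [w [z [_ ->]]]]; rewrite qrotE qface0E qface1E. Qed.
Lemma face1_rot b : XB b -> qface1 (qrot b) = qface2 b.
Proof. by move=> /XBP[v [w [z [_ ->]]]]; rewrite qrotE qface1E qface2E. Qed.
Lemma face2_rot b : XB b -> qface2 (qrot b) = qface0 b.
Proof. by move=> /XBP[v [w [z [_ ->]]]]; rewrite qrotE qface2E qface0E. Qed.
Lemma rot3 b : XB b -> qrot (qrot (qrot b)) = b.
Proof. by move=> /XBP[v [w [z [_ ->]]]]; rewrite !qrotE. Qed.
Lemma end_face0 b : XB b -> qend (qface0 b) = qstart (qface1 b).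
Proof. by move=> /XBP[v [w [z [_ ->]]]]; rewrite qface0E qface1E qendE qstartE. Qed.

(** Elements of Gamma preserve the valuation of determinants modulo 3, which an edge of
    type 1 changes. *)
Lemma no_loop_edge e : XE e -> qstart e <> qend e.
Proof.
move=> /XTP[v [w [vw ->]]]; rewrite qstartE qendE => /(orbit_eq subG act_is_act)[g Gg E].
move: vw; rewrite -E => /(no_loop localF resF (subgroup_GL3 subG Gg)).
by rewrite detG.
Qed.

(** The first face of a fixed point of the rotation would be a loop. *)
Lemma rot_neq b : XB b -> qrot b <> b.
Proof.
move=> Xb E; apply: (no_loop_edge (XB_face0 Xb)).
by rewrite end_face0 // -face0_rot // E.
Qed.

Lemma finE i : (0 < i < 3)%N -> finite_set (XT i).
Proof.
move=> i3; have Xfib v : vertex ord v -> finite_set [set e | XT i e /\ qstart e = ov v].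
  move=> Vv; apply: (@sub_finite_set _ _ ((fun w => oe (v, w)) @` [set w | adj v w])).
    move=> e [Xe /(lift_start i3 Xe)[w vw ->]]; exists w => //.
    exact: adjacent_type_adjacent vw.
  by apply: finite_image; apply: (adjacent_finite localF resF).
apply: (@sub_finite_set _ _ (\bigcup_(o in XV) [set e | XT i e /\ qstart e = o])).
  by move=> e Xe; exists (qstart e); first exact: XT_start Xe.
by apply: bigcup_finite => // o [v Vv <-]; apply: Xfib.
Qed.

Lemma finB : finite_set XB.
Proof.
have fE := finE lt13.
apply: (@sub_finite_set _ _ (\bigcup_(e in XE) [set b | XB b /\ qface0 b = e])).
  by move=> b Xb; exists (qface0 b); first exact: XB_face0.
apply: bigcup_finite => // _ [[v w] vw <-].
have [I [f [_ _ fP]]] := chambers_on_edge localF resF vw.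
apply: (@sub_finite_set _ _ ((fun i => ob (v, w, f i)) @` setT)); last exact: finite_image.
by move=> b [Xb /(lift_face0 Xb)[z /fP[i <-] ->]]; exists i.
Qed.

Lemma XT_swap i e : (0 < i < 3)%N -> XT i e -> XT (3 - i) (qswap e).
Proof.
move=> i3 /XTP[v [w [vw ->]]]; rewrite qswapE; apply: XT_oe.
exact: (adjacent_type_rev localF resF).
Qed.

Lemma qswapK e : qswap (qswap e) = e.
Proof.
apply/seteqP; split => [_ [_ [[v w] ee <-] <-]//|[v w] ee].
by exists (w, v) => //; exists (v, w).
Qed.

Lemma swap_bij i : (0 < i < 3)%N -> set_bij (XT i) (XT (3 - i)) qswap.
Proof.
move=> i3; split.
- by move=> e; apply: XT_swap.
- by move=> e e' _ _ /(congr1 qswap); rewrite !qswapK.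
- move=> e Xe; exists (qswap e); last exact: qswapK.
  have := @XT_swap (3 - i) e _ Xe; rewrite subKn; [apply|]; lia.
Qed.

Lemma qstart_swap e : qstart (qswap e) = qend e.
Proof.
apply/seteqP; split => [_ [_ [[v w] ee <-] <-]|_ [[v w] ee <-]]; first by exists (v, w).
by exists (w, v) => //; exists (v, w).
Qed.

Lemma qend_swap e : qend (qswap e) = qstart e.
Proof. by rewrite -qstart_swap qswapK. Qed.

Let R := fps int.
Let finXE : finite_set XE := finE lt13.
Let finXB := finB.

Definition start_mx := mx_on2 XV XE (fun o e => (qstart e == o)%:R : R).
Definition end_mx := mx_on2 XV XE (fun o e => (qend e == o)%:R : R).
Definition face0_mx := mx_on2 XE XB (fun e b => (qface0 b == e)%:R : R).
Definition face1_mx := mx_on2 XE XB (fun e b => (qface1 b == e)%:R : R).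
Definition face2_mx := mx_on2 XE XB (fun e b => (qface2 b == e)%:R : R).
Definition rot_mx := mx_on2 XB XB (fun b' b => (b' == qrot b)%:R : R).

Let mulb (a b : bool) : a%:R * b%:R = (a && b)%:R :> R.
Proof. by rewrite -natrM mulnb. Qed.

Lemma pc_rot v w z : pc (v, w, z) -> pc (w, z, v).
Proof. by move/faces => []. Qed.

Lemma end_face0_mx : end_mx *m face0_mx = start_mx *m face1_mx.
Proof.
rewrite !mx_on2_mul; apply: eq_mx_on2 => // o b Vo Bb.
rewrite (sum_delta_sym (fun e => (qend e == o)%:R)) //; last exact: XB_face0.
rewrite (sum_delta_sym (fun e => (qstart e == o)%:R)) //; last exact: XB_face1.
by rewrite end_face0.
Qed.

Lemma face0_rot_mx : face0_mx *m rot_mx = face1_mx.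
Proof.
rewrite mx_on2_mul; apply: eq_mx_on2 => // e b Ee Bb.
rewrite (sum_delta (fun b => (qface0 b == e)%:R)) //; last exact: XB_rot.
by rewrite face0_rot.
Qed.

Lemma face1_rot_mx : face1_mx *m rot_mx = face2_mx.
Proof.
rewrite mx_on2_mul; apply: eq_mx_on2 => // e b Ee Bb.
rewrite (sum_delta (fun b => (qface1 b == e)%:R)) //; last exact: XB_rot.
by rewrite face1_rot.
Qed.

Lemma face2_rot_mx : face2_mx *m rot_mx = face0_mx.
Proof.
rewrite mx_on2_mul; apply: eq_mx_on2 => // e b Ee Bb.
rewrite (sum_delta (fun b => (qface2 b == e)%:R)) //; last exact: XB_rot.
by rewrite face2_rot.
Qed.

Lemma rot_mx2 : rot_mx *m rot_mx = mx_on2 XB XB (fun b' b => (b' == qrot (qrot b))%:R : R).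
Proof.
rewrite mx_on2_mul; apply: eq_mx_on2 => // b' b _ Bb.
by rewrite (sum_delta (fun b => (b' == qrot b)%:R)) //; apply: XB_rot.
Qed.

Lemma rot_mx3 : rot_mx *m (rot_mx *m rot_mx) = 1%:M.
Proof.
rewrite rot_mx2 mx_on2_mul (mx_on2_scalar XB 1); apply: eq_mx_on2 => // b' b _ Bb.
rewrite (sum_delta (fun b => (b' == qrot b)%:R)) ?rot3 //.
by do 2!apply: XB_rot.
Qed.

Lemma rot_mx_tr : rot_mx *m rot_mx^T = 1%:M.
Proof.
rewrite mx_on2_tr mx_on2_mul (mx_on2_scalar XB 1); apply: eq_mx_on2 => // b b' Bb Bb'.
under eq_bigr do rewrite mulb.
have [<-|bb'] := eqVneq b b'.
  rewrite (@sum_unique _ _ _ _ (qrot (qrot b))) ?rot3 ?eqxx //.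
    by do 2!apply: XB_rot.
  by move=> c Bc /andP[/eqP -> _]; rewrite rot3.
rewrite sum_none // => c Bc /andP[/eqP bc /eqP b'c].
by rewrite bc b'c eqxx in bb'.
Qed.

Lemma face01_inj b b' : XB b -> XB b' -> qface0 b = qface0 b' -> qface1 b = qface1 b' ->
  b = b'.
Proof.
move=> /XBP[v [w [z [vwz ->]]]] Bb'; rewrite qface0E => /esym/(lift_face0 Bb')[z' vwz' ->].
have [[_ Vw _ _] _ _ _] := faces vwz; rewrite !qface1E => /(oe_lift_unique Vw).
by move=> ->.
Qed.

Lemma count_face0 e : XE e -> \sum_(b <- fset_set XB) (qface0 b == e)%:R = q%:R + 1 :> R.
Proof.
move=> /XTP[v [w [vw ->]]]; have [I [f [cI fI fP]]] := chambers_on_edge localF resF vw.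
rewrite (@sum_bij _ _ _ _ I (fun i => ob (v, w, f i))) //.
- by rewrite cI -addn1 natrD.
- move=> i j /ob_eq[g [Gg gv _ gz]]; apply: fI.
  by rewrite -gz (free_action Gg (te_vertices vw).1 gv) act_is_act.1.
- by move=> i; split; [apply: XB_ob; apply/fP; exists i|rewrite qface0E].
- by move=> b Bb /eqP /(lift_face0 Bb)[z /fP[i <-] ->]; exists i.
Qed.

Lemma count_face1 e : XE e -> \sum_(b <- fset_set XB) (qface1 b == e)%:R = q%:R + 1 :> R.
Proof.
move=> /XTP[v [w [vw ->]]]; have [I [f [cI fI fP]]] := chambers_on_edge localF resF vw.
rewrite (@sum_bij _ _ _ _ I (fun i => ob (f i, v, w))) //.
- by rewrite cI -addn1 natrD.
- move=> i j /ob_eq[g [Gg gz gv _]]; apply: fI.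
  by rewrite -gz (free_action Gg (te_vertices vw).1 gv) act_is_act.1.
- move=> i; split; last by rewrite qface1E.
  by apply: XB_ob; do 2!apply: pc_rot; apply/fP; exists i.
- by move=> b Bb /eqP /(lift_face1 Bb)[z /pc_rot /fP[i <-] ->]; exists i.
Qed.

Lemma face0_mx_tr : face0_mx *m face0_mx^T = (q%:R + 1)%:M.
Proof.
rewrite mx_on2_tr mx_on2_mul (mx_on2_scalar XE); apply: eq_mx_on2 => // e e' Ee Ee'.
under eq_bigr do rewrite mulb.
have [<-|ee'] := eqVneq e e'; first by under eq_bigr do rewrite andbb; rewrite count_face0.
rewrite sum_none // => b Bb /andP[/eqP be /eqP be'].
by rewrite -be -be' eqxx in ee'.
Qed.

Let exb (P : set (vtx * vtx * vtx) -> Prop) := `[< exists2 b, XB b & P b >].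

Lemma sum_face01 e e' :
  \sum_(b <- fset_set XB) ((qface0 b == e) && (qface1 b == e'))%:R =
  (exb (fun b => qface0 b = e /\ qface1 b = e'))%:R :> R.
Proof.
rewrite /exb; case: asboolP => [[b Bb [be be']]|nb]; last first.
  by rewrite sum_none // => b Bb /andP[/eqP ? /eqP ?]; apply: nb; exists b.
rewrite (@sum_unique _ _ _ _ b) ?be ?be' ?eqxx // => c Bc /andP[/eqP ce /eqP ce'].
by apply: face01_inj => //; rewrite ?ce ?ce'.
Qed.

Let M := face1_mx *m face0_mx^T.

Let MtE : M^T =
  mx_on2 XE XE (fun e e' => (exb (fun b => qface0 b = e /\ qface1 b = e'))%:R).
Proof.
rewrite /M trmx_mul trmxK mx_on2_tr mx_on2_mul; apply: eq_mx_on2 => // e e' _ _.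
by under eq_bigr do rewrite mulb; rewrite sum_face01.
Qed.

Let ME : M =
  mx_on2 XE XE (fun e e' => (exb (fun b => qface0 b = e' /\ qface1 b = e))%:R).
Proof. by rewrite -[M]trmxK MtE mx_on2_tr. Qed.

(** The entry at edges e and e' counts the pairs of chambers (t, x, v), (t, x, y) with
    (x, v) = e and (x, y) = e'. For e = e' these are the q + 1 chambers on e; for e <> e'
    with a common origin x, there is one such t because the planes v and y in the link of
    x meet in one line. *)
Lemma face_mx_MMt : M *m M^T = (q%:R)%:M + start_mx^T *m start_mx.
Proof.
rewrite MtE /M -mulmxA !mx_on2_tr !mx_on2_mul (mx_on2_scalar XE) mx_on2D.
apply: eq_mx_on2 => // e e' Ee Ee'.
rewrite (sum_delta_sym (fun o => (qstart e == o)%:R)) //; last exact: XT_start Ee'.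
transitivity (\sum_(b <- fset_set XB)
   ((qface1 b == e) && exb (fun b' => qface0 b' = qface0 b /\ qface1 b' = e'))%:R : R).
  apply: eq_big_seq => b; rewrite in_fset_set // => /set_mem Bb.
  under eq_bigr do rewrite mulrC.
  pose g f : R := (exb (fun b' => qface0 b' = f /\ qface1 b' = e'))%:R.
  by rewrite (sum_delta_sym g) ?mulb //; apply: XB_face0.
have [<-|ee'] := eqVneq e e'.
  rewrite eqxx mulr1n -[RHS](count_face1 Ee); apply: eq_big_seq => b.
  rewrite in_fset_set // => /set_mem Bb; case: eqVneq => //= be.
  by rewrite /exb; case: asboolP => // -[]; exists b.
rewrite mulr0n add0r; have [st|nst] := eqVneq (qstart e) (qstart e'); last first.
  rewrite sum_none // => b Bb /andP[/eqP be /asboolP[b' Bb' [bb' be']]].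
  by move/eqP: nst; apply; rewrite -be -be' -!end_face0 // bb'.
have [x [v [xv eE]]] := XTP Ee; have Vx := (te_vertices xv).1.
have : qstart e' = ov x by rewrite -st eE qstartE.
move=> /(lift_start lt13 Ee')[y xy e'E].
have vy : v <> y by move=> vy; move/eqP: ee'; apply; rewrite eE e'E vy.
have [t [xvt xyt] tu] := two_planes_meet localF resF xv xy vy.
have txv : pc (t, x, v) by do 2!apply: pc_rot.
have txy : pc (t, x, y) by do 2!apply: pc_rot.
rewrite (@sum_unique _ _ _ _ (ob (t, x, v))) //; first exact: XB_ob.
  rewrite qface1E -eE eqxx /=; apply/asboolP; exists (ob (t, x, y)); first exact: XB_ob.
  by rewrite !qface0E qface1E -e'E.
move=> b Bb /andP[/eqP be /asboolP[b' Bb' [bb' be']]].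
rewrite eE in be; have [t' t'xv bE] := lift_face1 Bb be.
rewrite bE qface0E in bb'; have [y' t'xy' b'E] := lift_face0 Bb' bb'.
move: be'; rewrite b'E qface1E e'E => /(oe_lift_unique Vx) y'y.
rewrite bE (tu t') //; first exact: pc_rot.
by apply: pc_rot; rewrite -y'y.
Qed.

(** The dual of [face_mx_MMt]: two lines in a link span one plane. *)
Lemma face_mx_MtM : M^T *m M = (q%:R)%:M + end_mx^T *m end_mx.
Proof.
rewrite {2}ME /M trmx_mul trmxK -mulmxA !mx_on2_tr !mx_on2_mul (mx_on2_scalar XE) mx_on2D.
apply: eq_mx_on2 => // e e' Ee Ee'.
rewrite (sum_delta_sym (fun o => (qend e == o)%:R)) //; last exact: XT_end Ee'.
transitivity (\sum_(b <- fset_set XB)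
   ((qface0 b == e) && exb (fun b' => qface0 b' = e' /\ qface1 b' = qface1 b))%:R : R).
  apply: eq_big_seq => b; rewrite in_fset_set // => /set_mem Bb.
  under eq_bigr do rewrite mulrC.
  pose g f : R := (exb (fun b' => qface0 b' = e' /\ qface1 b' = f))%:R.
  by rewrite (sum_delta_sym g) ?mulb //; apply: XB_face1.
have [<-|ee'] := eqVneq e e'.
  rewrite eqxx mulr1n -[RHS](count_face0 Ee); apply: eq_big_seq => b.
  rewrite in_fset_set // => /set_mem Bb; case: eqVneq => //= be.
  by rewrite /exb; case: asboolP => // -[]; exists b.
rewrite mulr0n add0r; have [st|nst] := eqVneq (qend e) (qend e'); last first.
  rewrite sum_none // => b Bb /andP[/eqP be /asboolP[b' Bb' [bb' be']]].
  by move/eqP: nst; apply; rewrite -be -bb' !end_face0 // be'.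
have [v [x [vx eE]]] := XTP Ee; have Vx := (te_vertices vx).2.
have : qend e' = ov x by rewrite -st eE qendE.
move=> /(lift_end lt13 Ee')[y yx e'E].
have vy : v <> y by move=> vy; move/eqP: ee'; apply; rewrite eE e'E vy.
have xv := adjacent_type_rev localF resF lt13 vx.
have xy := adjacent_type_rev localF resF lt13 yx.
have [t [xtv xty] tu] := two_lines_span localF resF xv xy vy.
have vxt : pc (v, x, t) by do 2!apply: pc_rot.
have yxt : pc (y, x, t) by do 2!apply: pc_rot.
rewrite (@sum_unique _ _ _ _ (ob (v, x, t))) //; first exact: XB_ob.
  rewrite qface0E -eE eqxx /=; apply/asboolP; exists (ob (y, x, t)); first exact: XB_ob.
  by rewrite !qface1E qface0E -e'E.
move=> b Bb /andP[/eqP be /asboolP[b' Bb' [bb' be']]].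
rewrite eE in be; have [t' vxt' bE] := lift_face0 Bb be.
rewrite bE qface1E in be'; have [y' y'xt' b'E] := lift_face1 Bb' be'.
move: bb'; rewrite b'E qface0E e'E => /(oe_lift_unique_l Vx) y'y.
rewrite bE (tu t') //; first exact: pc_rot.
by apply: pc_rot; rewrite -y'y.
Qed.

Let out_deg := out_degree_mul end_face0_mx face0_rot_mx rot_mx_tr face0_mx_tr face_mx_MMt.
Let in_deg := in_degree_mul end_face0_mx face0_rot_mx rot_mx_tr face0_mx_tr face_mx_MtM.

(** Since every vertex is an end point [f e], the transposed incidence matrix can be
    cancelled on the left. *)
Let scalar_of_incidence (f : set (vtx * vtx) -> set vtx) (c : R) X :
    (forall o, XV o -> exists2 e, XE e & f e = o) ->
    (mx_on2 XV XE (fun o e => (f e == o)%:R : R))^T *m X =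
    c *: (mx_on2 XV XE (fun o e => (f e == o)%:R : R))^T ->
  X = c%:M.
Proof.
move=> fS E; apply/matrixP => i j.
have [e Ee fe] := fS _ (tnth_fset_set i finV).
have [l le] : exists l, tnth (in_tuple (fset_set XE : seq _)) l = e.
  have : e \in (fset_set XE : seq _) by rewrite in_fset_set //; apply/mem_set.
  by move/(tnthP (in_tuple _)) => [l]; exists l.
move/matrixP/(_ l j): E; rewrite [LHS]mxE (bigD1 i) //= big1 => [|i' i'i].
  rewrite addr0 !mxE le fe eqxx mul1r => ->.
  by rewrite (inj_eq (@tnth_fset_set_inj _ _)) mulr_natr.
by rewrite !mxE le fe (inj_eq (@tnth_fset_set_inj _ _)) eq_sym (negPf i'i) mul0r.
Qed.

Lemma start_mx_tr : start_mx *m start_mx^T = (q%:R ^+ 2 + q%:R + 1)%:M.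
Proof.
apply: scalar_of_incidence out_deg => _ [v Vv <-].
have [w vw] := adjacent_type_exists localF resF lt13 Vv.
by exists (oe (v, w)); rewrite ?qstartE //; apply: XT_oe.
Qed.

Lemma end_mx_tr : end_mx *m end_mx^T = (q%:R ^+ 2 + q%:R + 1)%:M.
Proof.
apply: scalar_of_incidence in_deg => _ [v Vv <-].
have [w vw] := adjacent_type_exists localF resF lt23 Vv.
have wv := adjacent_type_rev localF resF lt23 vw.
by exists (oe (w, v)); rewrite ?qendE //; apply: XT_oe.
Qed.

Lemma A_mx1E : A_mx ord pi q Gamma 1 = start_mx *m end_mx^T.
Proof.
rewrite mx_on2_tr mx_on2_mul; apply: eq_mx_on2 => // o o' _ _.
under [RHS]eq_bigr do rewrite mulb.
rewrite -(card_sum _ _ finXE); congr (Defs.card _)%:R.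
apply/seteqP; split => e.
  by move=> [Ee <- <-]; split => //; rewrite !eqxx.
by move=> [Ee /andP[/eqP <- /eqP <-]].
Qed.

Lemma A_mx2E : A_mx ord pi q Gamma 2 = end_mx *m start_mx^T.
Proof.
rewrite mx_on2_tr mx_on2_mul; apply: eq_mx_on2 => // o o' _ _.
under [RHS]eq_bigr do rewrite mulb.
rewrite -(card_sum _ _ finXE); congr _%:R.
apply: (@card_set_bij _ _ _ _ qswap).
  by apply: sub_finite_set (finE lt23) => e [].
split.
- move=> e [Ee <- <-]; split; first exact: (XT_swap lt23 Ee).
  by rewrite qend_swap qstart_swap !eqxx.
- by move=> e e' _ _ /(congr1 qswap); rewrite !qswapK.
- move=> e [Ee /andP[/eqP eo /eqP eo']]; exists (qswap e); last exact: qswapK.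
  split; first exact: (XT_swap lt13 Ee).
    by rewrite -[fst @` _]/(qstart (qswap e)) qstart_swap.
  by rewrite -[snd @` _]/(qend (qswap e)) qend_swap.
Qed.

(** The chambers (v2, v3, v4) are those whose first face is the second face of (v1, v2,
    v3), and the excluded case v4 = v1 is the rotation. By uniqueness of lifts each entry
    is 0 or 1, the pairs of chambers in the quotient having at most one orbit above them. *)
Lemma LB_mxE : LB_mx ord pi Gamma = (face0_mx^T *m face1_mx - rot_mx)^T.
Proof.
rewrite linearB /= trmx_mul trmxK !mx_on2_tr mx_on2_mul mx_on2N mx_on2D.
apply: eq_mx_on2 => // c c' Cc Cc'.
rewrite (sum_delta_sym (fun e => (qface1 c == e)%:R)) //; last exact: XB_face0.
have [v [w [z [vwz cE]]]] := XBP Cc; have [[Vv Vw _ _] _ _ _] := faces vwz.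
have [cc'|ncc'] := eqVneq (qface1 c) (qface0 c'); last first.
  rewrite [c' == _](introF eqP) ?subr0; last first.
    by move=> cr; move/eqP: ncc'; rewrite cr face0_rot.
  rewrite (_ : [set a | _] = set0) ?/Defs.card ?fset_set0 //.
  apply/seteqP; split => // a [[[[[v' w'] z'] [[s t] x]]]].
  move=> [/= p1 p2 [-> ->] _] <-.
  rewrite !(@image_orbit F Gamma _ _ _ (@act3 F)) //= => E1 E2.
  by move/eqP: ncc'; rewrite -E1 -E2 qface1E qface0E => /(_ erefl).
have f0 : qface0 c' = oe (w, z) by rewrite -cc' cE qface1E.
have [t wzt c'E] := lift_face0 Cc' f0.
have tv : (c' == qrot c) = `[< t = v >].
  rewrite cE qrotE c'E; apply/eqP/asboolP => [|->] //.
  by move=> /ob_eq[g [Gg gw _ <-]]; rewrite (free_action Gg Vw gw) act_is_act.1.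
rewrite tv; case: asboolP => [tv'|ntv].
  rewrite subrr (_ : [set a | _] = set0) ?/Defs.card ?fset_set0 //.
  apply/seteqP; split => // a [[[[[v' w'] z'] [[s t''] x]]]].
  move=> [/= p1 p2 [-> ->] xv'] <-.
  rewrite !(@image_orbit F Gamma _ _ _ (@act3 F)) //= cE c'E => /ob_eq[g [Gg gv gw gz]].
  rewrite -(orbit_act subG (w', z', x) act3_is_act Gg) /act3 /act2 /= gw gz.
  move=> /ob_eq[h [Gh hw _ hx]]; apply: xv'.
  move: hx; rewrite (free_action Gh Vw hw) act_is_act.1 tv' -gv => E.
  have : act (invmx g) (act g x) = act (invmx g) (act g v') by rewrite E.
  have ug := subgroup_GL3 subG Gg.
  by rewrite -!act_is_act.2 mulVmx // !act_is_act.1.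
rewrite subr0 (_ : [set a | _] = [set Defs.orbit Gamma (@act33 F) ((v, w, z), (w, z, t))]).
  by rewrite /Defs.card fset_set1 cardfs1.
apply/seteqP; split => [a [[[[[v' w'] z'] [[s t''] x]]]]|_ ->].
  move=> [/= p1 p2 [-> ->] xv'] <-.
  rewrite !(@image_orbit F Gamma _ _ _ (@act3 F)) //= cE c'E => /ob_eq[g [Gg gv gw gz]].
  rewrite -(orbit_act subG (w', z', x) act3_is_act Gg) /act3 /act2 /= gw gz.
  move=> /ob_eq[h [Gh hw _ hx]].
  rewrite -(orbit_act subG _ act33_is_act Gg) /act33 /act3 /act2 /= gv gw gz.
  by move: hx; rewrite (free_action Gh Vw hw) act_is_act.1 => ->.
split.
- exists ((v, w, z), (w, z, t)) => //; by split.
- by rewrite (@image_orbit F Gamma _ _ _ (@act3 F)) // cE.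
- by rewrite (@image_orbit F Gamma _ _ _ (@act3 F)) // c'E.
Qed.

(** * Straight continuation, and the numbers of edges and chambers *)

Lemma XT_te i v w : (0 < i < 3)%N -> XT i (oe (v, w)) -> te i v w.
Proof.
by move=> i3 /XTP[v' [w' [vw /esym /oe_eq[g [Gg <- <-]]]]]; apply: te_act.
Qed.

(** Any lift of e extends to a lift of the pair, so that the choice of v does not matter. *)
Definition qstraight i (e e' : set (vtx * vtx)) : bool :=
  `[< exists v w z, [/\ te i v w, te i w z, ~ adj v z, e = oe (v, w) & e' = oe (w, z)] >].

(** An edge e' that starts at the end of e continues it straight unless e and e' are
    consecutive edges of a chamber, by [adjacent_pointed_chamber]. *)
Lemma straight_mxE : mx_on XE (fun e e' => (qstraight 1 e e')%:R : R) =
  (start_mx^T *m end_mx - M)^T.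
Proof.
rewrite linearB /= trmx_mul trmxK MtE mx_on2_tr mx_on2_mul mx_on2N mx_on2D.
apply: eq_mx_on2 => // e e' Ee Ee'.
rewrite (sum_delta_sym (fun o => (qend e == o)%:R)) //; last exact: XT_start Ee'.
have [v [w [vw eE]]] := XTP Ee; have [Vv Vw] := te_vertices vw.
have [st|nst] := eqVneq (qend e) (qstart e'); last first.
  rewrite /exb; case: asboolP => [[b Bb [be be']]|_].
    by move/eqP: nst; rewrite -be -be' end_face0.
  rewrite subrr /qstraight; case: asboolP => // -[v' [w' [z [_ _ _ eE' eE'']]]].
  by move/eqP: nst; rewrite eE' eE'' qendE qstartE.
have : qstart e' = ov w by rewrite -st eE qendE.
move=> /(lift_start lt13 Ee')[z wz e'E].
have pcP := adjacent_pointed_chamber localF resF vw wz.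
rewrite /qstraight /exb; case: asboolP => [[v' [w' [z' [_ _ nadj eE' eE'']]]]|nq].
  case: asboolP => [[b Bb [be be']]|_]; last by rewrite subr0.
  case: nadj; rewrite eE in eE'; have [g [Gg gv gw]] := oe_eq eE'.
  rewrite -gv; have -> : z' = act g z.
    apply: (@oe_lift_unique w').
      by rewrite -gw; apply: act_vertex => //; apply: (subgroup_GL3 subG).
    rewrite -eE'' e'E -gw; apply/esym.
    exact: (orbit_act subG (w, z) act2_is_act Gg).
  apply: (act_adjacent localF resF (subgroup_GL3 subG Gg)); apply/pcP.
  rewrite eE in be; have [t vwt bE] := lift_face0 Bb be.
  by move: be'; rewrite bE qface1E e'E => /(oe_lift_unique Vw) <-.
case: asboolP => [|nb]; first by rewrite subrr.
case: nq; exists v, w, z; split => // /pcP vwz; apply: nb.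
by exists (ob (v, w, z)); [apply: XB_ob|rewrite qface0E qface1E].
Qed.

Lemma qstraight_swap i e e' : (0 < i < 3)%N ->
  qstraight i e e' = qstraight (3 - i) (qswap e') (qswap e).
Proof.
have sub j f f' : (0 < j < 3)%N -> qstraight j f f' -> qstraight (3 - j) (qswap f') (qswap f).
  move=> j3 /asboolP[v [w [z [vw wz nvz -> ->]]]]; apply/asboolP; exists z, w, v.
  rewrite !qswapE; split => //; try exact: (adjacent_type_rev localF resF).
  by move/(adjacent_sym localF resF).
move=> i3; apply/idP/idP; first exact: sub.
have i3' : (0 < 3 - i < 3)%N by lia.
by move/(sub _ _ _ i3'); rewrite !qswapK subKn //; lia.
Qed.

Lemma det_straight1 (c : R) :
  \det (1%:M - c *: mx_on XE (fun e e' => (qstraight 1 e e')%:R : R)) =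
  \det (1%:M - c *: (start_mx^T *m end_mx - M)).
Proof. by rewrite straight_mxE -[LHS]det_tr linearB linearZ /= trmx1 trmxK. Qed.

(** Reversing edges turns straight continuation for type 2 into the transpose of that for
    type 1. *)
Lemma det_straight2 (c : R) :
  \det (1%:M - c *: mx_on (XT 2) (fun e e' => (qstraight 2 e e')%:R : R)) =
  \det (1%:M - c *: (start_mx^T *m end_mx - M)^T).
Proof.
have trE (X : 'M[R]_(size (fset_set XE))) :
    (1%:M - c *: X)^T = 1%:M - c *: X^T by rewrite linearB linearZ /= trmx1.
rewrite -straight_mxE -[RHS]det_tr trE.
have -> : (mx_on XE (fun e e' => (qstraight 1 e e')%:R : R))^T =
    mx_on XE (fun e e' => (qstraight 1 e' e)%:R : R) by apply: mx_on2_tr.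
apply: (@det_mx_on_bij _ _ _ _ _ qswap).
- exact: finE lt23.
- exact: (swap_bij lt23).
- by move=> e e' _ _; rewrite qstraight_swap.
Qed.

Lemma set2_eq (T : Type) (a b c d : T) : [set a; b] = [set c; d] -> a <> b ->
  (a = c /\ b = d) \/ (a = d /\ b = c).
Proof.
move=> E ab; have : [set c; d] a by rewrite -E; left.
have : [set c; d] b by rewrite -E; right.
by move=> [bc|bd] [ac|ad]; [case: ab; rewrite ac bc|right|left|case: ab; rewrite ad bd].
Qed.

Lemma act_set2 g v w : act_set g [set v; w] = [set act g v; act g w].
Proof.
apply/seteqP; split => [_ [x [->|->] <-]|_ [->|->]]; [by left|by right| |].
  by exists v => //; left.
by exists w => //; right.
Qed.

(** Exactly one of the two directions of an edge has type 1, and Gamma preserves types. *)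
Lemma card_Xedge : Defs.card (Xedge ord pi Gamma) = Defs.card XE.
Proof.
pose f (p : vtx * vtx) := [set p.1; p.2].
have fE v w : f @` oe (v, w) = Defs.orbit Gamma (@act_set F) [set v; w].
  by apply: image_orbit => g y; rewrite /f act_set2.
apply/esym/(@card_set_bij _ _ _ _ (fun e => f @` e)) => //; split.
- move=> _ /XTP[v [w [vw ->]]]; rewrite fE; exists [set v; w] => //.
  by exists (v, w) => //; apply: adjacent_type_adjacent vw.
- move=> _ _ /set_mem/XTP[v [w [vw ->]]] /set_mem/XTP[v' [w' [vw' ->]]]; rewrite !fE.
  move=> /(orbit_eq subG act_set_is_act)[g Gg]; rewrite act_set2.
  have gvw := te_act lt13 Gg vw.
  have [_ _ ne _] := gvw.
  move=> E; case: (set2_eq E ne) => -[gv gw].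
    by rewrite -gv -gw; apply/esym/(orbit_act subG (v, w) act2_is_act Gg).
  rewrite gv gw in gvw.
  case: (adjacent_type_excl localF resF vw').
  exact: (adjacent_type_rev localF resF lt13 gvw).
- move=> _ [_ [[v w] /= vw <-] <-].
  case: (adjacent_types localF resF vw) => tvw.
    by exists (oe (v, w)); [apply: XT_oe|rewrite fE].
  exists (oe (w, v)); last by rewrite fE setUC.
  by apply: XT_oe; apply: (adjacent_type_rev localF resF lt23 tvw).
Qed.

(** The edges of type 1 orient the triangle cyclically. *)
Lemma pointed_chamber_unique v w z v' w' z' : pc (v, w, z) -> pc (v', w', z') ->
    [set v; w; z] = [set v'; w'; z'] ->
  [\/ (v', w', z') = (v, w, z), (v', w', z') = (w, z, v) | (v', w', z') = (z, v, w)].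
Proof.
move=> /[dup] vwz [/= _ _ _ [vw wz vz] _] /[dup] vwz' [/= _ _ _ [vw' wz' vz'] _] E.
have [a b c _] := faces vwz; have [a' b' c' _] := faces vwz'.
have ex x y : te 1 x y -> te 1 y x -> False.
  move=> xy yx; apply: (adjacent_type_excl localF resF xy).
  exact: (adjacent_type_rev localF resF lt13 yx).
have mem3 x : [set v; w; z] x -> (x = v \/ x = w) \/ x = z by [].
have V : (v' = v \/ v' = w) \/ v' = z by apply: mem3; rewrite E; left; left.
have W : (w' = v \/ w' = w) \/ w' = z by apply: mem3; rewrite E; left; right.
have Z : (z' = v \/ z' = w) \/ z' = z by apply: mem3; rewrite E; right.
by case: V => [[|]|] ?; subst v'; case: W => [[|]|] ?; subst w';
  case: Z => [[|]|] ?; subst z';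
  first [by constructor 1 | by constructor 2 | by constructor 3 | by case: vw' |
    by case: wz' | by case: vz' | by case: (ex _ _ a a') | by case: (ex _ _ b a') |
    by case: (ex _ _ c a')].
Qed.

Lemma act_set3 g v w z : act_set g [set v; w; z] = [set act g v; act g w; act g z].
Proof.
apply/seteqP; split => [_ [x [[->|->]|->] <-]|_ [[->|->]|->]].
- by left; left.
- by left; right.
- by right.
- by exists v => //; left; left.
- by exists w => //; left; right.
- by exists z => //; right.
Qed.

Let qset3 (b : set (vtx * vtx * vtx)) : set (set vtx) :=
  (fun c => [set c.1.1; c.1.2; c.2]) @` b.

Let qset3E v w z : qset3 (ob (v, w, z)) = Defs.orbit Gamma (@act_set F) [set v; w; z].
Proof. by apply: image_orbit => g y; rewrite act_set3. Qed.

Let qset3_rot b : XB b -> qset3 (qrot b) = qset3 b.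
Proof.
move=> /XBP[v [w [z [_ ->]]]]; rewrite qrotE !qset3E; congr Defs.orbit.
by rewrite setUC setUA.
Qed.

Let qset3_eq b b' : XB b -> XB b' -> qset3 b' = qset3 b ->
  [\/ b' = b, b' = qrot b | b' = qrot (qrot b)].
Proof.
move=> /XBP[v [w [z [vwz ->]]]] /XBP[v' [w' [z' [vwz' ->]]]]; rewrite !qset3E !qrotE.
move=> /(orbit_eq subG act_set_is_act)[g Gg]; rewrite act_set3 => E.
rewrite -(orbit_act subG (v', w', z') act3_is_act Gg) /act3 /act2 /=.
case: (pointed_chamber_unique vwz (pc_act Gg vwz') (esym E)) => ->.
- by constructor 1.
- by constructor 2.
- by constructor 3.
Qed.

(** A chamber has three pointings, permuted cyclically, and they remain distinct modulo
    Gamma by [rot_neq]. *)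
Lemma card_Xchamber : size (fset_set XB) = (3 * Defs.card (Xchamber ord pi Gamma))%N.
Proof.
have XcE : Xchamber ord pi Gamma = qset3 @` XB.
  apply/seteqP; split => [_ [_ [[[v w] z] vwz <-] <-]|_ [b /XBP[v [w [z [vwz ->]]]] <-]].
    by exists (ob (v, w, z)); [apply: XB_ob|rewrite qset3E].
  by rewrite qset3E; exists [set v; w; z] => //; exists (v, w, z).
have finC : finite_set (Xchamber ord pi Gamma) by rewrite XcE; apply: finite_image.
suff : (size (fset_set XB))%:R = (3 * Defs.card (Xchamber ord pi Gamma))%:R :> int.
  by move/eqP; rewrite eqr_nat => /eqP.
have sum1 (T : choiceType) (A : set T) : (size (fset_set A))%:R = \sum_(x <- fset_set A) 1 :> int.
  by rewrite -sum1_size natr_sum.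
rewrite sum1; transitivity (\sum_(b <- fset_set XB)
    \sum_(x <- fset_set (Xchamber ord pi Gamma)) (qset3 b == x)%:R : int).
  apply: eq_big_seq => b; rewrite in_fset_set // => /set_mem Bb.
  under eq_bigr do rewrite -[X in X%:R]mul1n natrM.
  by rewrite (sum_delta_sym (fun=> 1)) // XcE; exists b.
rewrite exchange_big natrM mulrC /Defs.card sum1 big_distrl /=; apply: eq_big_seq => x.
rewrite in_fset_set // mul1r => /set_mem; rewrite XcE => -[b Bb <-].
rewrite (@sum_bij _ _ _ _ 'I_3 (fun i => iter i qrot b)) ?card_ord //.
- have r1 := rot_neq Bb; have r2 : qrot (qrot b) <> b.
    by move=> E; apply: r1; rewrite -{1}E rot3.
  have r12 : qrot (qrot b) <> qrot b by apply: rot_neq (XB_rot Bb).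
  by move=> [[|[|[|//]]] ?] [[|[|[|//]]] ?] /= E; apply: val_inj => //=;
    first [by case: r1|by case: r2|by case: r12|by case: (nesym r1)|
           by case: (nesym r2)|by case: (nesym r12)].
- have Brb := XB_rot Bb.
  move=> [[|[|[|//]]] ?] /=; split => //; rewrite ?qset3_rot //; exact: XB_rot.
- move=> c Bc /eqP /(qset3_eq Bb Bc)[->|->|->].
  + by exists 0.
  + by exists 1.
  + by exists 2.
Qed.

Lemma det_rot_mx : \det (1%:M - fpsX int *: rot_mx) =
  (1 - fpsX int ^+ 3) ^+ Defs.card (Xchamber ord pi Gamma).
Proof.
pose P (b' b : set (vtx * vtx * vtx)) : int := (b' == qrot b)%:R.
have -> : rot_mx = map_mx fps_const (mx_on XB P).
  by apply/matrixP => i j; rewrite !mxE /P; apply: fpsP => -[|n]; case: eqP.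
have P2 : mx_on XB P *m mx_on XB P =
    mx_on XB (fun b' b => (b' == qrot (qrot b))%:R).
  rewrite [LHS]mx_on2_mul; apply: eq_mx_on2 => // b' b _ Bb.
  by rewrite (sum_delta (fun b => (b' == qrot b)%:R)) //; apply: XB_rot.
apply: det_order3; last exact: card_Xchamber.
- rewrite exprS expr2 -!mulmxE P2 [LHS]mx_on2_mul.
  transitivity (1%:M : 'M[int]_(size (fset_set XB))) => //.
  rewrite (mx_on2_scalar XB 1).
  apply: eq_mx_on2 => // b' b _ Bb.
  rewrite (sum_delta (fun b => (b' == qrot b)%:R)) ?rot3 //.
  by do 2!apply: XB_rot.
- rewrite /mxtrace big1 // => i _; rewrite !mxE /P.
  by case: eqP => // /esym /rot_neq; case; apply: tnth_fset_set.
- rewrite expr2 -mulmxE P2 /mxtrace big1 // => i _; rewrite !mxE.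
  have Bi := tnth_fset_set i finXB; case: eqP => // E.
  by case: (rot_neq Bi); rewrite {1}E rot3.
Qed.

(** * Closed geodesics as primitive cycles *)

Lemma path_of_splits (T : Type) (r : rel T) x s :
  (forall s1 a b s2, x :: s = s1 ++ [:: a, b & s2] -> r a b) -> path r x s.
Proof.
elim: s x => //= y s IH x H; rewrite (H [::] x y s erefl) /=.
by apply: IH => s1 a b s2 E; apply: (H (x :: s1) a b s2); rewrite E.
Qed.

(** Every pair of consecutive letters of a cyclic word stands at the beginning of some
    rotation. *)
Lemma cycle_of_rot (T : Type) (r : rel T) C : (1 < size C)%N ->
  (forall n a b s, rot n C = [:: a, b & s] -> r a b) -> cycle r C.
Proof.
case: C => // x s s1 H; apply: path_of_splits => t a b u.
case: (lastP u) => [|u' y] E.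
  have [E1 <-] : (x :: s, x) = (rcons t a, b).
    by apply: rcons_inj; rewrite rcons_cons E -!cats1 -catA.
  apply: (H (size t) a x (behead t)).
  case: t E E1 => [|x' t] E; first by case=> _ s0; move: s1; rewrite s0.
  by move=> [xx' sE]; rewrite sE -xx' -rcons_cons -cats1 rot_size_cat.
have [E1 _] : (x :: s, x) = (t ++ [:: a, b & u'], y).
  by apply: rcons_inj; rewrite rcons_cons E -!rcons_cons -rcons_cat.
by apply: (H (size t) a b (u' ++ t)); rewrite E1 rot_size_cat.
Qed.

Lemma straight_cons a b d s : ~ adj a d -> straight ord pi (b :: d :: s) ->
  straight ord pi [:: a, b, d & s].
Proof.
move=> nad st [|a' s1] x y z s2 /= [].
  by move=> <- _ <-.
by move=> _ E; apply: (st s1 x y z s2).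
Qed.

(** The path is lifted edge by edge: an element of Gamma moves the lift of the next
    corner to the edge lifted last. *)
Lemma lift_straight i v w s : (0 < i < 3)%N -> te i v w ->
    path (qstraight i) (oe (v, w)) s ->
  exists p, [/\ pairmap (fun v w => oe (v, w)) w p = s,
    path (fun v w => `[< te i v w >]) w p & straight ord pi [:: v, w & p]].
Proof.
move=> i3; elim: s v w => [|e s IH] v w vw /=.
  move=> _; exists [::]; split => // -[|a [|b [|d s1]]] //.
move=> /andP[/asboolP[v' [w' [z' [vw' wz' nvz eE ->]]]]].
have [g [Gg gv gw]] := oe_eq (esym eE).
have ug := subgroup_GL3 subG Gg.
have gwz := te_act i3 Gg wz'; rewrite gw in gwz.
have ozE : oe (w', z') = oe (w, act g z').
  by rewrite -gw; apply/esym/(orbit_act subG (w', z') act2_is_act Gg).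
rewrite ozE => /(IH _ _ gwz)[p [ps pp pst]]; exists (act g z' :: p); split => /=.
- by rewrite ps.
- by rewrite pp andbT; apply/asboolP.
apply: straight_cons pst => vz; apply: nvz.
have uV := subgroup_GL3 subG (subgroupV subG Gg).
have := act_adjacent localF resF uV vz.
by rewrite -gv -!act_is_act.2 mulVmx // !act_is_act.1.
Qed.

Lemma Xtyped_directed i e : XT i e -> Xdirected_edge ord pi Gamma e.
Proof. by move=> [[v w] vw <-]; exists (v, w) => //; apply: adjacent_type_adjacent vw. Qed.

Lemma qstraight_incident i e e' : qstraight i e e' -> qend e = qstart e'.
Proof. by move=> /asboolP[v [w [z [_ _ _ -> ->]]]]; rewrite qendE qstartE. Qed.

Lemma no_loop_type i e : (0 < i < 3)%N -> XT i e -> qstart e <> qend e.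
Proof.
move=> i3 Xe; have [i1|i2] : i = 1%N \/ i = 2%N by lia.
  by apply: no_loop_edge; rewrite -i1.
rewrite -qstart_swap -qend_swap; apply/nesym/no_loop_edge.
by have := XT_swap i3 Xe; rewrite i2.
Qed.

Lemma straight_cycle_geodesic i C : (0 < i < 3)%N -> C <> [::] ->
    (forall e, e \in C -> XT i e) -> cycle (qstraight i) C ->
  is_cycle ord pi Gamma C /\
  exists v p, [/\ lifts_to Gamma C v p, one_geodesic ord pi v p &
    path (fun v w => `[< te i v w >]) v p].
Proof.
move=> i3 C0 CX Cr; split.
  split => //; first by move=> e /CX /Xtyped_directed.
  case: C Cr {C0 CX} => //= e s; apply: sub_path => a b /qstraight_incident ab.
  exact/asboolP.
case: C C0 CX Cr => // e s _ CX /=; rewrite rcons_path => /andP[es _].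
have /XTP[v [w [vw eE]]] : XT i e by apply: CX; rewrite mem_head.
rewrite eE in es; have [p [ps pp pst]] := lift_straight i3 vw es.
have vwp : path (fun v w => `[< te i v w >]) v (w :: p).
  by rewrite /= pp andbT; apply/asboolP.
exists v, (w :: p); split => //; first by rewrite /lifts_to /= ps eE.
exact: (straight_path_geodesic localF resF i3 (te_vertices vw).1).
Qed.

(** A tailless cycle has a geodesic lift of each of its rotations, so every corner,
    including that at the starting vertex, is straight. Conversely a cycle with straight
    corners has rotations of the same kind, and their lifts are straight, hence geodesic. *)
Lemma geodesic_classesE i : (0 < i < 3)%N ->
  geodesic_classes ord pi q Gamma i = primitive_classes (XT i) (qstraight i).
Proof.
move=> i3; rewrite /geodesic_classes /primitive_classes; congr image.
apply/seteqP; split => C /=.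
  move=> [[[C0 CD Cc] _] CX tail prim].
  have st n a b s : rot n C = [:: a, b & s] -> qstraight i a b.
    move=> rC; have [|_ [v [p [lft geo]]]] := tail (rot n C); first by exists n.
    have /= := geodesic_is_straight geo; move: lft; rewrite /lifts_to rC.
    case: p {geo} => [|w [|z p]] //= [aE bE _] /(_ [::] v w z p erefl) nvz.
    have Xa : XT i a by apply: CX; rewrite -(mem_rot n) rC mem_head.
    have Xb : XT i b by apply: CX; rewrite -(mem_rot n) rC !inE eqxx orbT.
    apply/asboolP; exists v, w, z; split => //.
      by apply: (XT_te i3); rewrite aE.
    by apply: (XT_te i3); rewrite bE.
  (* A cycle with a single edge would be a loop. *)
  have szC : (1 < size C)%N.
    case: C C0 Cc CX {CD tail prim st} => [|e [|e' s]] //= _ /andP[/asboolP ee _] CX.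
    by case: (no_loop_type i3 (CX e (mem_head _ _))).
  split => //; first exact: cycle_of_rot.
  move=> [D [n [n1 CDn]]]; apply: prim; exists D, n; split => //.
  have n0 : (0 < n)%N by apply: ltnW.
  split.
  - by move=> D0; apply: C0; rewrite CDn D0; elim: (n).
  - by move=> e eD; apply: CD; rewrite CDn mem_wpow.
  - by rewrite -(cycle_wpow _ _ n0) -CDn.
move=> [C0 CX Cr prim]; have [cycC [v [p [lft geo tep]]]] := straight_cycle_geodesic i3 C0 CX Cr.
split => //.
- split => //; exists v, p; split => //; split => //; exists i => //.
  by rewrite !inE; lia.
- move=> C' [n ->].
  have [|||cyc [v' [p' [lft' geo' _]]]] := @straight_cycle_geodesic i (rot n C) i3.
  + by move/(congr1 (rotr n)); rewrite rotK.
  + by move=> e; rewrite mem_rot; apply: CX.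
  + by rewrite rot_cycle.
  by split => //; exists v', p'.
- by move=> [D [n [cD n1 CDn]]]; apply: prim; exists D, n.
Qed.

Lemma zeta_typeE i : (0 < i < 3)%N -> zeta_type ord pi q Gamma i =
  (\det (1%:M - fpsX int ^+ i *: mx_on (XT i) (fun e e' => (qstraight i e e')%:R)))^-1.
Proof.
move=> i3; rewrite /zeta_type geodesic_classesE //.
by apply: (euler_product _ (finE i3)); case/andP: i3.
Qed.

Let coef0 (f : fps int) : int := f 0%N.

Let coef0_det n (X : 'M[fps int]_n) : \det X 0%N = \det (map_mx coef0 X).
Proof.
have c0M (f g : fps int) : coef0 (f * g) = coef0 f * coef0 g by apply: fps_coefM0.
rewrite /determinant fps_coef_sum; apply: eq_bigr => s _.
rewrite fps_coefM0; congr (_ * _); first by case: odd_perm.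
by rewrite [LHS](big_morph coef0 c0M (erefl : coef0 1 = 1)); apply: eq_bigr => l _; rewrite mxE.
Qed.

Let unit_det n (X : 'M[fps int]_n) : map_mx coef0 X = 1%:M -> \det X \is a GRing.unit.
Proof. by move=> X0; rewrite fps_unitE coef0_det X0 det1 unitr1. Qed.

Let coef0D f g : coef0 (f + g) = coef0 f + coef0 g. Proof. by []. Qed.
Let coef0N f : coef0 (- f) = - coef0 f. Proof. by []. Qed.
Let coef0M f g : coef0 (f * g) = coef0 f * coef0 g. Proof. exact: fps_coefM0. Qed.
Let coef0X : coef0 (fpsX int) = 0. Proof. by []. Qed.

Let coef0n b : coef0 b%:R = b%:R.
Proof. by elim: b => // b IH; rewrite -!natr1 coef0D IH. Qed.
Let coef0Xn n : coef0 (fpsX int ^+ n.+1) = 0.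
Proof. by rewrite exprS coef0M coef0X mul0r. Qed.

(** [complex_det_identity] for the matrices of the quotient, up to transposition. All
    determinants are invertible because the matrices are 1 at u = 0. *)
Theorem zeta_det : let u := fpsX int in
  zeta ord pi q Gamma =
    (1 - u ^+ 3) ^ euler_char ord pi Gamma /
    (\det (1%:M - u *: A_mx ord pi q Gamma 1 + (q%:R * u ^+ 2) *: A_mx ord pi q Gamma 2
           - (q%:R ^+ 3 * u ^+ 3)%:M)
     * \det (1%:M + u *: LB_mx ord pi Gamma)).
Proof.
move=> u; rewrite /zeta !zeta_typeE // expr1 det_straight1 det_straight2.
set L := start_mx^T *m end_mx - M.
have u3 : 1 - u ^+ 3 \is a GRing.unit.
  by rewrite fps_unitE -[_ 0%N]/(coef0 _) coef0D coef0N coef0Xn subr0.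
have unit_vertex (c : R) B1 B2 : coef0 c = 0 -> vertex_mx (q%:R : R) c B1 B2 \in
    (@unitmx _ (size (fset_set XV))).
  move=> c0; rewrite unitmxE; apply: unit_det; apply/matrixP => i j.
  rewrite !mxE !(coef0D, coef0N, coef0M, expr2, exprS, coef0n, c0, mul0r, mulr0, subr0, addr0).
  have -> b : coef0 (q%:R * (q%:R * q%:R) * (c * (c * c)) *+ b) = 0.
    by elim: b => [|b IH]; rewrite ?mulr0n // mulrS coef0D IH addr0 !coef0M c0 mul0r mulr0.
  by rewrite subr0; case: eqP.
have unitN : chamber_mx M (q%:R : R) u \in unitmx.
  rewrite unitmxE; apply: unit_det; apply/matrixP => i j.
  rewrite !mxE !(coef0D, coef0M, coef0Xn, coef0X, mul0r, mulr0, addr0).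
  by case: eqP => _; rewrite ?mulr0n ?mulr1n // coef0D coef0M coef0Xn mulr0 addr0.
have vX2 : coef0 (u ^+ 2) = 0 by apply: coef0Xn.
pose U : R := 1 - u ^+ 3.
pose dA := \det (vertex_mx (q%:R : R) u (end_mx *m start_mx^T) (start_mx *m end_mx^T)).
pose dB := \det (1%:M + u *: (face0_mx^T *m face1_mx - rot_mx)).
pose d1 := \det (1%:M - u *: L); pose d2 := \det (1%:M - u ^+ 2 *: L^T).
have key : U ^+ size (fset_set XV) * U ^+ Defs.card (Xchamber ord pi Gamma) * (d1 * d2) =
    U ^+ size (fset_set XE) * (dA * dB).
  rewrite -det_rot_mx; exact: (complex_det_identity end_face0_mx face0_rot_mx face1_rot_mx
    face2_rot_mx rot_mx_tr rot_mx3 face0_mx_tr face_mx_MMt face_mx_MtM start_mx_tr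
    end_mx_tr unitN (unit_vertex _ _ _ vX2) u3).
have dL : \det (1%:M + u *: LB_mx ord pi Gamma) =
    \det (1%:M + u *: (face0_mx^T *m face1_mx - rot_mx)).
  have trE n (X : 'M[R]_n) : (1%:M + u *: X)^T = 1%:M + u *: X^T.
    by apply/matrixP => i j; rewrite !mxE eq_sym.
  by rewrite LB_mxE -[LHS]det_tr trE trmxK.
have dV : \det (1%:M - u *: A_mx ord pi q Gamma 1 + (q%:R * u ^+ 2) *: A_mx ord pi q Gamma 2
    - (q%:R ^+ 3 * u ^+ 3)%:M) =
    \det (vertex_mx q%:R u (end_mx *m start_mx^T) (start_mx *m end_mx^T)).
  have trE n (X Y : 'M[R]_n) (a b c : R) : (1%:M - a *: X + b *: Y - c%:M)^T =
      1%:M - a *: X^T + b *: Y^T - c%:M.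
    by apply/matrixP => i j; rewrite !mxE eq_sym.
  by rewrite A_mx1E A_mx2E -[LHS]det_tr trE !trmx_mul !trmxK.
rewrite dL dV; suff : d1^-1 / d2 = U ^ euler_char ord pi Gamma / (dA * dB) by [].
have ud1 : d1 \is a GRing.unit.
  apply: unit_det; apply/matrixP => i j; rewrite !mxE coef0D coef0N coef0M coef0X mul0r subr0.
  by case: eqP.
have ud2 : d2 \is a GRing.unit.
  apply: unit_det; apply/matrixP => i j; rewrite !mxE coef0D coef0N coef0M coef0Xn mul0r subr0.
  by case: eqP.
have udA : dA \is a GRing.unit by have := unit_vertex u (end_mx *m start_mx^T) (start_mx *m end_mx^T) coef0X; rewrite unitmxE.
have udB : dB \is a GRing.unit.
  apply: unit_det; apply/matrixP => i j; rewrite !mxE coef0D coef0M coef0X mul0r addr0.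
  by case: eqP.
have uU : U \is a GRing.unit by [].
rewrite /euler_char card_Xedge; exact: (unit_quotient uU udA udB ud1 ud2 key).
Qed.

End QuotientComplex.

(** * Finiteness of the quotient *)

Section Finiteness.
Variables (F : fieldType) (ord : F -> int) (pi : F) (q : nat) (Gamma : set 'M[F]_3).
Hypothesis localF : nonarch_local_field ord pi q.
Hypothesis subG : GL3_subgroup Gamma.
Variables (k : finFieldType) (red : F -> k) (lift : k -> F).
Hypothesis resF : residue_field ord q red lift.
Local Notation lat := (lattice_of ord).

Lemma matrix_ord_bound m n (A : 'M[F]_(m, n)) : exists b, forall i j, ord_ge ord b (A i j).
Proof.
exists (- \sum_(p : 'I_m * 'I_n) `|ord (A p.1 p.2)|) => i j; apply/orP; right.
rewrite lerNl (bigD1 (i, j)) //= -[leLHS]addr0 lerD //; last exact: sumr_ge0.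
by rewrite -normrN ler_norm.
Qed.

Lemma lattice_mulr g A : integral ord A -> A \in unitmx -> integral ord (invmx A) ->
  lat (g *m A) = lat g.
Proof.
have sub h B : integral ord B -> lat (h *m B) `<=` lat h.
  move=> OB _ [x Ox <-]; exists (B *m x); last by rewrite mulmxA.
  by move=> i; apply: (integral_mul localF OB) => a b; rewrite [b]ord1; apply: Ox.
move=> OA uA OV; apply/seteqP; split; first exact: sub.
by rewrite -{1}[g](mulmxK uA); apply: sub.
Qed.

(** For h close to g the matrix g^-1 h is integral and congruent to 1 modulo pi, hence in
    GL_3(O). *)
Lemma lattice_locally_constant g : GL3 g ->
  exists n, forall h : 'M_3, (forall i j, ord_ge ord n (h i j - g i j)) -> lat h = lat g.
Proof.
move=> ug; have [b gb] := matrix_ord_bound (invmx g); exists (1 - b) => h hg.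
pose D := invmx g *m (h - g).
have D1 i j : ord_ge ord 1 (D i j).
  rewrite mxE; elim/big_ind: _ => [|x y x1 y1|l _]; first by rewrite /ord_ge eqxx.
    exact: (ord_geD localF).
  by rewrite -[1](subrKC b); apply: (ord_geM localF) => //; rewrite !mxE.
have OD i j : ord_ge ord 0 (D i j) by apply: (ord_ge_le _ (D1 i j)).
have O1M : integral ord (1%:M : 'M[F]_3).
  by move=> i j; rewrite mxE; case: (i == j); [apply: O1 localF|apply: O0].
have OA : integral ord (1%:M + D) by move=> i j; rewrite mxE; apply: (ord_geD localF (O1M i j)).
have rA : map_mx red (1%:M + D) = 1%:M.
  apply/matrixP => i j; rewrite mxE [X in red X]mxE (redD resF) // [RHS]mxE.
  have /eqP -> : red (D i j) == 0 by rewrite (red_eq0 resF).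
  by rewrite addr0 mxE; case: (i == j); [exact: red1 resF|exact: red0 resF].
have [uA OV] : 1%:M + D \in unitmx /\ integral ord (invmx (1%:M + D)).
  by apply: (integral_unit localF resF OA); rewrite rA unitmx1.
suff -> : h = g *m (1%:M + D) by apply: lattice_mulr.
by rewrite mulmxDr mulmx1 mulKVmx // addrC subrK.
Qed.

Local Notation class g := (Defs.orbit Gamma (@act F) (homothety_class (lat g))).

Lemma class_dcoset g h : GL3 g -> dcoset Gamma g = dcoset Gamma h -> class g = class h.
Proof.
move=> ug E; have : dcoset Gamma g g.
  exists 1%:M, 1; split; [exact: subgroup1 subG|exact: oner_neq0|].
  by rewrite mul1mx mulmx1.
rewrite E => -[gam [c [Gg c0 ->]]].
have -> : lat (gam *m h *m c%:M) = scale_set c (lat (gam *m h)).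
  rewrite mul_mx_scalar; apply/seteqP; split => [_ [x Ox <-]|_ [_ [x Ox <-] <-]].
    by exists (gam *m h *m x); [exists x|rewrite scalemxAl].
  by exists x; rewrite // scalemxAl.
rewrite homothety_class_scale // -img_lattice -act_class.
by rewrite (orbit_act subG) //; apply: act_is_act.
Qed.

Let dcoset_of (g : 'M[F]_3) (ug : GL3 g) : dcoset_space ord Gamma :=
  exist _ (dcoset Gamma g) (mem_set (ex_intro2 _ _ g ug erefl)).

(** A base point, as required by [compact_cover]. *)
HB.instance Definition _ :=
  isPointed.Build (dcoset_space ord Gamma) (dcoset_of (unitmx1 F 3)).

(** Each double coset determines a vertex of the quotient. The sets of double cosets with
    a given vertex are open and cover a compact space, and every vertex arises. *)
Lemma finite_Xvertex : compact [set: dcoset_space ord Gamma] ->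
  finite_set (Xvertex ord Gamma).
Proof.
pose U (o : set (set (set 'cV[F]_3))) : set (dcoset_space ord Gamma) :=
  [set d | exists g, [/\ GL3 g, val d = dcoset Gamma g & class g = o]].
rewrite compact_cover => /(_ _ (Xvertex ord Gamma) U) [o _|d _|D DX cov].
- split=> [g []//|g [ug [d [h [uh dh <-]] dg]]].
  have [n near] := lattice_locally_constant ug; exists n => h' uh' /near E; split=> //.
  exists (dcoset_of uh') => //; exists h'; split=> //.
  by rewrite E; apply: class_dcoset; rewrite // -dg.
- have [g ug dg] := set_mem (valP d).
  by exists (class g); [exists (homothety_class (lat g)) => //; exists g|exists g].
apply: (sub_finite_set (B := [set` D])); last exact: finite_fset.
move=> _ [_ [g ug <-] <-].
have [o Do [h [uh /= E Eo]]] := cov (dcoset_of ug) I.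
by rewrite (class_dcoset ug E) Eo.
Qed.

End Finiteness.

Theorem theoremC (F : fieldType) (ord : F -> int) (pi : F) (q : nat)
    (Gamma : set 'M[F]_3)
    (localF : nonarch_local_field ord pi q)
    (subG : GL3_subgroup Gamma)
    (discrG : discrete_subgroup ord Gamma)
    (torfG : torsion_free Gamma)
    (cocomptG : compact [set: dcoset_space ord Gamma])
    (KZ_G : forall g, GL3 g -> Gamma `&` conj_KZ ord g = [set 1%:M])
    (detG : forall g, Gamma g -> (3%:Z %| ord (\det g))%Z) :
  let u := fpsX int in
  let A1 := A_mx ord pi q Gamma 1 in
  let A2 := A_mx ord pi q Gamma 2 in
  let LB := LB_mx ord pi Gamma in
  zeta ord pi q Gamma =
    (1 - u ^+ 3) ^ euler_char ord pi Gamma /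
    (\det (1%:M - u *: A1 + (q%:R * u ^+ 2) *: A2 - (q%:R ^+ 3 * u ^+ 3)%:M)
     * \det (1%:M + u *: LB)).
Proof.
have [k [red [lift resF]]] := residue_field_exists localF.
exact: (zeta_det localF resF subG KZ_G detG (finite_Xvertex localF subG resF cocomptG)).
Qed.
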